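(* Let $(M,g)$ be an oriented Riemannian 4-manifold with a metric connection $D$, and let $SM$ carry the associated $G_2$ structure $\phi$. In the decomposition $d\phi=\tau_0*\phi+\frac34\tau_1\wedge\phi+*\tau_3$ of $d\phi$ into its $G_2$-torsion forms, one has $\tau_0=\frac27(\underline r-l+6)$.
   Context: Setting. $(M,g)$ is an oriented Riemannian 4-manifold, $\langle\,,\rangle=g$, $D$ is a linear connection on $TM$ with $Dg=0$ and curvature $R^D(X,Y)=D_XD_Y-D_YD_X-D_{[X,Y]}$. $SM=\{u\in TM:\|u\|=1\}$, $f:SM\to M$ is the projection, and $U$ is the section of $f^*TM$ with $U_u=u$. One has $T\,SM=\mathcal V\oplus\mathcal H$ with $\mathcal V=\ker df$, $\mathcal H=\{X:(f^*D)_XU=0\}$; $\mathcal H_u\simeq T_{f(u)}M$ via $df$ and $\mathcal V_u\simeq u^\perp\subset T_{f(u)}M$ via $X\mapsto (f^*D)_XU$. $SM$ carries the metric (still $g$) for which $\mathcal H\perp\mathcal V$ and both identifications are isometries. Adapted frame. At $u\in SM$ take a direct orthonormal basis $e_0=u,e_1,e_2,e_3$ of $T_{f(u)}M$; the same symbols denote its horizontal lift to $\mathcal H_u$, and $e_{i+3}\in\mathcal V_u$ ($i=1,2,3$) denotes the vertical vector corresponding to $e_i$. $e^0,\dots,e^6$ is the dual coframe, $e^{ij\cdots}=e^i\wedge e^j\wedge\cdots$, and $SM$ is oriented by $e^{0123456}$; $*$ is the Hodge operator of $SM$. The following forms do not depend on the adapted frame: $\mu=e^0$, $\beta=e^{14}+e^{25}+e^{36}$,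 $\alpha=e^{456}$, $\alpha_1=e^{156}+e^{264}+e^{345}$, $\alpha_2=e^{126}+e^{234}+e^{315}$, $\mathrm{vol}=f^*\mathrm{vol}_M=e^{0123}$. The $G_2$ structure is $\phi=\alpha+\mu\wedge\beta-\alpha_2$, with $*\phi=\mathrm{vol}-\frac12\beta^2-\mu\wedge\alpha_1$. Torsion forms. The decomposition of $d\phi$ is the unique one with $\tau_0\in\Omega^0$, $\tau_1\in\Omega^1$ and $\tau_3\in\Omega^3_{27}=\{\gamma\in\Omega^3:\gamma\wedge\phi=\gamma\wedge*\phi=0\}$. Curvature quantities. $R_{ijkl}=\langle R^D(e_i,e_j)e_k,e_l\rangle$ for $0\le i,j,k,l\le3$; $r(X,Y)=\mathrm{Tr}(Z\mapsto R^D(Z,X)Y)$; $\underline r=r(U,U)=\sum_jR_{j00j}$ (a function on $SM$); $l=R_{1230}+R_{2310}+R_{3120}$. *)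

(* Defs.v *)
From mathcomp Require Import all_boot all_order all_algebra all_fingroup.
From mathcomp Require Import all_classical all_reals all_analysis.
Set Implicit Arguments.
Unset Strict Implicit.
Unset Printing Implicit Defensive.
Import Order.TTheory GRing.Theory Num.Theory numFieldNormedType.Exports.
Local Open Scope classical_set_scope.
Local Open Scope ring_scope.

(** ** Smooth functions on open subsets of R^n *)

Fixpoint Ck (R : realType) (n k : nat) (B : set 'rV[R]_n)
    (F : 'rV[R]_n -> R) : Prop :=
  (forall x, B x -> {for x, continuous F}) /\
  (if k is k'.+1 then
     forall i : 'I_n, (forall x, B x -> derivable F x (delta_mx 0 i)) /\
       Ck k' B (fun x => 'D_(delta_mx 0 i) F x)
   else True).

Definition Cinfty (R : realType) (n : nat) (B : set 'rV[R]_n)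
    (F : 'rV[R]_n -> R) : Prop := forall k, Ck k B F.

(** ** Spaces with smooth functions

A point set with, at each point [x], the filter of neighbourhoods of [x] and
the functions that are smooth on some neighbourhood of [x].  Only the instances
[mspace] (a smooth manifold) and [sphere_bundle] below are used. *)

Record diffSpace (R : realType) := DiffSpace {
  dpoint :> Type;
  dnbhs : dpoint -> set (set dpoint);
  smooth_at : dpoint -> (dpoint -> R) -> Prop }.

Definition tvec (R : realType) (X : diffSpace R) : Type := (X -> R) -> R.

(* T_x X: derivations at x of the functions smooth near x (they depend on germs
   only, by the Leibniz rule).  The value on other functions is normalised to 0,
   so that equality of tangent vectors is equality of functions. *)
Definition tangent (R : realType) (X : diffSpace R) (x : X) (v : tvec X) :
    Prop :=
  [/\ forall h, ~ smooth_at x h -> v h = 0,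
      forall a h k, smooth_at x h -> smooth_at x k ->
        v (fun y => a * h y + k y) = a * v h + v k
    & forall h k, smooth_at x h -> smooth_at x k ->
        v (fun y => h y * k y) = v h * k x + h x * v k].

Definition differential (R : realType) (X Y : diffSpace R) (f : X -> Y) (x : X)
    (v : tvec X) : tvec Y :=
  fun h => if `[< smooth_at (f x) h >] then v (fun y => h (f y)) else 0.

(* [s] is a smooth section of f^*TY on a neighbourhood of x *)
Definition smooth_section_at (R : realType) (X Y : diffSpace R) (f : X -> Y)
    (x : X) (s : X -> tvec Y) : Prop :=
  dnbhs x [set y | tangent (f y) (s y)] /\
  forall h, smooth_at (f x) h -> smooth_at x (fun y => s y h).

Definition smooth_field_at (R : realType) (X : diffSpace R) (x : X)
    (V : X -> tvec X) : Prop :=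
  smooth_section_at (fun y : X => y) x V.

Definition bracket (R : realType) (X : diffSpace R) (V W : X -> tvec X) :
    X -> tvec X :=
  fun x h => if `[< smooth_at x h >]
             then V x (fun y => W y h) - W x (fun y => V y h) else 0.

(** ** Differential forms

A [k]-form is evaluated on [k] tangent vectors; its values on non-tangent
arguments are irrelevant. *)

Definition dform (R : realType) (X : diffSpace R) (k : nat) : Type :=
  X -> ('I_k -> tvec X) -> R.

Definition is_form (R : realType) (X : diffSpace R) (k : nat)
    (w : dform X k) : Prop :=
  [/\ forall (x : X) (v : 'I_k -> tvec X) (i : 'I_k) (a : R) (y z : tvec X),
        (forall j, tangent x (v j)) -> tangent x y -> tangent x z ->
        w x [eta v with i |-> a *: y + z] =
          a * w x [eta v with i |-> y] + w x [eta v with i |-> z],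
      forall (x : X) (v : 'I_k -> tvec X) (i j : 'I_k),
        (forall j, tangent x (v j)) -> i != j -> v i = v j -> w x v = 0
    & forall (x : X) (V : 'I_k -> X -> tvec X),
        (forall i, smooth_field_at x (V i)) ->
        smooth_at x (fun y => w y (fun i => V i y))].

(* exterior product, normalised so that e^1 /\ ... /\ e^k is a determinant *)
Definition wedge (R : realType) (V : Type) (p q : nat)
    (w : ('I_p -> V) -> R) (h : ('I_q -> V) -> R) : ('I_(p + q) -> V) -> R :=
  fun v => (p`! * q`!)%N%:R^-1 *
    \sum_(s : 'S_(p + q)) (-1) ^+ s *
      (w (fun i => v (s (lshift q i))) * h (fun j => v (s (rshift p j)))).

(* e^{s_0 s_1 ...} for a coframe [theta] *)
Definition emono (R : realType) (V : Type) (n : nat)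
    (theta : 'I_n.+1 -> V -> R) (s : seq nat) : ('I_(size s) -> V) -> R :=
  fun v => \det (\matrix_(a, b) theta (inord (nth 0%N s a)) (v b)).
Arguments emono {R V n} theta s _.

Definition fcons (V : Type) (k : nat) (x : V) (v : 'I_k -> V) : 'I_k.+1 -> V :=
  fun a => oapp v x (unlift ord0 a).

Definition fcat (V : Type) (p q : nat) (x : 'I_p -> V) (y : 'I_q -> V) :
    'I_(p + q) -> V :=
  fun a => match fintype.split a with inl i => x i | inr j => y j end.

(* Hodge star [star w] : star w (v) = 1/p! sum_I w(e_I) vol(e_I, v), for a direct
   orthonormal frame [e] with dual coframe [theta]; this is the convention
   a /\ star b = <a, b> vol. *)
Definition hodge (R : realType) (V : Type) (p q : nat)
    (theta : 'I_(p + q) -> V -> R) (e : 'I_(p + q) -> V)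
    (w : ('I_p -> V) -> R) : ('I_q -> V) -> R :=
  fun v => p`!%:R^-1 *
    \sum_(I : {ffun 'I_p -> 'I_(p + q)})
      w (fun a => e (I a)) *
      \det (\matrix_(i, b) theta i (fcat (fun a => e (I a)) v b)).

(* Exterior derivative at x, evaluated on local vector fields V_0, ..., V_{k+1}
   (Koszul formula).  In the second sum the indices are i < [lift i j] = j + 1,
   and [lift i (lift j _)] enumerates the remaining ones. *)
Definition ext_d (R : realType) (X : diffSpace R) (k : nat) (w : dform X k.+1)
    (V : 'I_k.+2 -> X -> tvec X) (x : X) : R :=
  \sum_(i < k.+2) (-1) ^+ i * V i x (fun y => w y (fun a => V (lift i a) y)) +
  \sum_(i < k.+2) \sum_(j < k.+1 | (i <= j)%N)
    (-1) ^+ (i + j.+1) *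
    w x (fcons (bracket (V i) (V (lift i j)) x)
               (fun a : 'I_k => V (lift i (lift j a)) x)).

(** ** Oriented smooth manifolds *)

Record chart (R : realType) (T : topologicalType) (n : nat) := Chart {
  cdom : set T;
  cmap : T -> 'rV[R]_n;
  cinv : 'rV[R]_n -> T }.

Definition is_chart (R : realType) (T : topologicalType) (n : nat)
    (c : chart R T n) : Prop :=
  [/\ open (cdom c), open (cmap c @` cdom c),
      forall p, cdom c p -> cinv c (cmap c p) = p,
      forall p, cdom c p -> {for p, continuous (cmap c)}
    & forall x, (cmap c @` cdom c) x -> {for x, continuous (cinv c)}].

Definition is_oriented_atlas (R : realType) (T : topologicalType) (n : nat)
    (A : set (chart R T n)) : Prop :=
  [/\ forall c, A c -> is_chart c,
      forall p, exists2 c, A c & cdom c p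
    & forall c c', A c -> A c' ->
        let B := cmap c @` (cdom c `&` cdom c') in
        let t j x := cmap c' (cinv c x) 0 j in
        (forall j, Cinfty B (t j)) /\
        (forall x, B x ->
           0 < \det (\matrix_(i, j) ('D_(delta_mx 0 i) (t j) x : R)))].

Record oriented_manifold (R : realType) (n : nat) := OrientedManifold {
  mtop : topologicalType;
  atlas : set (chart R mtop n);
  m_hausdorff : hausdorff_space mtop;
  m_second_countable : @second_countable mtop;
  m_atlas : is_oriented_atlas atlas }.
Arguments atlas {R n} o _.

Definition mspace (R : realType) (n : nat) (M : oriented_manifold R n) :
    diffSpace R :=
  @DiffSpace R (mtop M) (fun p => nbhs p)
    (fun p h => exists c B,
       [/\ atlas M c, cdom c p, open B /\ B (cmap c p),
           B `<=` cmap c @` cdom c & Cinfty B (fun x => h (cinv c x))]).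
Coercion mspace : oriented_manifold >-> diffSpace.

(** ** Riemannian metrics and connections *)

Definition is_riemannian (R : realType) (n : nat) (M : oriented_manifold R n)
    (g : M -> tvec M -> tvec M -> R) : Prop :=
  [/\ forall p x y, tangent p x -> tangent p y -> g p x y = g p y x,
      forall p a x y z, tangent p x -> tangent p y -> tangent p z ->
        g p (a *: x + y) z = a * g p x z + g p y z,
      forall p x, tangent p x -> x <> 0 -> 0 < g p x x
    & forall p V W, smooth_field_at p V -> smooth_field_at p W ->
        smooth_at p (fun q => g q (V q) (W q))].

Definition direct_orthonormal (R : realType) (n : nat)
    (M : oriented_manifold R n) (g : M -> tvec M -> tvec M -> R) (p : M)
    (e : 'I_n -> tvec M) : Prop :=
  [/\ forall i, tangent p (e i),
      forall i j, g p (e i) (e j) = (i == j)%:R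
    & forall c, atlas M c -> cdom c p ->
        0 < \det (\matrix_(i, j) e i (fun q => cmap c q 0 j))].

(* [D x v s] is the derivative at x, in the direction v, of the section s of
   f^*TY.  The Leibniz rule makes it depend on the germ of s at x only. *)
Definition connection (R : realType) (X Y : diffSpace R) : Type :=
  X -> tvec X -> (X -> tvec Y) -> tvec Y.

Definition is_connection_along (R : realType) (X Y : diffSpace R) (f : X -> Y)
    (D : connection X Y) : Prop :=
  [/\ forall x v s, tangent x v -> smooth_section_at f x s ->
        tangent (f x) (D x v s),
      forall x a v w s, tangent x v -> tangent x w -> smooth_section_at f x s ->
        D x (a *: v + w) s = a *: D x v s + D x w s,
      forall x v s t, tangent x v -> smooth_section_at f x s ->
        smooth_section_at f x t ->
        D x v (fun y => s y + t y) = D x v s + D x v t,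
      forall x v h s, tangent x v -> smooth_at x h -> smooth_section_at f x s ->
        D x v (fun y => h y *: s y) = v h *: s x + h x *: D x v s
    & forall x V s, smooth_field_at x V -> smooth_section_at f x s ->
        smooth_section_at f x (fun y => D y (V y) s)].

Definition is_linear_connection (R : realType) (X : diffSpace R)
    (D : connection X X) : Prop :=
  is_connection_along (fun x : X => x) D.

(* [fD] is f^*D, the unique connection on f^*TY with
   (f^*D)_v (W o f) = D_{df v} W. *)
Definition is_pullback_connection (R : realType) (X Y : diffSpace R)
    (f : X -> Y) (D : connection Y Y) (fD : connection X Y) : Prop :=
  is_connection_along f fD /\
  forall x v W, tangent x v -> smooth_field_at (f x) W ->
    fD x v (fun y => W (f y)) = D (f x) (differential f x v) W.

Definition is_metric_connection (R : realType) (n : nat)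
    (M : oriented_manifold R n) (g : M -> tvec M -> tvec M -> R)
    (D : connection M M) : Prop :=
  forall p x V W, tangent p x -> smooth_field_at p V -> smooth_field_at p W ->
    x (fun q => g q (V q) (W q)) =
      g p (D p x V) (W p) + g p (V p) (D p x W).

Definition curvature (R : realType) (X : diffSpace R) (D : connection X X)
    (V W Z : X -> tvec X) (p : X) : tvec X :=
  D p (V p) (fun q => D q (W q) Z) - D p (W p) (fun q => D q (V q) Z)
  - D p (bracket V W p) Z.

(* a vector field, smooth near p, with value x at p *)
Definition extend (R : realType) (X : diffSpace R) (p : X) (x : tvec X) :
    X -> tvec X :=
  xget (fun=> 0) [set V : X -> tvec X | smooth_field_at p V /\ V p = x].

(* R^D(x, y) z at p; the curvature being tensorial, the choice of the
   extensions is irrelevant. *)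
Definition curvature_at (R : realType) (X : diffSpace R) (D : connection X X)
    (p : X) (x y z : tvec X) : tvec X :=
  curvature D (extend p x) (extend p y) (extend p z) p.

(* r(x, y) = Tr (z |-> R^D(z, x) y), computed in an orthonormal basis e *)
Definition ricci (R : realType) (n : nat) (M : oriented_manifold R n)
    (g : M -> tvec M -> tvec M -> R) (D : connection M M) (p : M)
    (e : 'I_n -> tvec M) (x y : tvec M) : R :=
  \sum_j g p (curvature_at D p (e j) x y) (e j).

Definition Rcoef (R : realType) (n : nat) (M : oriented_manifold R n.+1)
    (g : M -> tvec M -> tvec M -> R) (D : connection M M) (p : M)
    (e : 'I_n.+1 -> tvec M) (i j k l : nat) : R :=
  g p (curvature_at D p (e (inord i)) (e (inord j)) (e (inord k)))
      (e (inord l)).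

Definition l_coef (R : realType) (M : oriented_manifold R 4)
    (g : M -> tvec M -> tvec M -> R) (D : connection M M) (p : M)
    (e : 'I_4 -> tvec M) : R :=
  Rcoef g D p e 1 2 3 0 + Rcoef g D p e 2 3 1 0 + Rcoef g D p e 3 1 2 0.

(** ** The unit sphere tangent bundle SM *)

(* coordinates (x, dx(v)) of (p, v) in the chart of TM induced by c *)
Definition tcoord (R : realType) (n : nat) (M : oriented_manifold R n)
    (c : chart R (mtop M) n) (u : M * tvec M) : 'rV[R]_(n + n) :=
  row_mx (cmap c u.1) (\row_i u.2 (fun q => cmap c q 0 i)).

Definition sphere_type (R : realType) (n : nat) (M : oriented_manifold R n)
    (g : M -> tvec M -> tvec M -> R) : Type :=
  {u : M * tvec M | tangent u.1 u.2 /\ g u.1 u.2 u.2 = 1}.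

(* topology and smooth functions of SM as a submanifold of TM: a function is
   smooth when it extends locally to a smooth function on TM *)
Definition sphere_bundle (R : realType) (n : nat) (M : oriented_manifold R n)
    (g : M -> tvec M -> tvec M -> R) : diffSpace R :=
  @DiffSpace R (sphere_type g)
    (fun u => [set W | exists c B,
       [/\ atlas M c, cdom c (sval u).1, open B /\ B (tcoord c (sval u))
         & forall w : sphere_type g, cdom c (sval w).1 ->
             B (tcoord c (sval w)) -> W w]])
    (fun u h => exists c B F,
       [/\ atlas M c, cdom c (sval u).1, open B /\ B (tcoord c (sval u)),
           Cinfty B F
         & forall w : sphere_type g, cdom c (sval w).1 ->
             B (tcoord c (sval w)) -> h w = F (tcoord c (sval w))]).

Definition sproj (R : realType) (n : nat) (M : oriented_manifold R n)
    (g : M -> tvec M -> tvec M -> R) (u : sphere_bundle g) : M :=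
  (sval u).1.

(* the section U of f^*TM, U_u = u *)
Definition taut (R : realType) (n : nat) (M : oriented_manifold R n)
    (g : M -> tvec M -> tvec M -> R) (u : sphere_bundle g) : tvec M :=
  (sval u).2.

(* The metric of SM: its restrictions to H = ker (X |-> (f^*D)_X U) and to
   V = ker df are those transported by df and by X |-> (f^*D)_X U, and H is
   orthogonal to V.  [fD] stands for f^*D. *)
Definition sphere_metric (R : realType) (n : nat) (M : oriented_manifold R n)
    (g : M -> tvec M -> tvec M -> R) (fD : connection (sphere_bundle g) M)
    (u : sphere_bundle g) (X Y : tvec (sphere_bundle g)) : R :=
  g (sproj u) (differential (@sproj R n M g) u X)
              (differential (@sproj R n M g) u Y)
  + g (sproj u) (fD u X (@taut R n M g)) (fD u Y (@taut R n M g)).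

(** ** The G2 structure of SM, for M of dimension 4 *)

(* [e] is e_0 = u, e_1, e_2, e_3 in T_{f(u)}M and [E] is e_0, ..., e_6 in
   T_u SM: horizontal lifts, then vertical vectors e_{i+3} for i = 1, 2, 3. *)
Definition adapted_frame (R : realType) (M : oriented_manifold R 4)
    (g : M -> tvec M -> tvec M -> R) (fD : connection (sphere_bundle g) M)
    (u : sphere_bundle g) (e : 'I_4 -> tvec M)
    (E : 'I_7 -> tvec (sphere_bundle g)) : Prop :=
  [/\ direct_orthonormal g (sproj u) e,
      e ord0 = taut u,
      forall i : 'I_4,
        [/\ tangent u (E (lshift 3 i)),
            differential (@sproj R 4 M g) u (E (lshift 3 i)) = e i
          & fD u (E (lshift 3 i)) (@taut R 4 M g) = 0]
    & forall i : 'I_3,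
        [/\ tangent u (E (rshift 4 i)),
            differential (@sproj R 4 M g) u (E (rshift 4 i)) = 0
          & fD u (E (rshift 4 i)) (@taut R 4 M g) = e (rshift 1 i)]].

(* e^0, ..., e^6; dual to E since an adapted frame is orthonormal *)
Definition coframe (R : realType) (M : oriented_manifold R 4)
    (g : M -> tvec M -> tvec M -> R) (fD : connection (sphere_bundle g) M)
    (u : sphere_bundle g) (E : 'I_7 -> tvec (sphere_bundle g)) (i : 'I_7)
    (X : tvec (sphere_bundle g)) : R :=
  sphere_metric fD u (E i) X.

Definition mu_ (R : realType) (V : Type) (th : 'I_7 -> V -> R)
    (v : 'I_1 -> V) : R := emono th [:: 0]%N v.

Definition beta_ (R : realType) (V : Type) (th : 'I_7 -> V -> R)
    (v : 'I_2 -> V) : R :=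
  emono th [:: 1; 4]%N v + emono th [:: 2; 5]%N v + emono th [:: 3; 6]%N v.

Definition alpha_ (R : realType) (V : Type) (th : 'I_7 -> V -> R)
    (v : 'I_3 -> V) : R := emono th [:: 4; 5; 6]%N v.

Definition alpha2_ (R : realType) (V : Type) (th : 'I_7 -> V -> R)
    (v : 'I_3 -> V) : R :=
  emono th [:: 1; 2; 6]%N v + emono th [:: 2; 3; 4]%N v
  + emono th [:: 3; 1; 5]%N v.

(* [phi] is the form alpha + mu /\ beta - alpha_2 (in any adapted frame) *)
Definition is_G2_form (R : realType) (M : oriented_manifold R 4)
    (g : M -> tvec M -> tvec M -> R) (fD : connection (sphere_bundle g) M)
    (phi : dform (sphere_bundle g) 3) : Prop :=
  forall u e E, adapted_frame fD u e E ->
  forall v : 'I_3 -> tvec (sphere_bundle g), (forall i, tangent u (v i)) ->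
    let th := coframe fD u E in
    phi u v = alpha_ th v + wedge (mu_ th) (beta_ th) v - alpha2_ th v.

(* d phi = tau0 star(phi) + 3/4 tau1 /\ phi + star(tau3) with tau0, tau1 smooth forms and
   tau3 in Omega^3_27 *)
Definition torsion_decomposition (R : realType) (M : oriented_manifold R 4)
    (g : M -> tvec M -> tvec M -> R) (fD : connection (sphere_bundle g) M)
    (phi : dform (sphere_bundle g) 3) (tau0 : sphere_bundle g -> R)
    (tau1 : dform (sphere_bundle g) 1) (tau3 : dform (sphere_bundle g) 3) :
    Prop :=
  [/\ forall u, smooth_at u tau0, is_form tau1, is_form tau3,
      forall u e E, adapted_frame fD u e E ->
        let star := @hodge R (tvec (sphere_bundle g)) 3 4 (coframe fD u E) E in
        (forall v : 'I_6 -> tvec (sphere_bundle g),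
           (forall i, tangent u (v i)) -> wedge (tau3 u) (phi u) v = 0) /\
        (forall v : 'I_7 -> tvec (sphere_bundle g),
           (forall i, tangent u (v i)) -> wedge (tau3 u) (star (phi u)) v = 0)
    & forall u e E, adapted_frame fD u e E ->
        let star := @hodge R (tvec (sphere_bundle g)) 3 4 (coframe fD u E) E in
        forall V : 'I_4 -> sphere_bundle g -> tvec (sphere_bundle g),
        (forall i, smooth_field_at u (V i)) ->
        let v := fun i => V i u in
        ext_d phi V u =
          tau0 u * star (phi u) v + 3 / 4 * wedge (tau1 u) (phi u) v
          + star (tau3 u) v].

(* Main.v *)
From HB Require Import structures.
Require Import Defs.
From mathcomp Require Import all_boot all_order all_algebra all_fingroup.
From mathcomp Require Import all_classical all_reals all_analysis.
From mathcomp Require Import ring lra.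
Set Implicit Arguments.
Unset Strict Implicit.
Unset Printing Implicit Defensive.
Import Order.TTheory GRing.Theory Num.Theory numFieldNormedType.Exports.
Local Open Scope classical_set_scope.
Local Open Scope ring_scope.

(** Every adapted frame at [u] extends to a smooth field of adapted frames
    near [u]: take an orthonormal frame of M and rotate it by the quaternion of
    the coordinates of the point of SM, so that its first vector is the
    tautological section.  In such a field [phi] has constant coefficients, so
    the Koszul formula expresses [d phi] by the structure functions
    [e^m([e_i, e_j])].  In [<d phi, star phi>] the terms of [tau_1] and [tau_3]
    vanish and [|phi|^2 = 7], hence [7 tau_0] is a combination of structure
    functions.  The vertical parts of brackets of horizontal fields are
    curvatures and give [r - l]; the parts of the other brackets involving
    [e_0] give [6], because the derivative of the tautological section in a
    vertical direction is that direction; what remains consists of connection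
    coefficients which cancel by skew-symmetry. *)

(** * Smooth functions on open subsets of R^n *)

(** Tangent vectors are derivations, and smoothness on SM is inherited from the 2n coordinates of
    TM, one more than the dimension of SM. Two devices restore calculus: Hadamard's lemma turns a
    derivation into a combination of partial derivatives, and a renormalising retraction of an open
    subset of R^(2n) pushes coordinate derivations forward to vector fields on SM. The connection D
    may have torsion, which would enter through the horizontal part of the bracket of two horizontal
    fields. It does not appear in the result because every monomial of phi contains a vertical
    index. For a < b, the coefficient of e^m([e_a, e_b]) in <d phi, star phi> is 2 phi_(abm); the 2
    is the contraction of phi with star phi over unordered pairs. This is the numerator of 2/7. The
    quantity l is computed in a prescribed frame at u, so the field of frames has to pass through
    that frame: the orthonormal frame of M is built with given values, and the rotating quaternion
    is 1 at u. *)

Lemma MVT_origin (R : realType) (f df : R -> R) (h : R) :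
  (forall t : R, `|t| <= `|h| -> is_derive t 1 f (df t)) ->
  exists2 t, `|t| <= `|h| & f h - f 0 = df t * h.
Proof.
move=> dfP.
have cf (a b : R) : (forall t, t \in `[a, b] -> `|t| <= `|h|) ->
    {within `[a, b], continuous f}.
  move=> ab; apply: derivable_within_continuous => t /ab /dfP dft.
  exact: ex_derive.
(* The increments to which this is applied are coordinates of a vector, hence of either sign or
   zero. *)
case: (ltgtP 0 h) => [h0|h0|h0]; last first.
- by exists 0 => /=; rewrite -?h0 ?subrr ?mulr0 ?lexx.
- have sub t : t \in `[h, 0] -> `|t| <= `|h|.
    rewrite in_itv/= => /andP[ht t0].
    by rewrite (ltr0_norm h0) ler0_norm// lerN2.
  have [t tI e] : exists2 t, t \in `]h, 0[ & f 0 - f h = df t * (0 - h).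
    apply: MVT => //; last exact: cf.
    by move=> t /subset_itv_oo_cc tI; exact/dfP/sub.
  by exists t; [exact/sub/subset_itv_oo_cc|move: e; lra].
- have sub t : t \in `[0, h] -> `|t| <= `|h|.
    rewrite in_itv/= => /andP[t0 ht].
    by rewrite (gtr0_norm h0) ger0_norm.
  have [t tI e] : exists2 t, t \in `]0, h[ & f h - f 0 = df t * (h - 0).
    apply: MVT => //; last exact: cf.
    by move=> t /subset_itv_oo_cc tI; exact/dfP/sub.
  by exists t; [exact/sub/subset_itv_oo_cc|rewrite e subr0].
Qed.

Lemma is_derive_line (R : realType) (V : normedModType R) (F : V -> R)
    (p v : V) (t : R) :
  derivable F (p + t *: v) v ->
  is_derive t 1 (fun s : R => F (p + s *: v)) ('D_v F (p + t *: v)).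
Proof.
have E : (fun h : R => h^-1 *: (F (p + (h *: (1 : R) + t) *: v) - F (p + t *: v))) =
         (fun h : R => h^-1 *: (F (h *: v + (p + t *: v)) - F (p + t *: v))).
  apply/funext => h; congr (_ *: (F _ - _)).
  by rewrite [h *: 1]mulr1 scalerDl addrCA.
move=> dF; apply: DeriveDef.
  by rewrite /derivable /= E; exact: dF.
by rewrite /derive /= E.
Qed.

Lemma coord_le_norm (R : realType) n (h : 'rV[R]_n) i : `|h 0 i| <= `|h|.
Proof.
rewrite [leRHS]/Num.norm /= mx_normrE; apply/bigmax_geP; right => /=.
by exists (0, i).
Qed.

Lemma norm_le_coord (R : realType) n (h : 'rV[R]_n) (c : R) :
  0 <= c -> (forall i, `|h 0 i| <= c) -> `|h| <= c.
Proof.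
move=> c0 hc; rewrite [leLHS]/Num.norm /= mx_normrE; apply/bigmax_leP.
by split=> // -[a i] _ /=; rewrite ord1.
Qed.

Lemma linear_diff (R : realType) (V W : normedModType R) (f : V -> W)
    (df : {linear V -> W}) x :
  continuous df ->
  (forall eps : R, 0 < eps -> \forall h \near (0 : V),
     `|f (h + x) - f x - df h| <= eps * `|h|) ->
  differentiable f x /\ 'd f x = df :> (V -> W).
Proof.
move=> cdf H.
have E : f \o shift x = cst (f x) + df +o_ 0 id.
  apply/eqaddoP => e e0; near=> h.
  rewrite -[X in `|X|]/(f (h + x) - (f x + df h)) opprD addrA.
  by near: h; exact: H.
have D := diff_unique cdf E.
split=> //; apply/diff_locallyP.
by rewrite D; split.
Unshelve. all: by end_near. Qed.

Lemma continuous_at_sum (R : realType) (T : topologicalType) (I : Type)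
    (r : seq I) (f : I -> T -> R) x :
  (forall i, {for x, continuous (f i)}) ->
  {for x, continuous (fun y => \sum_(i <- r) f i y)}.
Proof.
move=> cf; elim: r => [|i r IH].
  rewrite (_ : (fun _ => _) = cst 0); first exact: cst_continuous.
  by apply/funext => y; rewrite big_nil.
rewrite (_ : (fun _ => _) = f i \+ (fun y => \sum_(i <- r) f i y)).
  exact: cvgD (cf i) IH.
by apply/funext => y; rewrite big_cons.
Qed.

Lemma differential_continuous_rV (R : realType) n (c : 'I_n -> R) :
  linear (fun h : 'rV[R]_n => \sum_i h 0 i * c i) /\
  continuous (fun h : 'rV[R]_n => \sum_i h 0 i * c i).
Proof.
split=> [a x y|h].
  rewrite scaler_sumr -big_split /=; apply: eq_bigr => i _.
  by rewrite !mxE mulrDl scalerAl.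
by apply: continuous_at_sum => i; exact: cvgMr_tmp (@coord_continuous R 1 n 0 i h).
Qed.

(** A path from x to x + h along edges parallel to the axes costs one mean value theorem per edge,
    and continuity of the partial derivatives at x controls the errors. *)
Lemma Ck1_differentiable (R : realType) n (B : set 'rV[R]_n) F x :
  open B -> Ck 1 B F -> B x ->
  differentiable F x /\
  'd F x = (fun h => \sum_i h 0 i * 'D_(delta_mx 0 i) F x) :> ('rV[R]_n -> R).
Proof.
move=> oB [_ dF] Bx.
have [ldf cdf] := differential_continuous_rV (fun i => 'D_(delta_mx 0 i) F x).
pose L : {linear 'rV[R]_n -> R} := HB.pack_for {linear 'rV[R]_n -> R}
  (fun h : 'rV[R]_n => \sum_i h 0 i * 'D_(delta_mx 0 i) F x)
  (GRing.isLinear.Build _ _ _ _ _ ldf).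
apply: (@linear_diff R _ _ F L x cdf) => eps eps0 /=.
(* Each of the n edges gets an equal share of the error; [n.+1] keeps the denominator nonzero for n
   = 0. *)
have n0 : 0 <= eps / n.+1%:R by rewrite divr_ge0// ltW.
have : \forall y \near x, B y /\ forall i : 'I_n,
    `|'D_(delta_mx 0 i) F x - 'D_(delta_mx 0 i) F y| <= eps / n.+1%:R.
  near=> y; split; first by near: y; exact: open_nbhs_nbhs.
  near: y; apply: filter_forall => i.
  have [_ [/(_ _ Bx) /cvgrPdist_le + _]] := dF i; apply.
  by rewrite divr_gt0.
move=> /nbhs_ballP[r /= r0 xr]; apply/nbhs_ballP; exists r => //= h.
rewrite -ball_normE /= sub0r normrN => hr.
pose p k : 'rV[R]_n := \row_i (if (i < k)%N then h 0 i else 0).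
have pn : p n = h by apply/rowP => i; rewrite mxE ltn_ord.
have p0 : p 0%N = 0 by apply/rowP => i; rewrite !mxE.
have -> : F (h + x) - F x = \sum_(k < n) (F (x + p k.+1) - F (x + p k)).
  rewrite -(big_mkord xpredT (fun k => F (x + p k.+1) - F (x + p k))).
  by rewrite (telescope_sumr (fun k => F (x + p k))) ?leq0n// pn p0 addr0 [h + x]addrC.
rewrite -sumrB; apply: le_trans (ler_norm_sum _ _ _) _.
apply: (@le_trans _ _ (\sum_(k < n) eps / n.+1%:R * `|h|)); last first.
  rewrite sumr_const card_ord -[_ *+ n]mulr_natr mulrAC; apply: ler_wpM2r => //.
  by rewrite -mulrA ler_piMr ?(ltW eps0)// mulrC ler_pdivrMr ?mul1r ?ltr0n// ler_nat.
apply: ler_sum => k _.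
have pS : p k.+1 = p k + h 0 k *: delta_mx 0 k.
  apply/rowP => i; rewrite !mxE eqxx /= ltnS leq_eqVlt -val_eqE.
  case: eqP => [/val_inj ->|] /=; first by rewrite ltnn mulr1 add0r.
  by rewrite mulr0 addr0.
(* In the sup norm the edges stay in the ball, since their coordinates are bounded by those of
   [h]. *)
have xrB t : `|t| <= `|h 0 k| -> ball x r (x + p k + t *: delta_mx 0 k).
  move=> tk; rewrite -ball_normE /= -addrA opprD addNKr normrN.
  apply: le_lt_trans hr; apply: norm_le_coord => // i; rewrite !mxE eqxx /=.
  case: ifPn => ik.
    rewrite [i == k](_ : _ = false) ?mulr0 ?addr0 ?coord_le_norm//.
    by apply/negbTE; rewrite -val_eqE neq_ltn ik.
  rewrite add0r; case: eqP => _; last by rewrite mulr0 normr0.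
  by rewrite mulr1; apply: le_trans tk _; exact: coord_le_norm.
have [t tk] := @MVT_origin R (fun t => F (x + p k + t *: delta_mx 0 k))
   (fun t => 'D_(delta_mx 0 k) F (x + p k + t *: delta_mx 0 k)) (h 0 k)
   (fun t tk => is_derive_line ((dF k).1 _ (xr _ (xrB t tk)).1)).
rewrite scale0r addr0 pS addrA => ->; rewrite mulrC -mulrBr normrM mulrC.
rewrite ler_pM//; last exact: coord_le_norm.
rewrite distrC; exact: (xr _ (xrB t tk)).2.
Unshelve. all: by end_near. Qed.

(** * Closure properties of the classes C^k *)

Lemma Ck_S (R : realType) n k (B : set 'rV[R]_n) F : Ck k.+1 B F -> Ck k B F.
Proof.
elim: k F => [|k IH] F [cF dF]; first by split.
by split=> // i; have [d1 d2] := dF i; split=> //; exact: IH.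
Qed.

Lemma Ck_le (R : realType) n k m (B : set 'rV[R]_n) F :
  (m <= k)%N -> Ck k B F -> Ck m B F.
Proof.
by move=> /subnKC <-; elim: (k - m)%N => [|j IH]; rewrite ?addn0 ?addnS // => /Ck_S.
Qed.

Lemma Ck_continuous (R : realType) n k (B : set 'rV[R]_n) F x :
  Ck k B F -> B x -> {for x, continuous F}.
Proof. by case: k => [|k] [+ _]; apply. Qed.

Lemma Ck_sub (R : realType) n k (B C : set 'rV[R]_n) F :
  C `<=` B -> Ck k B F -> Ck k C F.
Proof.
move=> CB; elim: k F => [|k IH] F [cF dF]; first by split=> // x /CB; exact: cF.
split=> [x /CB|i]; first exact: cF.
by have [d1 d2] := dF i; split=> [x /CB|]; [exact: d1|exact: IH].
Qed.

(** [Ck] says nothing off [B], so functions are only ever identified on [B]; openness of [B] carries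
    this agreement over to the partial derivatives. *)
Lemma Ck_ext (R : realType) n k (B : set 'rV[R]_n) F G :
  open B -> (forall x, B x -> F x = G x) -> Ck k B F -> Ck k B G.
Proof.
move=> oB FG kF.
have nFG F' G' x : (forall x, B x -> F' x = G' x) -> B x ->
    \forall y \near x, F' y = G' y :> R.
  by move=> FG' Bx; near=> y; apply: FG'; near: y; exact: open_nbhs_nbhs.
have cG F' G' : (forall x, B x -> F' x = G' x) ->
    (forall x, B x -> {for x, continuous F'}) ->
    forall x, B x -> {for x, continuous (G' : _ -> R)}.
  move=> FG' cF' x Bx; rewrite /prop_for /continuous_at -FG'//.
  exact: cvg_trans (near_eq_cvg (nFG _ _ _ FG' Bx)) (cF' _ Bx).
elim: k F G FG kF => [|k IH] F G FG [cF dF]; first by split=> //; exact: cG cF.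
split=> [|i]; first exact: cG cF.
have [d1 d2] := dF i; split=> [x Bx|].
  exact: near_eq_derivable (nFG _ _ _ FG Bx) (d1 _ Bx).
by apply: IH d2 => x Bx; exact: near_eq_derive (nFG _ _ _ FG Bx).
Unshelve. all: by end_near. Qed.

Lemma Ck_cst (R : realType) n k (B : set 'rV[R]_n) (a : R) :
  Ck k B (fun=> a).
Proof.
elim: k a => [|k IH] a; (split=> [x Bx|]; first exact: cst_continuous) => // i.
split=> [x Bx|]; first exact: derivable_cst.
rewrite [X in Ck k B X](_ : _ = (fun=> 0)) //.
by apply/funext => x; rewrite derive_cst.
Qed.

Lemma CkD (R : realType) n k (B : set 'rV[R]_n) F G :
  open B -> Ck k B F -> Ck k B G -> Ck k B (fun x => F x + G x).
Proof.
move=> oB; elim: k F G => [|k IH] F G [cF dF] [cG dG].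
  by split=> // x Bx; exact: cvgD (cF _ Bx) (cG _ Bx).
split=> [x Bx|i]; first exact: cvgD (cF _ Bx) (cG _ Bx).
have [dF1 dF2] := dF i; have [dG1 dG2] := dG i.
split=> [x Bx|]; first exact: derivableD (dF1 _ Bx) (dG1 _ Bx).
apply: Ck_ext (IH _ _ dF2 dG2) => // x Bx.
exact/esym/(deriveD (dF1 _ Bx) (dG1 _ Bx)).
Qed.

Lemma CkM (R : realType) n k (B : set 'rV[R]_n) F G :
  open B -> Ck k B F -> Ck k B G -> Ck k B (fun x => F x * G x).
Proof.
move=> oB; elim: k F G => [|k IH] F G kF kG; have [cF dF] := kF; have [cG dG] := kG.
  by split=> // x Bx; exact: cvgM (cF _ Bx) (cG _ Bx).
split=> [x Bx|i]; first exact: cvgM (cF _ Bx) (cG _ Bx).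
have [dF1 dF2] := dF i; have [dG1 dG2] := dG i.
split=> [x Bx|]; first exact: derivableM (dF1 _ Bx) (dG1 _ Bx).
apply: Ck_ext (CkD oB (IH _ _ (Ck_S kF) dG2) (IH _ _ (Ck_S kG) dF2)) => // x Bx.
exact/esym/(deriveM (dF1 _ Bx) (dG1 _ Bx)).
Qed.

Lemma Ck_sum (R : realType) n k (B : set 'rV[R]_n) (I : Type) (r : seq I)
    (F : I -> 'rV[R]_n -> R) :
  open B -> (forall i, Ck k B (F i)) -> Ck k B (fun x => \sum_(i <- r) F i x).
Proof.
move=> oB kF; elim: r => [|i r IH].
  by apply: Ck_ext (Ck_cst k B 0) => // x _; rewrite big_nil.
by apply: Ck_ext (CkD oB (kF i) IH) => // x _; rewrite big_cons.
Qed.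

Lemma derive_coord (R : realType) n (x v : 'rV[R]_n) j :
  is_derive x v (fun y : 'rV[R]_n => y 0 j) (v 0 j).
Proof.
have dM : forall i j, derivable (fun y : 'rV[R]_n => y i j) x v.
  by apply/derivable_mxP; exact: derivable_id.
apply: DeriveDef => //.
have := derive_mx (@derivable_id _ _ x v); rewrite derive_id => /matrixP/(_ 0 j).
by rewrite mxE.
Qed.

Lemma Ck_coord (R : realType) n k (B : set 'rV[R]_n) j :
  Ck k B (fun x => x 0 j).
Proof.
case: k => [|k]; (split=> [x Bx|]; first exact: coord_continuous) => // i.
split=> [x Bx|]; first exact: (@ex_derive _ _ _ _ _ _ _ (derive_coord x _ j)).
rewrite [X in Ck k B X](_ : _ = (fun=> (delta_mx 0 i : 'rV[R]_n) 0 j)); first exact: Ck_cst.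
by apply/funext => x; rewrite (@derive_val _ _ _ _ _ _ _ (derive_coord x _ j)).
Qed.

Lemma continuous_rV (R : realType) (T : topologicalType) n (f : T -> 'rV[R]_n) x :
  (forall j, {for x, continuous (fun y => f y 0 j)}) -> {for x, continuous f}.
Proof.
move=> cf; apply/cvgrPdist_le => e e0.
have : \forall y \near x, forall i, `|f x 0 i - f y 0 i| <= e.
  by apply: filter_forall => i; have /cvgrPdist_le/(_ _ e0) := cf i.
apply: filterS => y fy; apply: norm_le_coord; first exact: ltW.
by move=> i; rewrite !mxE.
Qed.

(** Only a directional derivative of [f] is at hand. Restricting to the line through x in the
    direction v leaves a function of one variable, for which derivability is differentiability. *)
Lemma is_derive_chain (R : realType) (V W : normedModType R) (f : V -> W)
    (F : W -> R) x v :
  derivable f x v -> differentiable F (f x) ->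
  is_derive x v (F \o f) ('d F (f x) ('D_v f x)).
Proof.
move=> /derivable1P /derivable1_diffP df dF.
have E : (fun h : R => (F \o f) (h *: v + x)) = F \o (fun h => f (h *: v + x)) by [].
have f0 : f (0 *: v + x) = f x by rewrite scale0r add0r.
have D : differentiable (F \o (fun h : R => f (h *: v + x))) 0.
  by apply: differentiable_comp => //; rewrite f0.
have lineE (U : normedModType R) (G : V -> U) :
    'D_v G x = 'D_1 (fun h : R => G (h *: v + x)) 0.
  rewrite /derive; set g1 := fun h => h^-1 *: _; set g2 := fun h => h^-1 *: _.
  suff -> : g1 = g2 by [].
  by apply/funext => h; rewrite /g1 /g2 /= addr0 scale0r add0r [h *: 1]mulr1.
apply: DeriveDef.
  by apply: (derivable1P (F \o f) x v).2; rewrite E; exact: diff_derivable D.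
rewrite !lineE E deriveE// diff_comp//; last by rewrite f0.
rewrite /= f0; congr (_ _); rewrite -deriveE ?f0//.
Qed.

Lemma Ck_comp (R : realType) m n k (B : set 'rV[R]_m) (C : set 'rV[R]_n)
    (f : 'rV[R]_m -> 'rV[R]_n) F :
  open B -> open C -> (forall x, B x -> C (f x)) ->
  (forall j, Ck k B (fun x => f x 0 j)) -> Ck k C F -> Ck k B (F \o f).
Proof.
move=> oB oC BC; elim: k F => [|k IH] F kf kF.
  split=> // x Bx; apply: continuous_comp; last exact: kF.1 _ (BC _ Bx).
  by apply: continuous_rV => j; exact: (kf j).1.
split=> [x Bx|i].
  apply: continuous_comp; last exact: kF.1 _ (BC _ Bx).
  by apply: continuous_rV => j; exact: (kf j).1.
have df x : B x -> derivable f x (delta_mx 0 i).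
  move=> Bx; apply/derivable_mxP => a j; rewrite ord1.
  by have [_ /(_ i)[/(_ _ Bx)]] := kf j.
have dF x : B x -> is_derive x (delta_mx 0 i) (F \o f)
    (\sum_j 'D_(delta_mx 0 j) F (f x) * 'D_(delta_mx 0 i) (fun y => f y 0 j) x).
  move=> Bx.
  have [|dFx eF] := @Ck1_differentiable R n C F (f x) oC _ (BC _ Bx).
    exact: Ck_le kF.
  have := is_derive_chain (df _ Bx) dFx; rewrite eF; congr is_derive.
  by apply: eq_bigr => j _; rewrite derive_mx ?mxE; [rewrite mulrC|exact: df].
split=> [x Bx|]; first by have [] := dF _ Bx.
have kfS j : Ck k B (fun x => f x 0 j) by exact: Ck_S.
have := @Ck_sum R m k B _ (index_enum 'I_n) (fun j x => 'D_(delta_mx 0 j) F (f x) *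
   'D_(delta_mx 0 i) (fun y => f y 0 j) x) oB.
move=> /(_ (fun j => CkM oB (IH _ kfS (kF.2 j).2) ((kf j).2 i).2)).
by apply: Ck_ext => // x Bx; have [_ ->] := dF _ Bx.
Qed.

(** The exponent is arbitrary so that the induction on k closes: differentiating lowers it by 1. The
    exponent of interest is -1/2, which normalises vectors. *)
Lemma Ck_powR (R : realType) n k (B : set 'rV[R]_n) F (a : R) :
  open B -> (forall x, B x -> 0 < F x) -> Ck k B F ->
  Ck k B (fun x => F x `^ a).
Proof.
move=> oB F0; elim: k a => [|k IH] a kF.
  split=> // x Bx; have dp := is_derive1_powR a (F0 _ Bx).
  have cp : {for F x, continuous (fun y : R => y `^ a)}.
    by apply/differentiable_continuous/derivable1_diffP; exact: ex_derive.
  exact: (continuous_comp (kF.1 _ Bx) cp).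
have dpow x : B x -> differentiable (fun y : R => y `^ a) (F x).
  by move=> Bx; apply/derivable1_diffP; have := is_derive1_powR a (F0 _ Bx); case.
split=> [x Bx|i].
  exact: (continuous_comp (kF.1 _ Bx) (differentiable_continuous (dpow _ Bx))).
have dF x : B x -> is_derive x (delta_mx 0 i) (fun x => F x `^ a)
    (a * (F x `^ (a - 1)) * 'D_(delta_mx 0 i) F x).
  move=> Bx; have := is_derive_chain ((kF.2 i).1 _ Bx) (dpow _ Bx).
  rewrite deriv1E; last by have := is_derive1_powR a (F0 _ Bx); case.
  rewrite derive1E (@derive_val _ _ _ _ _ _ _ (is_derive1_powR a (F0 _ Bx))).
  by rewrite [_ *: _]mulrC.
split=> [x Bx|]; first by have [] := dF _ Bx.
apply: Ck_ext (CkM oB (CkM oB (Ck_cst k B a) (IH (a - 1) (Ck_S kF))) (kF.2 i).2) => //.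
by move=> x Bx; have [_ ->] := dF _ Bx.
Qed.

(** * Integrals over the unit interval *)

Lemma integrable01 (R : realType) (f : R -> R) :
  (forall t, 0 <= t <= 1 -> {for t, continuous f}) ->
  (@lebesgue_measure R).-integrable `[0, 1] (EFin \o f).
Proof.
move=> cf; apply: continuous_compact_integrable; first exact: segment_compact.
by apply: continuous_in_subspaceT => t; rewrite inE /= in_itv /=; exact: cf.
Qed.

Lemma Rintegral01_sum (R : realType) (I : Type) (r : seq I) (f : I -> R -> R) (c : I -> R) :
  (forall i t, 0 <= t <= 1 -> {for t, continuous (f i)}) ->
  \int[@lebesgue_measure R]_(t in `[0, 1]) (\sum_(i <- r) c i * f i t) =
  \sum_(i <- r) c i * \int[@lebesgue_measure R]_(t in `[0, 1]) f i t.
Proof.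
move=> cf; elim: r => [|i r IH].
  rewrite big_nil; under eq_Rintegral do rewrite big_nil.
  by rewrite Rintegral_cst ?mul0r.
rewrite big_cons -IH -RintegralZl//; last first.
  by apply: integrable01 => t; exact: cf.
rewrite -RintegralD//.
- by apply: eq_Rintegral => t _; rewrite big_cons.
- by apply: integrable01 => t t01; exact: cvgMl_tmp (cf _ _ t01).
- apply: integrable01 => t t01; apply: continuous_at_sum => j.
  exact: cvgMl_tmp (cf _ _ t01).
Qed.

(** * Hadamard's lemma *)

Definition ray (R : realType) n (x0 x : 'rV[R]_n) (t : R) := x0 + t *: (x - x0).

Lemma ball_ray (R : realType) n (x0 x : 'rV[R]_n) r t :
  ball x0 r x -> 0 <= t <= 1 -> ball x0 r (ray x0 x t).
Proof.
rewrite -!ball_normE /= => xr /andP[t0 t1].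
rewrite opprD addNKr normrN normrZ ger0_norm// distrC.
by apply: le_lt_trans xr; rewrite distrC ler_piMl.
Qed.

Lemma ray_continuous (R : realType) n (x0 x : 'rV[R]_n) (F : 'rV[R]_n -> R) t :
  {for ray x0 x t, continuous F} -> {for t, continuous (fun s => F (ray x0 x s))}.
Proof.
move=> cF; apply: continuous_comp cF.
by apply: cvgD; [exact: cvg_cst|exact: cvgZr_tmp].
Qed.

Lemma closed_ball_bound (R : realType) n (B : set 'rV[R]_n) (G : 'rV[R]_n -> R) x0 r :
  0 < r -> (forall y, `|x0 - y| <= r -> {for y, continuous G}) ->
  exists2 M, 0 <= M & forall y, `|x0 - y| <= r -> `|G y| <= M.
Proof.
move=> r0 cG.
have cK : compact [set y : 'rV[R]_n | `|x0 - y| <= r].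
  rewrite (_ : [set y | _] = closed_ball_ Num.norm x0 r) //.
  apply: bounded_closed_compact; last exact: closed_closed_ball_.
  exists (`|x0| + r); split; first exact: num_real.
  move=> M rM y /= yr; apply: le_trans (ltW rM).
  rewrite -[y](subKr x0); apply: le_trans (ler_normB _ _) _.
  by rewrite lerD2l.
have [||c _ Hc] := @EVT_max_rV R n (fun y => `|G y|) _ _ cK.
- by exists x0; rewrite /= subrr normr0 ltW.
- apply: continuous_in_subspaceT => y; rewrite inE /= => /cG cGy.
  by apply: continuous_comp cGy _; exact: norm_continuous.
by exists `|G c| => // y yr; apply: Hc; rewrite inE.
Qed.

(** The partial derivatives are bounded on the compact closed ball. The constant is uniform along
    rays, which makes ray integrals continuous in their end point. *)
Lemma Ck1_lipschitz (R : realType) n (B : set 'rV[R]_n) F x0 r :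
  open B -> 0 < r -> (forall y, `|x0 - y| <= r -> B y) -> Ck 1 B F ->
  exists2 L, 0 <= L & forall y z, ball x0 r y -> ball x0 r z ->
    `|F y - F z| <= L * `|y - z|.
Proof.
move=> oB r0 KB kF.
have /choice[M MP] : forall i : 'I_n, exists M : R, 0 <= M /\
    forall y, `|x0 - y| <= r -> `|'D_(delta_mx 0 i) F y| <= M.
  move=> i; have [|M M0 MP] := @closed_ball_bound R n B ('D_(delta_mx 0 i) F) x0 r r0.
    by move=> y /KB; exact: (kF.2 i).2.1.
  by exists M.
exists (\sum_i M i); first by apply: sumr_ge0 => i _; exact: (MP i).1.
move=> y z yB zB; rewrite distrC [`|y - z|]distrC.
have rayK s : 0 <= s <= 1 -> `|x0 - (y + s *: (z - y))| <= r.
  move=> /andP[s0 s1]; move: yB zB; rewrite -!ball_normE /= => yB zB.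
  have -> : x0 - (y + s *: (z - y)) = (1 - s) *: (x0 - y) + s *: (x0 - z).
    by apply/rowP => i; rewrite !mxE; ring.
  apply: le_trans (ler_normD _ _) _; rewrite !normrZ !ger0_norm ?subr_ge0//.
  have := ler_wpM2l s0 (ltW zB); have := ler_wpM2l (_ : 0 <= 1 - s) (ltW yB).
  rewrite subr_ge0 => /(_ s1); lra.
pose f (s : R) := F (y + s *: (z - y)).
have dF (s : R) : 0 <= s <= 1 -> is_derive s 1 f
    (\sum_i (z - y) 0 i * 'D_(delta_mx 0 i) F (y + s *: (z - y))).
  move=> /rayK/KB /(Ck1_differentiable oB kF)[dF eF].
  have := is_derive_line (@diff_derivable _ _ _ _ _ (z - y) dF).
  by rewrite deriveE// eF.
have [|||s s01] := @MVT_segment R f (fun s => \sum_i (z - y) 0 i * 'D_(delta_mx 0 i) F (y + s *: (z - y))) 0 1.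
- exact: ler01.
- by move=> s /subset_itv_oo_cc; rewrite in_itv /=; exact: dF.
- apply: derivable_within_continuous => s; rewrite in_itv /= => /dF.
  by case.
rewrite /f scale1r scale0r addr0 subrKC subr0 mulr1 => ->.
move: s01; rewrite in_itv /= => /rayK s01.
apply: le_trans (ler_norm_sum _ _ _) _; rewrite mulr_suml; apply: ler_sum => i _.
by rewrite normrM mulrC ler_pM ?(MP i).2 ?coord_le_norm.
Qed.

(* With the weight [t ^+ m], the derivatives of a ray integral are again ray
   integrals. *)
Definition ray_integral (R : realType) n (x0 : 'rV[R]_n) m (F : 'rV[R]_n -> R) x : R :=
  \int[@lebesgue_measure R]_(t in `[0, 1]) (t ^+ m * F (ray x0 x t)).

Lemma ray_integrand_continuous (R : realType) n k (B : set 'rV[R]_n) F x0 r x m (t : R) :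
  (forall y, ball x0 r y -> B y) -> Ck k B F -> ball x0 r x -> 0 <= t <= 1 ->
  {for t, continuous (fun t : R => t ^+ m * F (ray x0 x t))}.
Proof.
move=> KB kF xr t01; apply: (@cvgM R R (nbhs t)).
  exact: exprn_continuous.
by apply: ray_continuous; apply: (Ck_continuous kF); exact/KB/ball_ray.
Qed.

Lemma lebesgue01 (R : realType) : fine (@lebesgue_measure R `[0, 1]%classic) = 1.
Proof. by rewrite lebesgue_measure_itv /= lte01 oppr0 addr0. Qed.

Lemma ray_integral_continuous (R : realType) n (B : set 'rV[R]_n) F x0 r m x :
  open B -> 0 < r -> (forall y, `|x0 - y| <= r -> B y) -> Ck 1 B F ->
  ball x0 r x -> {for x, continuous (ray_integral x0 m F)}.
Proof.
move=> oB r0 KB kF xr; have [L L0 LP] := Ck1_lipschitz oB r0 KB kF.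
have KB' y : ball x0 r y -> B y.
  by rewrite -ball_normE /= => /ltW; exact: KB.
apply/(@cvgrPdist_le R R _ (nbhs x)) => e e0.
(* The denominator is L + 1 because L may be 0. *)
have e1 : 0 < e / (L + 1) by rewrite divr_gt0// ltr_wpDl.
near=> y.
have yr : ball x0 r y.
  by near: y; apply: open_nbhs_nbhs; split=> //; exact: ball_open.
have yx : `|x - y| <= e / (L + 1).
  near: y; apply/nbhs_ballP; exists (e / (L + 1)) => // z.
  by rewrite -ball_normE /=; exact: ltW.
have cI z : ball x0 r z -> (@lebesgue_measure R).-integrable `[0, 1]
    (EFin \o (fun t => t ^+ m * F (ray x0 z t))).
  by move=> zr; apply: integrable01 => t t01; exact: (ray_integrand_continuous KB' kF zr t01).
have cB : (@lebesgue_measure R).-integrable `[0, 1]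
    (EFin \o (fun t => t ^+ m * F (ray x0 x t) - t ^+ m * F (ray x0 y t))).
  apply: integrable01 => t t01.
  exact: cvgB (ray_integrand_continuous KB' kF xr t01)
    (ray_integrand_continuous KB' kF yr t01).
rewrite /ray_integral -RintegralB ?cI//.
apply: le_trans; first by apply: (le_normr_Rintegral _ cB).
apply: (@le_trans _ _ (\int[@lebesgue_measure R]_(t in `[0, 1]) (cst e t))); last first.
  by rewrite Rintegral_cst// lebesgue01 mulr1.
apply: le_Rintegral => //.
- apply: integrable01 => t t01; apply: continuous_comp; last exact: norm_continuous.
  exact: cvgB (ray_integrand_continuous KB' kF xr t01)
    (ray_integrand_continuous KB' kF yr t01).
- by apply: integrable01 => t _; exact: cst_continuous.
move=> t; rewrite /= in_itv /= => t01; have /andP[t0 t1] := t01.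
rewrite -mulrBr normrM normrX (ger0_norm t0).
apply: (@le_trans _ _ (1 * (L * `|x - y|))).
  apply: ler_pM => //; first by rewrite exprn_ge0.
    by rewrite exprn_ile1.
  apply: le_trans (LP _ _ (ball_ray xr t01) (ball_ray yr t01)) _.
  rewrite ler_wpM2l//.
  have -> : ray x0 x t - ray x0 y t = t *: (x - y).
    by apply/rowP => i; rewrite !mxE; ring.
  by rewrite normrZ (ger0_norm t0) ler_piMl.
rewrite mul1r; apply: le_trans (ler_wpM2l L0 yx) _.
by rewrite mulrCA ler_piMr ?(ltW e0)// ler_pdivrMr ?mul1r ?lerDl// ltr_wpDl.
Unshelve. all: by end_near. Qed.

(** Differentiation under the integral sign, dominated by a bound of the partial derivative on the
    closed ball. Moving x by s moves the point of the ray at time t by s t, whence the extra factor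
    t. *)
Lemma is_derive_ray_integral (R : realType) n (B : set 'rV[R]_n) F x0 r m x i :
  open B -> 0 < r -> (forall y, `|x0 - y| <= r -> B y) -> Ck 2 B F ->
  ball x0 r x ->
  is_derive x (delta_mx 0 i) (ray_integral x0 m F)
    (ray_integral x0 m.+1 ('D_(delta_mx 0 i) F) x).
Proof.
move=> oB r0 KB kF xr; set v : 'rV[R]_n := delta_mx 0 i.
have KB' y : ball x0 r y -> B y.
  by rewrite -ball_normE /= => /ltW; exact: KB.
have kdF : Ck 1 B ('D_v F) by exact: (kF.2 i).2.
have [|M M0 MP] := @closed_ball_bound R n B ('D_v F) x0 r r0.
  by move=> y /KB; exact: (Ck_continuous kdF).
have : \forall s \near (0 : R), ball x0 r (s *: v + x).
  have : (fun s : R => s *: v + x) @ 0 --> 0 *: v + x.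
    by apply: cvgD; [exact: cvgZr_tmp|exact: cvg_cst].
  rewrite scale0r add0r; apply; apply: open_nbhs_nbhs; split=> //; exact: ball_open.
move=> /nbhs_ballP[d /= d0 dP].
have sB s : s \in `](- d), d[ -> ball x0 r (s *: v + x).
  rewrite in_itv /= -ltr_norml => sd; apply: dP.
  by rewrite -ball_normE /= sub0r normrN.
pose f s t := t ^+ m * F (ray x0 (s *: v + x) t).
have rayE s t : ray x0 (s *: v + x) t = ray x0 x t + s *: (t *: v).
  by apply/rowP => j; rewrite !mxE; ring.
have df (s t : R) : s \in `](- d), d[ -> 0 <= t <= 1 ->
    is_derive s 1 (f ^~ t) (t ^+ m.+1 * 'D_v F (ray x0 (s *: v + x) t)).
  move=> sd t01; have Bs := KB' _ (ball_ray (sB _ sd) t01).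
  have [dF _] := Ck1_differentiable oB (Ck_S kF) Bs.
  rewrite /f; under eq_fun do rewrite rayE.
  have dF' : differentiable F (ray x0 x t + s *: (t *: v)) by rewrite -rayE.
  have D := is_derive_line (@diff_derivable _ _ _ _ _ (t *: v) dF').
  have := @is_deriveZ _ _ _ _ (t ^+ m) s 1 _ D.
  rewrite deriveE// linearZ /= -deriveE//.
  by rewrite rayE exprSr -mulrA.
have d1 (s t : R) : s \in `](- d), d[ -> 0 <= t <= 1 ->
    partial1of2 f s t = t ^+ m.+1 * 'D_v F (ray x0 (s *: v + x) t).
  by move=> sd t01; rewrite partial1of2E (@derive_val _ _ _ _ _ _ _ (df _ _ sd t01)).
have I0 : `](- d), d[%classic (0 : R) by rewrite /= in_itv /= oppr_lt0 d0.
have intf (s : R) : `](- d), d[%classic s ->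
    (@lebesgue_measure R).-integrable `[0, 1] (EFin \o f s).
  move=> sd; apply: integrable01 => t t01.
  exact: (ray_integrand_continuous KB' kF (sB _ sd) t01).
have derf (s t : R) : `](- d), d[%classic s -> `[0, 1]%classic t ->
    derivable (f ^~ t) s 1.
  by rewrite /= in_itv /= in_itv /= => sd t01; have [] := df s t sd t01.
have bound (s t : R) : `](- d), d[%classic s -> `[0, 1]%classic t ->
    `|partial1of2 f s t| <= cst M t.
  move=> sd; rewrite /= in_itv /= => t01; have /andP[t0 t1] := t01.
  rewrite d1// normrM normrX ger0_norm// -[leRHS]mul1r.
  apply: ler_pM; rewrite ?exprn_ge0 ?exprn_ile1//.
  by apply: MP; have := ball_ray (sB _ sd) t01; rewrite -ball_normE /= => /ltW.
have intM : (@lebesgue_measure R).-integrable `[0, 1] (EFin \o cst M).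
  by apply: integrable01 => t _; exact: cst_continuous.
have m01 : measurable (`[0%R, 1%R]%classic : set (measurableTypeR R)) by exact: measurable_itv.
have D1 := derivable_under_integral m01 I0 intf derf (fun=> M0) intM bound.
have D2 := differentiation_under_integral m01 I0 intf derf (fun=> M0) intM bound.
apply: DeriveDef; first exact/derivable1P.
have -> : 'D_v (ray_integral x0 m F) x =
    derive1 (fun s : R => \int[@lebesgue_measure R]_(t in `[0, 1]) f s t) 0.
  rewrite derive1E /derive; set g1 := fun h => h^-1 *: _; set g2 := fun h => h^-1 *: _.
  suff -> : g1 = g2 by [].
  by apply/funext => h; rewrite /g1 /g2 /= addr0 [h *: 1]mulr1 /ray_integral /f /= scale0r add0r.
rewrite D2; apply: eq_Rintegral => t; rewrite inE /= in_itv /= => t01.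
by rewrite d1//= scale0r add0r.
Qed.

Lemma Ck_ray_integral (R : realType) n (B : set 'rV[R]_n) F x0 r m k :
  open B -> 0 < r -> (forall y, `|x0 - y| <= r -> B y) -> Cinfty B F ->
  Ck k (ball x0 r) (ray_integral x0 m F).
Proof.
move=> oB r0 KB; elim: k m F => [|k IH] m F kF.
  by split=> // x xr; exact: ray_integral_continuous (kF 1%N) xr.
split=> [x xr|i]; first exact: ray_integral_continuous (kF 1%N) xr.
have D x xr := @is_derive_ray_integral R n B F x0 r m x i oB r0 KB (kF 2%N) xr.
split=> [x xr|]; first by have [] := D x xr.
have := IH m.+1 ('D_(delta_mx 0 i) F) (fun j => ((kF j.+1).2 i).2).
by apply: Ck_ext => [|x xr]; [exact: ball_open|have [_ ->] := D x xr].
Qed.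

(** The fundamental theorem of calculus along the segment from x0 to x; [G i] is the average over it
    of the i-th partial derivative. *)
Lemma hadamard (R : realType) n (B : set 'rV[R]_n) F x0 :
  open B -> B x0 -> Cinfty B F ->
  exists (C : set 'rV[R]_n) (G : 'I_n -> 'rV[R]_n -> R),
    [/\ open C /\ C x0, forall i, Cinfty C (G i),
        forall i, G i x0 = 'D_(delta_mx 0 i) F x0
      & forall x, C x -> F x = F x0 + \sum_i (x 0 i - x0 0 i) * G i x].
Proof.
move=> oB Bx0 kF.
have /nbhs_ballP[d /= d0 dB] : nbhs x0 B by exact: open_nbhs_nbhs.
(* Half the radius, so that the closed ball also lies in [B]: the bounds above come from
   compactness. *)
pose r := d / 2; have r0 : 0 < r by rewrite divr_gt0.
have KB y : `|x0 - y| <= r -> B y.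
  move=> yr; apply: dB; rewrite -ball_normE /=; apply: le_lt_trans yr _.
  by rewrite /r; lra.
have KB' y : ball x0 r y -> B y by rewrite -ball_normE /= => /ltW; exact: KB.
exists (ball x0 r), (fun i => ray_integral x0 0 ('D_(delta_mx 0 i) F)); split.
- by split; [exact: ball_open|exact: ballxx].
- by move=> i k; apply: Ck_ray_integral oB r0 KB (fun j => ((kF j.+1).2 i).2).
- move=> i; rewrite /ray_integral.
  rewrite (@eq_Rintegral _ _ _ _ _ (cst ('D_(delta_mx 0 i) F x0))).
    by rewrite Rintegral_cst// lebesgue01 mulr1.
  by move=> t _; rewrite expr0 mul1r /ray subrr scaler0 addr0.
have kd i : Ck 0 B ('D_(delta_mx 0 i) F) by exact: ((kF 1%N).2 i).2.
move=> x xr.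
rewrite -(@Rintegral01_sum R _ _ (fun i t => t ^+ 0 * 'D_(delta_mx 0 i) F (ray x0 x t))
  (fun i => x 0 i - x0 0 i)); last first.
  by move=> i t t01; exact: (ray_integrand_continuous KB' (kd i) xr t01).
have cF (t : R) : 0 <= t <= 1 -> {for t, continuous (fun t : R =>
    \sum_i (x 0 i - x0 0 i) * (t ^+ 0 * 'D_(delta_mx 0 i) F (ray x0 x t)))}.
  move=> t01; apply: continuous_at_sum => i; apply: cvgMl_tmp.
  exact: (ray_integrand_continuous KB' (kd i) xr t01).
have dF (t : R) : 0 <= t <= 1 -> is_derive t 1 (fun t : R => F (ray x0 x t))
    (\sum_i (x 0 i - x0 0 i) * (t ^+ 0 * 'D_(delta_mx 0 i) F (ray x0 x t))).
  move=> t01; have Bt := KB' _ (ball_ray xr t01).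
  have [dF eF] := Ck1_differentiable oB (kF 1%N) Bt.
  have := is_derive_line (@diff_derivable _ _ _ _ _ (x - x0) dF).
  rewrite deriveE// eF; congr is_derive; apply: eq_bigr => i _.
  by rewrite !mxE expr0 mul1r.
have E : (\int[@lebesgue_measure R]_(t in `[0%R, 1%R])
    (\sum_i (x 0 i - x0 0 i) * (t ^+ 0 * 'D_(delta_mx 0 i) F (ray x0 x t)))%R%:E
    = (F (ray x0 x 1))%:E - (F (ray x0 x 0))%:E)%E.
  apply: (@continuous_FTC2 R _ (fun t => F (ray x0 x t))); first exact: ltr01.
  - by apply: continuous_in_subspaceT => t; rewrite inE /= in_itv /=; exact: cF.
  - have cray (t : R) : 0 <= t <= 1 -> {for t, continuous (fun t : R => F (ray x0 x t))}.
      move=> t01; apply: ray_continuous; apply: (Ck_continuous (kF 0%N)).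
      exact/KB'/ball_ray.
    split=> [t /subset_itv_oo_cc||].
    + by rewrite in_itv /= => /dF [].
    + by apply: cvg_at_right_filter; apply: cray; rewrite lexx ler01.
    + by apply: cvg_at_left_filter; apply: cray; rewrite lexx ler01.
  - move=> t /subset_itv_oo_cc; rewrite in_itv /= => /dF D.
    by rewrite derive1E (@derive_val _ _ _ _ _ _ _ D).
rewrite /Rintegral E -EFinB -[fine _]/(F (ray x0 x 1) - F (ray x0 x 0)).
by rewrite /ray scale1r scale0r addr0 subrKC addrC subrK.
Qed.

(** * Charts *)

Notation nearby := Defs.dnbhs.

(** The properties of smooth functions on which the calculus of derivations rests. They hold for
    R^n, M and SM, which thus share one theory of tangent vectors, brackets and connections. *)
Record smooth_space (R : realType) (X : diffSpace R) : Prop := SmoothSpace {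
  nearby_filter : forall x : X, Filter (nearby x);
  nearby_point : forall (x : X) W, nearby x W -> W x;
  nearby_nearby : forall (x : X) W, nearby x W -> nearby x (fun y => nearby y W);
  smooth_near : forall (x : X) h,
    smooth_at x h -> nearby x (fun y => smooth_at y h);
  smooth_eq : forall (x : X) h k,
    nearby x (fun y => h y = k y) -> smooth_at x h -> smooth_at x k;
  smooth_comp : forall (x : X) n (B : set 'rV[R]_n) F (h : X -> 'rV[R]_n),
    open B -> B (h x) -> Cinfty B F ->
    (forall j, smooth_at x (fun y => h y 0 j)) -> smooth_at x (fun y => F (h y));
  smooth_cont : forall (x : X) h (B : set R),
    smooth_at x h -> open B -> B (h x) -> nearby x (fun y => B (h y)) }.

(* An atlas, each chart being given by its domain and its coordinates. *)
Record charted (R : realType) (X : diffSpace R) n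
    (K : set (set X * (X -> 'rV[R]_n))) : Prop := Charted {
  chart_cover : forall x, exists2 k, K k & k.1 x;
  chart_nearby : forall x W, nearby x W <-> exists k B,
    [/\ K k /\ k.1 x, open B, B (k.2 x) & forall y, k.1 y -> B (k.2 y) -> W y];
  chart_smooth : forall x h, smooth_at x h <-> exists k B F,
    [/\ K k /\ k.1 x, open B, B (k.2 x), Cinfty B F &
        forall y, k.1 y -> B (k.2 y) -> h y = F (k.2 y)];
  chart_transition : forall k l x, K k -> K l -> k.1 x -> l.1 x ->
    exists B (T : 'rV[R]_n -> 'rV[R]_n),
    [/\ open B, B (k.2 x), forall j, Cinfty B (fun z => T z 0 j) &
        forall y, k.1 y -> B (k.2 y) -> l.1 y /\ l.2 y = T (k.2 y)] }.

Lemma open_setI_preimage (T U : topologicalType) (B : set T) (f : T -> U) C :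
  open B -> (forall x, B x -> {for x, continuous f}) -> open C ->
  open (B `&` f @^-1` C).
Proof.
move=> oB cf oC; rewrite openE => x [Bx Cfx]; apply: filterI.
  exact: open_nbhs_nbhs.
by apply: cf => //; exact: open_nbhs_nbhs.
Qed.

Lemma Cinfty_sub (R : realType) n (B C : set 'rV[R]_n) F :
  C `<=` B -> Cinfty B F -> Cinfty C F.
Proof. by move=> CB kF k; exact: Ck_sub (kF k). Qed.

Lemma Cinfty_continuous_rV (R : realType) m n (B : set 'rV[R]_m)
    (f : 'rV[R]_m -> 'rV[R]_n) :
  (forall j, Cinfty B (fun z => f z 0 j)) ->
  forall x, B x -> {for x, continuous f}.
Proof.
move=> kf x Bx; apply: continuous_rV => j.
exact: Ck_continuous (kf j 0%N) Bx.
Qed.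

Lemma Cinfty_comp (R : realType) m n (B : set 'rV[R]_m) (C : set 'rV[R]_n)
    (f : 'rV[R]_m -> 'rV[R]_n) F :
  open B -> open C -> (forall x, B x -> C (f x)) ->
  (forall j, Cinfty B (fun x => f x 0 j)) -> Cinfty C F -> Cinfty B (F \o f).
Proof. by move=> oB oC BC kf kF k; apply: (Ck_comp oB oC BC _ (kF k)) => j; exact: kf. Qed.

Lemma Cinfty_common (R : realType) m n (B : 'I_n -> set 'rV[R]_m)
    (F : 'I_n -> 'rV[R]_m -> R) x :
  (forall j, [/\ open (B j), B j x & Cinfty (B j) (F j)]) ->
  exists C, [/\ open C, C x, forall j, C `<=` B j & forall j, Cinfty C (F j)].
Proof.
move=> BF; have xB : nbhs x [set z | forall j, B j z].
  apply: (@filter_forall _ _ B (nbhs x) _) => j.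
  by have [oB Bx _] := BF j; exact: open_nbhs_nbhs.
exists [set z | forall j, B j z]°; split=> //; first exact: open_interior.
  by move=> j z /interior_subset.
move=> j; have [_ _] := BF j; apply: Cinfty_sub => z /interior_subset; exact.
Qed.

(** The chart that witnesses a neighbourhood is existential; the transition map carries the witness
    to any chosen chart at x. The next lemma does the same for smooth functions. *)
Lemma charted_nearby (R : realType) (X : diffSpace R) n K (k : _ * (X -> 'rV[R]_n)) x W :
  charted K -> K k -> k.1 x -> nearby x W -> exists2 B, open B /\ B (k.2 x) &
    forall y, k.1 y -> B (k.2 y) -> W y.
Proof.
move=> cX Kk kx /(chart_nearby cX)[l [B [[Kl lx] oB Bx BW]]].
have [C [T [oC Cx kT CT]]] := chart_transition cX Kk Kl kx lx.
exists (C `&` T @^-1` B).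
  split; last by split=> //=; have [_ <-] := CT _ kx Cx.
  exact: open_setI_preimage oC (Cinfty_continuous_rV kT) oB.
by move=> y ky [Cy By]; have [ly e] := CT _ ky Cy; apply: BW => //; rewrite e.
Qed.

Lemma charted_smooth (R : realType) (X : diffSpace R) n K (k : _ * (X -> 'rV[R]_n)) x h :
  charted K -> K k -> k.1 x -> smooth_at x h ->
  exists B F, [/\ open B, B (k.2 x), Cinfty B F &
    forall y, k.1 y -> B (k.2 y) -> h y = F (k.2 y)].
Proof.
move=> cX Kk kx /(chart_smooth cX)[l [B [F [[Kl lx] oB Bx kF BF]]]].
have [C [T [oC Cx kT CT]]] := chart_transition cX Kk Kl kx lx.
have oD : open (C `&` T @^-1` B).
  exact: open_setI_preimage oC (Cinfty_continuous_rV kT) oB.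
exists (C `&` T @^-1` B), (F \o T); split=> //.
- by split=> //=; have [_ <-] := CT _ kx Cx.
- apply: Cinfty_comp oD oB _ _ kF; first by move=> z [].
  by move=> j; apply: Cinfty_sub (kT j) => z [].
- move=> y ky [Cy By]; have [ly e] := CT _ ky Cy.
  by rewrite /= -e; apply: BF => //; rewrite e.
Qed.

Lemma charted_smooth_space (R : realType) (X : diffSpace R) n
    (K : set (set X * (X -> 'rV[R]_n))) : charted K -> smooth_space X.
Proof.
move=> cX; split.
- move=> x; have [k Kk kx] := chart_cover cX x; split.
  + by apply/(chart_nearby cX); exists k, setT; split=> //; exact: openT.
  + move=> P Q /(charted_nearby cX Kk kx)[B [oB Bx] BP].
    move=> /(charted_nearby cX Kk kx)[C [oC Cx] CQ].
    apply/(chart_nearby cX); exists k, (B `&` C); split=> //; first exact: openI.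
    by move=> y ky [By Cy]; split; [exact: BP|exact: CQ].
  + move=> P Q PQ /(chart_nearby cX)[l [B [? ? ? BP]]].
    by apply/(chart_nearby cX); exists l, B; split=> // y ly By; exact/PQ/BP.
- by move=> x W /(chart_nearby cX)[l [B [[_ lx] _ Bx]]]; exact.
- move=> x W /(chart_nearby cX)[l [B [Kl oB Bx BW]]]; apply/(chart_nearby cX).
  exists l, B; split=> // y ly By; apply/(chart_nearby cX); exists l, B.
  by split=> //; split=> //; case: Kl.
- move=> x h /(chart_smooth cX)[l [B [F [Kl oB Bx kF BF]]]].
  apply/(chart_nearby cX); exists l, B; split=> // y ly By.
  apply/(chart_smooth cX); exists l, B, F.
  by split=> //; split=> //; case: Kl.
- move=> x h h'; have [k Kk kx] := chart_cover cX x.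
  move=> /(charted_nearby cX Kk kx)[B [oB Bx] BP].
  move=> /(charted_smooth cX Kk kx)[C [F [oC Cx kF CF]]].
  apply/(chart_smooth cX); exists k, (B `&` C), F; split=> //; first exact: openI.
    by apply: Cinfty_sub kF => z [].
  by move=> y ky [By Cy]; rewrite -BP// CF.
- move=> x m B F h oB Bhx kF; have [k Kk kx] := chart_cover cX x.
  move=> /(_ _)/(charted_smooth cX Kk kx) sh.
  have /choice[C sC] := sh; have /choice[G sG] := sC.
  have [|D [oD Dx DC kG]] := @Cinfty_common R n m C G (k.2 x).
    by move=> j; have [] := sG j.
  pose f z := \row_j G j z.
  have kf j : Cinfty D (fun z => f z 0 j).
    rewrite [X in Cinfty D X](_ : _ = G j) //.
    by apply/funext => z; rewrite mxE.
  have hf y : k.1 y -> D (k.2 y) -> h y = f (k.2 y).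
    move=> ky Dy; apply/rowP => j; rewrite mxE.
    by have [_ _ _] := sG j; apply=> //; exact: DC.
  have oE : open (D `&` f @^-1` B).
    exact: open_setI_preimage oD (Cinfty_continuous_rV kf) oB.
  apply/(chart_smooth cX); exists k, (D `&` f @^-1` B), (F \o f); split=> //.
  + by split=> //=; rewrite -hf.
  + apply: Cinfty_comp oE oB _ _ kF; first by move=> z [].
    by move=> j; apply: Cinfty_sub (kf j) => z [].
  + by move=> y ky [Dy _]; rewrite hf.
- move=> x h B /(chart_smooth cX)[l [C [F [Kl oC Cx kF CF]]]] oB Bhx.
  apply/(chart_nearby cX); exists l, (C `&` F @^-1` B); split=> //.
  + apply: open_setI_preimage oC _ oB => z Cz.
    exact: Ck_continuous (kF 0%N) Cz.
  + by split=> //=; rewrite -CF//; case: Kl.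
  + by move=> y ly [Cy By]; rewrite CF.
Qed.

(** R^n as a [diffSpace], so that inverse charts and the retraction onto SM become smooth maps along
    which derivations are pushed forward. *)
Definition rspace (R : realType) n : diffSpace R :=
  @DiffSpace R 'rV[R]_n (fun x => nbhs x)
    (fun x h => exists B, [/\ open B, B x & Cinfty B h]).

Lemma rspace_charted (R : realType) n :
  @charted R (rspace R n) n [set (setT, id)].
Proof.
split.
- by move=> x; exists (setT, id).
- move=> x W; split=> [xW|[k [B [[-> _] /= oB Bx BW]]]].
    exists (setT, id), (W : set 'rV[R]_n)°; split=> //; first exact: open_interior.
    by move=> y _; exact: interior_subset.
  have xB : nbhs (x : 'rV[R]_n) B by exact: open_nbhs_nbhs.
  by apply: (@filterS _ (nbhs (x : 'rV[R]_n)) _ B) => // y; exact: BW.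
- move=> x h; split=> [[B [oB Bx kh]]|[k [B [F [[-> _] /= oB Bx kF BF]]]]].
    by exists (setT, id), B, h; split.
  by exists B; split=> // m; apply: Ck_ext (kF m) => // y /BF ->.
- move=> k l x -> -> _ _; exists setT, id; split=> //; first exact: openT.
  by move=> j k'; exact: Ck_coord.
Qed.

Definition mcharts (R : realType) n (M : oriented_manifold R n) :
    set (set M * (M -> 'rV[R]_n)) :=
  [set k | exists2 c, atlas M c & k = (cdom c, cmap c)].

Lemma chart_overlap (R : realType) (T : topologicalType) n (c : chart R T n) C :
  is_chart c -> cmap c @` (cdom c `&` C) = cmap c @` cdom c `&` cinv c @^-1` C.
Proof.
move=> [_ _ cK _ _]; apply/seteqP; split=> x.
  by move=> [p [dp Cp] <-]; split; [exists p|rewrite /= cK].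
by move=> [[p dp <-]] /=; rewrite cK// => Cp; exists p.
Qed.

Lemma mspace_charted (R : realType) n (M : oriented_manifold R n) :
  charted (@mcharts R n M).
Proof.
have [chP coverP transP] := m_atlas M; split.
- by move=> x; have [c Ac cx] := coverP x; exists (cdom c, cmap c) => //; exists c.
- move=> x W; split=> [xW|[_ [B [[[c Ac ->] /= cx] oB Bx BW]]]].
    have [c Ac cx] := coverP x; have [oc oi cK cc ci] := chP _ Ac.
    exists (cdom c, cmap c), (cmap c @` cdom c `&` cinv c @^-1` W°); split => /=.
    + by split=> //; exists c.
    + exact: open_setI_preimage oi ci (open_interior W).
    + by split; [exists x|rewrite /= cK].
    + by move=> y cy [_] /=; rewrite cK//; exact: interior_subset.
  have [oc oi cK cc ci] := chP _ Ac.
  apply: (@filterS _ (nbhs (x : mtop M)) _ (cdom c `&` cmap c @^-1` B)).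
    by move=> y [cy By]; exact: BW.
  by apply: open_nbhs_nbhs; split=> //; exact: open_setI_preimage oc cc oB.
- move=> x h; split=> [[c [B [Ac cx [oB Bx] BI kh]]]|].
    have [oc oi cK cc ci] := chP _ Ac.
    exists (cdom c, cmap c), B, (h \o cinv c); split=> //=; first by split=> //; exists c.
    by move=> y cy _; rewrite cK.
  move=> [_ [B [F [[[c Ac ->] /= cx] oB Bx kF BF]]]].
  have [oc oi cK cc ci] := chP _ Ac.
  exists c, (B `&` cmap c @` cdom c); split=> //.
  + by split; [exact: openI|split=> //; exists x].
  + move=> k; apply: (@Ck_ext _ _ _ _ F); first exact: openI.
      by move=> z [+ [y cy e]]; rewrite -e => By; rewrite /= cK// BF.
    by apply: Ck_sub (kF k) => z [].
- move=> _ _ x [c Ac ->] [c' Ac' ->] /= cx cx'.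
  have [oc oi cK cc ci] := chP _ Ac; have [kt _] := transP _ _ Ac Ac'.
  exists (cmap c @` (cdom c `&` cdom c')), (cmap c' \o cinv c); split=> //.
  + rewrite chart_overlap; last exact: chP.
    by apply: open_setI_preimage oi ci _; have [] := chP _ Ac'.
  + by exists x.
  + move=> y cy [z [cz cz'] e]; have zy : z = y by rewrite -[z]cK// e cK.
    by rewrite /= cK -?zy.
Qed.

Lemma mspace_smooth (R : realType) n (M : oriented_manifold R n) : smooth_space M.
Proof. exact: charted_smooth_space (@mspace_charted R n M). Qed.

Lemma rspace_smooth (R : realType) n : smooth_space (rspace R n).
Proof. exact: charted_smooth_space (@rspace_charted R n). Qed.

(** * Tangent vectors and vector fields *)

Section SmoothFunctions.
Context (R : realType) (X : diffSpace R) (sX : smooth_space X).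
Implicit Types (x : X) (h k : X -> R) (W : set X).

Lemma nearbyS x W W' : (forall y, W y -> W' y) -> nearby x W -> nearby x W'.
Proof. have FX := nearby_filter sX x; exact: filterS. Qed.

Lemma nearbyI x W W' :
  nearby x W -> nearby x W' -> nearby x (fun y => W y /\ W' y).
Proof. have FX := nearby_filter sX x; exact: filterI. Qed.

Lemma nearbyT x W : (forall y, W y) -> nearby x W.
Proof. by move=> WT; have FX := nearby_filter sX x; apply: filterE. Qed.

Lemma nearby_forall x (I : finType) (W : I -> set X) :
  (forall i, nearby x (W i)) -> nearby x (fun y => forall i, W i y).
Proof. have FX := nearby_filter sX x; exact: filter_forall. Qed.

Lemma smooth_cst x (a : R) : smooth_at x (fun=> a).
Proof.
(* A constant is a smooth function of no coordinates at all. *)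
have := @smooth_comp _ _ sX x 0 setT (fun=> a) (fun=> 0) openT I.
by apply=> [k|[]//]; exact: Ck_cst.
Qed.

Lemma smooth_comp2 x h k (F : 'rV[R]_2 -> R) :
  Cinfty setT F -> smooth_at x h -> smooth_at x k ->
  smooth_at x (fun y => F (\row_j (if j == ord0 then h y else k y))).
Proof.
move=> kF sh sk; apply: (smooth_comp sX openT) => // j.
rewrite [X in smooth_at x X](_ : _ = if j == ord0 then h else k); first by case: ifP.
by apply/funext => y; rewrite mxE; case: ifP.
Qed.

Lemma smoothD x h k : smooth_at x h -> smooth_at x k ->
  smooth_at x (fun y => h y + k y).
Proof.
move=> sh sk; have := @smooth_comp2 x h k (fun z => z 0 0 + z 0 ord_max).
move=> /(_ _ sh sk); rewrite (_ : (fun y => _ + _) = (fun y => h y + k y)).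
  by apply=> m; apply: CkD; [exact: openT|exact: Ck_coord..].
by apply/funext => y; rewrite !mxE.
Qed.

Lemma smoothM x h k : smooth_at x h -> smooth_at x k ->
  smooth_at x (fun y => h y * k y).
Proof.
move=> sh sk; have := @smooth_comp2 x h k (fun z => z 0 0 * z 0 ord_max).
move=> /(_ _ sh sk); rewrite (_ : (fun y => _ * _) = (fun y => h y * k y)).
  by apply=> m; apply: CkM; [exact: openT|exact: Ck_coord..].
by apply/funext => y; rewrite !mxE.
Qed.

Lemma smoothZ x a h : smooth_at x h -> smooth_at x (fun y => a * h y).
Proof. by move=> sh; apply: smoothM => //; exact: smooth_cst. Qed.

Lemma smoothB x h k : smooth_at x h -> smooth_at x k ->
  smooth_at x (fun y => h y - k y).
Proof.
move=> sh sk; have := smoothD sh (smoothZ (-1) sk); congr smooth_at.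
by apply/funext => y; rewrite mulN1r.
Qed.

Lemma smooth_sum x (I : Type) (r : seq I) (h : I -> X -> R) :
  (forall i, smooth_at x (h i)) -> smooth_at x (fun y => \sum_(i <- r) h i y).
Proof.
move=> sh; elim: r => [|i r IH].
  have := smooth_cst x 0; congr smooth_at.
  by apply/funext => y; rewrite big_nil.
have := smoothD (sh i) IH; congr smooth_at.
by apply/funext => y; rewrite big_cons.
Qed.

Lemma smooth_prod x (I : Type) (r : seq I) (h : I -> X -> R) :
  (forall i, smooth_at x (h i)) -> smooth_at x (fun y => \prod_(i <- r) h i y).
Proof.
move=> sh; elim: r => [|i r IH].
  have := smooth_cst x 1; congr smooth_at.
  by apply/funext => y; rewrite big_nil.
have := smoothM (sh i) IH; congr smooth_at.
by apply/funext => y; rewrite big_cons.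
Qed.

Lemma smooth_powR x h a : smooth_at x h -> 0 < h x ->
  smooth_at x (fun y => h y `^ a).
Proof.
move=> sh h0.
have oB : open [set z : 'rV[R]_1 | 0 < z 0 0].
  rewrite (_ : [set z | _] = setT `&` (fun z : 'rV[R]_1 => z 0 0) @^-1` [set t | 0 < t]).
    apply: open_setI_preimage; first exact: openT.
      by move=> z _; exact: coord_continuous.
    exact: open_gt.
  by apply/seteqP; split=> z //= [].
have := @smooth_comp _ _ sX x 1 _ (fun z => z 0 0 `^ a) (fun y => \row_j h y) oB.
rewrite (_ : (fun y => _ `^ a) = (fun y => h y `^ a)); last first.
  by apply/funext => y; rewrite mxE.
apply=> [|m|j]; first by rewrite /= mxE.
  by apply: Ck_powR => //; exact: Ck_coord.
by move: sh; congr smooth_at; apply/funext => y; rewrite mxE.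
Qed.

End SmoothFunctions.

Section TangentVectors.
Context (R : realType) (X : diffSpace R) (sX : smooth_space X).
Implicit Types (x : X) (h k : X -> R) (W : set X) (v : tvec X).

Lemma tangentM x v h k : tangent x v -> smooth_at x h -> smooth_at x k ->
  v (fun y => h y * k y) = v h * k x + h x * v k.
Proof. by move=> [_ _]; exact. Qed.

Lemma tangent_lin x v a h k : tangent x v -> smooth_at x h -> smooth_at x k ->
  v (fun y => a * h y + k y) = a * v h + v k.
Proof. by move=> [_ + _]; exact. Qed.

Lemma tangentD x v h k : tangent x v -> smooth_at x h -> smooth_at x k ->
  v (fun y => h y + k y) = v h + v k.
Proof.
move=> tv sh sk; rewrite -[v h]mul1r -(tangent_lin 1 tv sh sk); congr v.
by apply/funext => y; rewrite mul1r.
Qed.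

Lemma smooth_indic x W : nearby x W -> smooth_at x (\1_W : X -> R).
Proof.
move=> xW; apply: (smooth_eq sX) (smooth_cst sX x 1).
by apply: (nearbyS sX) xW => y Wy; rewrite indicE mem_set.
Qed.

(* The indicator of a neighbourhood is smooth and idempotent, so the Leibniz
   rule kills it. *)
Lemma tangent_indic x v W : tangent x v -> nearby x W -> v \1_W = 0.
Proof.
move=> tv xW; have := tangentM tv (smooth_indic xW) (smooth_indic xW).
have Wx : \1_W x = 1 :> R by rewrite indicE mem_set//; exact: (nearby_point sX).
rewrite Wx mulr1 mul1r (_ : (fun y => _ * _) = \1_W); first lra.
by apply/funext => y; rewrite !indicE; case: (_ \in _); rewrite ?mulr1 ?mulr0.
Qed.

Lemma tangent_mul_indic x v W h : tangent x v -> nearby x W ->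
  smooth_at x h -> v (fun y => \1_W y * h y) = v h.
Proof.
move=> tv xW sh; rewrite (tangentM tv (smooth_indic xW) sh) (tangent_indic tv xW).
by rewrite mul0r add0r indicE mem_set ?mul1r//; exact: (nearby_point sX).
Qed.

(** Multiplied by the indicator of the set where they agree, h and k become the same function, and
    this indicator is invisible to v. If one of them is not smooth at x then neither is, and both
    values are the normalised 0. *)
Lemma tangent_eq x v h k : tangent x v -> nearby x (fun y => h y = k y) ->
  v h = v k.
Proof.
move=> tv hk; case: (pselect (smooth_at x h)) => [sh|nsh]; last first.
  have [v0 _ _] := tv; rewrite !v0// => sk; apply: nsh.
  by apply: (smooth_eq sX) sk; apply: (nearbyS sX) hk => y ->.
have sk := smooth_eq sX hk sh.
rewrite -(tangent_mul_indic tv hk sh) -(tangent_mul_indic tv hk sk); congr v.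
apply/funext => y; rewrite indicE; case: (boolP (y \in _)) => [|_].
  by rewrite inE => ->.
by rewrite !mul0r.
Qed.

Lemma tangent_cst x v a : tangent x v -> v (fun=> a) = 0.
Proof.
move=> tv; have xT : nearby x setT by exact: (nearbyT sX).
have v0 : v (fun=> 0) = 0.
  have := tangent_lin (-1) tv (smooth_cst sX x 0) (smooth_cst sX x 0).
  by rewrite /= mulr0 addr0 mulN1r addNr.
have := tangent_lin a tv (smooth_indic xT) (smooth_cst sX x 0).
rewrite (tangent_indic tv xT) mulr0 add0r v0 => <-; congr v.
by apply/funext => y; rewrite indicE mem_set// mulr1 addr0.
Qed.

Lemma tangentZ x v a h : tangent x v -> smooth_at x h ->
  v (fun y => a * h y) = a * v h.
Proof.
move=> tv sh; have := tangent_lin a tv sh (smooth_cst sX x 0).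
rewrite (tangent_cst 0 tv) addr0 => <-; congr v.
by apply/funext => y; rewrite addr0.
Qed.

Lemma tangentB x v h k : tangent x v -> smooth_at x h -> smooth_at x k ->
  v (fun y => h y - k y) = v h - v k.
Proof.
move=> tv sh sk; have := tangentD tv sh (smoothZ sX (-1) sk).
rewrite (tangentZ _ tv sk) mulN1r => <-; congr v.
by apply/funext => y; rewrite mulN1r.
Qed.

Lemma tangent_sum x v (I : Type) (r : seq I) (h : I -> X -> R) :
  tangent x v -> (forall i, smooth_at x (h i)) ->
  v (fun y => \sum_(i <- r) h i y) = \sum_(i <- r) v (h i).
Proof.
move=> tv sh; elim: r => [|i r IH].
  rewrite big_nil; apply: etrans (tangent_cst 0 tv); congr v.
  by apply/funext => y; rewrite big_nil.
rewrite big_cons -IH -(tangentD tv (sh i) (smooth_sum sX r sh)); congr v.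
by apply/funext => y; rewrite big_cons.
Qed.

(** By Hadamard's lemma F(h) is a constant plus the sum of (h_j - h_j(x)) G_j(h). The first factors
    vanish at x, so the Leibniz rule leaves G_j(h(x)), a partial derivative of F, times v(h_j). *)
Lemma tangent_comp x v n (B : set 'rV[R]_n) F (h : X -> 'rV[R]_n) :
  tangent x v -> open B -> B (h x) -> Cinfty B F ->
  (forall j, smooth_at x (fun y => h y 0 j)) ->
  v (fun y => F (h y)) =
    \sum_j 'D_(delta_mx 0 j) F (h x) * v (fun y => h y 0 j).
Proof.
move=> tv oB Bhx kF sh.
have [C [G [[oC Chx] kG Gx FG]]] := hadamard oB Bhx kF.
have xC : nearby x (fun y => C (h y)).
  have /nbhs_ballP[r /= r0 rC] : nbhs (h x) C by exact: open_nbhs_nbhs.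
  have : nearby x (fun y => forall j, ball (h x 0 j) r (h y 0 j)).
    apply: (nearby_forall sX) => j.
    by apply: (smooth_cont sX (sh j)); [exact: ball_open|exact: ballxx].
  apply: (nearbyS sX) => y hy; apply: rC; split=> // i j; rewrite ord1; exact: hy.
have sG j : smooth_at x (fun y => G j (h y)) by exact: (smooth_comp sX oC Chx).
have sd j : smooth_at x (fun y => h y 0 j - h x 0 j).
  by apply: (smoothB sX) => //; exact: (smooth_cst sX).
rewrite (@tangent_eq x v _ (fun y => F (h x) +
    \sum_j (h y 0 j - h x 0 j) * G j (h y))) //; last first.
  by apply: (nearbyS sX) xC => y /FG.
rewrite (tangentD tv)//; [|exact: (smooth_cst sX)|]; last first.
  by apply: (smooth_sum sX) => j; exact: (smoothM sX).
rewrite (tangent_cst _ tv) add0r (tangent_sum _ tv)//; last first.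
  by move=> j; exact: (smoothM sX).
apply: eq_bigr => j _; rewrite (tangentM tv)// subrr mul0r addr0 Gx mulrC.
rewrite (tangentB tv)//; last exact: (smooth_cst sX).
by rewrite (tangent_cst _ tv) subr0.
Qed.

Lemma tangent_scaleD x a v w : tangent x v -> tangent x w -> tangent x (a *: v + w).
Proof.
move=> tv tw; split=> [h nsh|b h k sh sk|h k sh sk].
- have [v0 _ _] := tv; have [w0 _ _] := tw.
  by rewrite !fctE v0// w0// scaler0 addr0.
- rewrite !fctE (tangent_lin b tv sh sk) (tangent_lin b tw sh sk).
  by rewrite /GRing.scale /=; ring.
- rewrite !fctE (tangentM tv sh sk) (tangentM tw sh sk).
  by rewrite /GRing.scale /=; ring.
Qed.

Lemma tangent0 x : tangent x (0 : tvec X).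
Proof.
have z h : (0 : tvec X) h = 0 by [].
by split=> [h nsh|b h k sh sk|h k sh sk]; rewrite !z ?mulr0 ?mul0r ?addr0.
Qed.

Lemma tangent_scale x a v : tangent x v -> tangent x (a *: v).
Proof.
by move=> tv; have := tangent_scaleD a tv (tangent0 x); rewrite addr0.
Qed.

Lemma tangent_sum_scale x (I : Type) (r : seq I) (a : I -> R) (v : I -> tvec X) :
  (forall i, tangent x (v i)) -> tangent x (\sum_(i <- r) a i *: v i).
Proof.
move=> tv; elim: r => [|i r IH]; first by rewrite big_nil; exact: tangent0.
by rewrite big_cons; exact: tangent_scaleD.
Qed.

Lemma bracketE x (V W : X -> tvec X) h : smooth_at x h ->
  bracket V W x h = V x (fun y => W y h) - W x (fun y => V y h).
Proof. by move=> sh; rewrite /bracket; case: asboolP. Qed.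

Lemma bracket_tangent x (V W : X -> tvec X) :
  smooth_field_at x V -> smooth_field_at x W -> tangent x (bracket V W x).
Proof.
move=> [tV sV] [tW sW].
have tVx := nearby_point sX tV; have tWx := nearby_point sX tW.
split=> [h nsh|a h k sh sk|h k sh sk].
- by rewrite /bracket; case: asboolP.
- rewrite !bracketE//; last by apply: (smoothD sX) => //; exact: (smoothZ sX).
  have nhk := nearbyI sX (smooth_near sX sh) (smooth_near sX sk).
  rewrite (@tangent_eq x (V x) _ (fun y => a * W y h + W y k)) //; last first.
    apply: (nearbyS sX) (nearbyI sX nhk tW) => y [[shy sky] tWy].
    exact: (tangent_lin a tWy).
  rewrite (@tangent_eq x (W x) _ (fun y => a * V y h + V y k)) //; last first.
    apply: (nearbyS sX) (nearbyI sX nhk tV) => y [[shy sky] tVy].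
    exact: (tangent_lin a tVy).
  rewrite (tangent_lin _ tVx (sW _ sh) (sW _ sk)).
  by rewrite (tangent_lin _ tWx (sV _ sh) (sV _ sk)); ring.
- rewrite !bracketE//; last exact: (smoothM sX).
  have nhk := nearbyI sX (smooth_near sX sh) (smooth_near sX sk).
  rewrite (@tangent_eq x (V x) _ (fun y => W y h * k y + h y * W y k)) //; last first.
    apply: (nearbyS sX) (nearbyI sX nhk tW) => y [[shy sky] tWy].
    exact: (tangentM tWy).
  rewrite (@tangent_eq x (W x) _ (fun y => V y h * k y + h y * V y k)) //; last first.
    apply: (nearbyS sX) (nearbyI sX nhk tV) => y [[shy sky] tVy].
    exact: (tangentM tVy).
  have sVh := sV _ sh; have sVk := sV _ sk; have sWh := sW _ sh; have sWk := sW _ sk.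
  rewrite (tangentD tVx) ?(tangentD tWx)//; try exact: (smoothM sX).
  by rewrite !(tangentM tVx)// !(tangentM tWx)//; ring.
Qed.

End TangentVectors.

Section SmoothMaps.
Context (R : realType) (X Y : diffSpace R) (sX : smooth_space X) (sY : smooth_space Y).

Definition smooth_map_at (f : X -> Y) (x : X) : Prop :=
  (forall W, nearby (f x) W -> nearby x (fun y => W (f y))) /\
  (forall h, smooth_at (f x) h -> smooth_at x (fun y => h (f y))).

Lemma differentialE (f : X -> Y) x (v : tvec X) h :
  smooth_at (f x) h -> differential f x v h = v (fun y => h (f y)).
Proof. by move=> sh; rewrite /differential; case: asboolP. Qed.

Lemma differential_tangent (f : X -> Y) x (v : tvec X) :
  smooth_map_at f x -> tangent x v -> tangent (f x) (differential f x v).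
Proof.
move=> [_ sf] tv; split=> [h nsh|a h k sh sk|h k sh sk].
- by rewrite /differential; case: asboolP.
- rewrite !differentialE//; first by rewrite (tangent_lin _ tv (sf _ sh) (sf _ sk)).
  by apply: (smoothD sY) => //; exact: (smoothZ sY).
- rewrite !differentialE//; first by rewrite (tangentM tv (sf _ sh) (sf _ sk)).
  exact: (smoothM sY).
Qed.

Lemma differential_scaleD (f : X -> Y) x a (v w : tvec X) :
  differential f x (a *: v + w) = a *: differential f x v + differential f x w.
Proof.
apply/funext => h; rewrite !fctE /differential; case: asboolP => // _.
by rewrite scaler0 addr0.
Qed.

(** Reduces smoothness of a map to that of its coordinates, continuity included. *)
Lemma smooth_map_charted n (K : set (set Y * (Y -> 'rV[R]_n))) (f : X -> Y) k x :
  charted K -> K k -> k.1 (f x) -> nearby x (fun y => k.1 (f y)) ->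
  (forall j, smooth_at x (fun y => k.2 (f y) 0 j)) -> smooth_map_at f x.
Proof.
move=> cY Kk kfx xk sk.
have near_open (B : set 'rV[R]_n) : open B -> B (k.2 (f x)) ->
    nearby x (fun y => k.1 (f y) /\ B (k.2 (f y))).
  move=> oB Bx; apply: (nearbyI sX) => //.
  have /nbhs_ballP[r /= r0 rB] : nbhs (k.2 (f x)) B by exact: open_nbhs_nbhs.
  have : nearby x (fun y => forall j, ball (k.2 (f x) 0 j) r (k.2 (f y) 0 j)).
    apply: (nearby_forall sX) => j.
    by apply: (smooth_cont sX (sk j)); [exact: ball_open|exact: ballxx].
  apply: (nearbyS sX) => y hy; apply: rB; split=> // i j; rewrite ord1; exact: hy.
split=> [W /(charted_nearby cY Kk kfx)[B [oB Bx] BW]|h].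
  by apply: (nearbyS sX) (near_open B oB Bx) => y [ky By]; exact: BW.
move=> /(charted_smooth cY Kk kfx)[B [F [oB Bx kF BF]]].
apply: (smooth_eq sX) (smooth_comp sX oB Bx kF sk).
by apply: (nearbyS sX) (near_open B oB Bx) => y [ky By]; rewrite BF.
Qed.

End SmoothMaps.

Lemma tangent_coord (R : realType) (X : diffSpace R) n
    (K : set (set X * (X -> 'rV[R]_n))) k x B F h v :
  charted K -> K k -> k.1 x -> open B -> B (k.2 x) -> Cinfty B F ->
  (forall y, k.1 y -> B (k.2 y) -> h y = F (k.2 y)) -> tangent x v ->
  v h = \sum_j 'D_(delta_mx 0 j) F (k.2 x) * v (fun y => k.2 y 0 j).
Proof.
move=> cX Kk kx oB Bx kF hF tv; have sX := charted_smooth_space cX.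
rewrite -(tangent_comp sX tv oB Bx kF).
  apply: (tangent_eq sX tv); apply/(chart_nearby cX); exists k, B.
  by split.
move=> j; apply/(chart_smooth cX); exists k, setT, (fun z => z 0 j).
by split=> //; [exact: openT|move=> m; exact: Ck_coord].
Qed.

Lemma tangent_ext (R : realType) (X : diffSpace R) n
    (K : set (set X * (X -> 'rV[R]_n))) k x v w :
  charted K -> K k -> k.1 x -> tangent x v -> tangent x w ->
  (forall j, v (fun y => k.2 y 0 j) = w (fun y => k.2 y 0 j)) -> v = w.
Proof.
move=> cX Kk kx tv tw vw; apply/funext => h.
case: (pselect (smooth_at x h)) => [sh|nsh]; last first.
  by have [-> // _ _] := tv; have [-> // _ _] := tw.
have [B [F [oB Bx kF hF]]] := charted_smooth cX Kk kx sh.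
rewrite (tangent_coord cX Kk kx oB Bx kF hF tv).
rewrite (tangent_coord cX Kk kx oB Bx kF hF tw).
by apply: eq_bigr => j _; rewrite vw.
Qed.

(** * The sphere bundle *)

Lemma smooth_chart_coord (R : realType) (X : diffSpace R) n
    (K : set (set X * (X -> 'rV[R]_n))) k x j :
  charted K -> K k -> k.1 x -> smooth_at x (fun y => k.2 y 0 j).
Proof.
move=> cX Kk kx; apply/(chart_smooth cX); exists k, setT, (fun z => z 0 j).
by split=> //; [exact: openT|move=> m; exact: Ck_coord].
Qed.

Lemma mchart (R : realType) n (M : oriented_manifold R n) c :
  atlas M c -> @mcharts R n M (cdom c, cmap c).
Proof. by move=> Ac; exists c. Qed.

Definition scharts (R : realType) n (M : oriented_manifold R n)
    (g : M -> tvec M -> tvec M -> R) :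
    set (set (sphere_bundle g) * (sphere_bundle g -> 'rV[R]_(n + n))) :=
  [set k | exists2 c, atlas M c &
     k = (fun w => cdom c (sval w).1, fun w => tcoord c (sval w))].

(** The coordinates are those of TM, redundant by one on SM; [charted] asks for no inverse, so they
    are admissible. A transition map is the one of M on the base and its Jacobian on the fibre
    coordinates. *)
Lemma sphere_charted (R : realType) n (M : oriented_manifold R n)
    (g : M -> tvec M -> tvec M -> R) : charted (@scharts R n M g).
Proof.
have [chP coverP transP] := m_atlas M; split.
- move=> x; have [c Ac cx] := coverP (sval x).1.
  by exists (fun w => cdom c (sval w).1, fun w => tcoord c (sval w)) => //; exists c.
- move=> x W; split=> [[c [B [Ac cx [oB Bx] BW]]]|[_ [B [[[c Ac ->] /= cx] oB Bx BW]]]].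
    exists (fun w => cdom c (sval w).1, fun w => tcoord c (sval w)), B.
    by split=> //; split=> //; exists c.
  by exists c, B.
- move=> x h; split=> [[c [B [F [Ac cx [oB Bx] kF BF]]]]|
    [_ [B [F [[[c Ac ->] /= cx] oB Bx kF BF]]]]].
    exists (fun w => cdom c (sval w).1, fun w => tcoord c (sval w)), B, F.
    by split=> //; split=> //; exists c.
  by exists c, B, F.
- move=> _ _ x [c Ac ->] [c' Ac' ->] /= cx cx'.
  have [oc oi cK cc ci] := chP _ Ac; have [oc' _ _ _ _] := chP _ Ac'.
  have [kt _] := transP _ _ Ac Ac'.
  set Bm := cmap c @` (cdom c `&` cdom c') in kt.
  set t := fun j (x : 'rV[R]_n) => cmap c' (cinv c x) 0 j in kt.
  have oBm : open Bm.
    by rewrite /Bm chart_overlap; [exact: open_setI_preimage oi ci oc'|exact: chP].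
  have ls i : (fun z : 'rV[R]_(n + n) => lsubmx z 0 i) = (fun z => z 0 (lshift n i)).
    by apply/funext => z; rewrite mxE.
  have cl z : {for z, continuous (lsubmx : 'rV[R]_(n + n) -> 'rV[R]_n)}.
    by apply: continuous_rV => i; rewrite ls; exact: coord_continuous.
  pose B : set 'rV[R]_(n + n) := setT `&` lsubmx @^-1` Bm.
  have oB : open B by apply: open_setI_preimage oBm => //; exact: openT.
  have kl i : Cinfty B (fun z : 'rV[R]_(n + n) => lsubmx z 0 i).
    by rewrite ls => k; exact: Ck_coord.
  have Bl z : B z -> Bm (lsubmx z) by case.
  exists B, (fun z => row_mx (\row_j t j (lsubmx z))
    (\row_j \sum_i 'D_(delta_mx 0 i) (t j) (lsubmx z) * z 0 (rshift n i))).
  split=> //.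
  + by split=> //=; rewrite /tcoord row_mxKl; exists (sval x).1.
  + move=> j; case: (fintype.split_ordP j) => i ->.
      rewrite [X in Cinfty B X](_ : _ = t i \o lsubmx).
        exact: Cinfty_comp oB oBm Bl kl (kt i).
      by apply/funext => z; rewrite row_mxEl mxE.
    rewrite [X in Cinfty B X](_ : _ = fun z => \sum_j
        ('D_(delta_mx 0 j) (t i) \o lsubmx) z * z 0 (rshift n j)); last first.
      by apply/funext => z; rewrite row_mxEr mxE.
    move=> k; apply: Ck_sum => // m; apply: CkM => //; last exact: Ck_coord.
    by apply: (Ck_comp oB oBm Bl) => [i'|]; [exact: kl|exact: ((kt i k.+1).2 m).2].
  + move=> w cw [_]; rewrite /= /tcoord row_mxKl => Bw.
    have cw' : cdom c' (sval w).1.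
      by move: Bw => [z [cz cz'] e]; rewrite -[_.1]cK// -e cK.
    split=> //; congr row_mx.
      by apply/rowP => j; rewrite mxE /t cK.
    apply/rowP => j; rewrite !mxE.
    have [tw _] := svalP w.
    rewrite (@tangent_coord R M n (@mcharts R n M) (cdom c, cmap c) _ Bm (t j)
      (fun q => cmap c' q 0 j) _ (@mspace_charted R n M) (mchart Ac) cw oBm Bw (kt j) _ tw).
      by apply: eq_bigr => i _; rewrite row_mxEr mxE.
    by move=> y /= cy _; rewrite /t cK.
Qed.

Lemma sphere_smooth (R : realType) n (M : oriented_manifold R n)
    (g : M -> tvec M -> tvec M -> R) : smooth_space (sphere_bundle g).
Proof. exact: charted_smooth_space (sphere_charted g). Qed.

Lemma schart (R : realType) n (M : oriented_manifold R n)
    (g : M -> tvec M -> tvec M -> R) c :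
  atlas M c -> @scharts R n M g (fun w => cdom c (sval w).1, fun w => tcoord c (sval w)).
Proof. by move=> Ac; exists c. Qed.

Lemma sphere_base_smooth (R : realType) n (M : oriented_manifold R n)
    (g : M -> tvec M -> tvec M -> R) c (u : sphere_bundle g) j :
  atlas M c -> cdom c (sproj u) -> smooth_at u (fun w => cmap c (sproj w) 0 j).
Proof.
move=> Ac cu.
have := @smooth_chart_coord R (sphere_bundle g) _ _ _ u (lshift n j)
  (sphere_charted g) (schart g Ac) cu.
by congr smooth_at; apply/funext => w; rewrite /= /tcoord row_mxEl.
Qed.

Lemma taut_coord_smooth (R : realType) n (M : oriented_manifold R n)
    (g : M -> tvec M -> tvec M -> R) c (u : sphere_bundle g) j :
  atlas M c -> cdom c (sproj u) ->
  smooth_at u (fun w => taut w (fun q => cmap c q 0 j)).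
Proof.
move=> Ac cu.
have := @smooth_chart_coord R (sphere_bundle g) _ _ _ u (rshift n j)
  (sphere_charted g) (schart g Ac) cu.
by congr smooth_at; apply/funext => w; rewrite /= /tcoord row_mxEr mxE.
Qed.

Lemma sproj_smooth (R : realType) n (M : oriented_manifold R n)
    (g : M -> tvec M -> tvec M -> R) (u : sphere_bundle g) :
  smooth_map_at (@sproj R n M g) u.
Proof.
have [_ coverP _] := m_atlas M; have [c Ac cu] := coverP (sproj u).
apply: (@smooth_map_charted _ _ _ (sphere_smooth g) _ _ _ _ _
  (@mspace_charted R n M) (mchart Ac)) => //.
- exists c, setT; split=> //; split=> //; exact: openT.
- by move=> j; exact: sphere_base_smooth.
Qed.

(** * Coordinate derivations and coordinate vector fields *)

Definition pder (R : realType) n (j : 'I_n) (r : rspace R n) : tvec (rspace R n) :=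
  fun h => if `[< smooth_at r h >] then 'D_(delta_mx 0 j) (h : 'rV[R]_n -> R) r else 0.

Lemma pderE (R : realType) n (j : 'I_n) (r : rspace R n) h :
  smooth_at r h -> pder j r h = 'D_(delta_mx 0 j) (h : 'rV[R]_n -> R) r.
Proof. by move=> sh; rewrite /pder; case: asboolP. Qed.

Lemma rspace_derivable (R : realType) n (r : rspace R n) h j :
  smooth_at r h -> derivable (h : 'rV[R]_n -> R) r (delta_mx 0 j).
Proof. by move=> [B [oB Br kh]]; exact: ((kh 1%N).2 j).1. Qed.

Lemma pder_tangent (R : realType) n (j : 'I_n) (r : rspace R n) : tangent r (pder j r).
Proof.
have sR := rspace_smooth R n.
split=> [h nsh|a h k sh sk|h k sh sk].
- by rewrite /pder; case: asboolP.
- have dh := @rspace_derivable _ _ _ _ j sh; have dk := @rspace_derivable _ _ _ _ j sk.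
  rewrite !pderE//; last by apply: (smoothD sR) => //; exact: (smoothZ sR).
  by have := deriveD (derivableZ (k := a) dh) dk; rewrite deriveZ.
- have dh := @rspace_derivable _ _ _ _ j sh; have dk := @rspace_derivable _ _ _ _ j sk.
  rewrite !pderE//; last exact: (smoothM sR).
  have := deriveM dh dk; rewrite addrC => ->.
  by rewrite /GRing.scale /= mulrC.
Qed.

Lemma pder_coord (R : realType) n (i j : 'I_n) (r : rspace R n) :
  pder j r (fun z : 'rV[R]_n => z 0 i) = (i == j)%:R.
Proof.
rewrite pderE; last first.
  by exists setT; split=> //; [exact: openT|move=> k; exact: Ck_coord].
by have [_ ->] := derive_coord (r : 'rV[R]_n) (delta_mx 0 j) i; rewrite mxE eqxx.
Qed.

Lemma smooth_field_lincomb (R : realType) (X Y : diffSpace R) (sX : smooth_space X)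
    (sY : smooth_space Y) (f : X -> Y) x (I : finType) (a : I -> X -> R)
    (V : I -> X -> tvec Y) :
  (forall i, smooth_at x (a i)) -> (forall i, smooth_section_at f x (V i)) ->
  smooth_section_at f x (fun y => \sum_i a i y *: V i y).
Proof.
move=> sa sV; split.
  have : nearby x (fun y => forall i, tangent (f y) (V i y)).
    by apply: (nearby_forall sX) => i; have [] := sV i.
  by apply: (nearbyS sX) => y tV /=; exact: tangent_sum_scale.
move=> h sh.
have -> : (fun y => (\sum_i a i y *: V i y) h) = (fun y => \sum_i a i y * V i y h).
  by apply/funext => y; rewrite fct_sumE.
by apply: (smooth_sum sX) => i; apply: (smoothM sX) => //; exact: (sV i).2.
Qed.

Lemma pushforward_field (R : realType) (X : diffSpace R) (sX : smooth_space X) n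
    (rho : rspace R n -> X) (kappa : X -> rspace R n) x j :
  (forall i, smooth_at x (fun y => (kappa y : 'rV[R]_n) 0 i)) ->
  nearby x (fun y => rho (kappa y) = y /\ smooth_map_at rho (kappa y)) ->
  smooth_field_at x (fun y => differential rho (kappa y) (pder j (kappa y))).
Proof.
move=> sk xr; have sR := rspace_smooth R n; split.
  apply: (nearbyS sX) xr => y [ry srho] /=; rewrite -[X in tangent X]ry.
  by apply: (differential_tangent sX srho); exact: pder_tangent.
move=> h sh; have [rx [_ srho]] := nearby_point sX xr.
have [|B [oB Bx kh]] := srho h; first by rewrite rx.
have := @smooth_comp _ _ sX x n B ('D_(delta_mx 0 j) (fun z => h (rho z))) kappa oB Bx.
move=> /(_ (fun m => ((kh m.+1).2 j).2) sk); apply: (smooth_eq sX).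
apply: (nearbyS sX) (nearbyI sX xr (smooth_near sX sh)) => y [[ry [_ srhoy]] shy].
rewrite differentialE ?ry// pderE//; apply: srhoy; by rewrite ry.
Qed.

Definition coord_field (R : realType) n (M : oriented_manifold R n)
    (c : chart R (mtop M) n) (j : 'I_n) (q : M) : tvec M :=
  differential (cinv c : rspace R n -> M) (cmap c q) (pder j (cmap c q)).

Lemma cinv_smooth (R : realType) n (M : oriented_manifold R n) c (q : M) :
  atlas M c -> cdom c q -> smooth_map_at (cinv c : rspace R n -> M) (cmap c q).
Proof.
move=> Ac cq; have [chP _ _] := m_atlas M; have [oc oi cK cc ci] := chP _ Ac.
have sR := rspace_smooth R n.
have near_im : @Defs.dnbhs R (rspace R n) (cmap c q) (cmap c @` cdom c).
  by apply: open_nbhs_nbhs; split=> //; exists q.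
apply: (@smooth_map_charted _ _ _ sR _ _ _ _ _ (@mspace_charted R n M) (mchart Ac)).
- by rewrite /= cK.
- by apply: (nearbyS sR) near_im => z [y cy <-] /=; rewrite cK.
move=> j; apply: (smooth_eq sR (h := fun z : 'rV[R]_n => z 0 j)).
  by apply: (nearbyS sR) near_im => z [y cy <-] /=; rewrite cK.
by exists setT; split=> //; [exact: openT|move=> k; exact: Ck_coord].
Qed.

Lemma chart_dom_nearby (R : realType) n (M : oriented_manifold R n) c (q : M) :
  atlas M c -> cdom c q -> nearby q (cdom c).
Proof.
move=> Ac cq; have [chP _ _] := m_atlas M; have [oc oi cK cc ci] := chP _ Ac.
exact: open_nbhs_nbhs.
Qed.

Lemma coord_field_smooth (R : realType) n (M : oriented_manifold R n) c j (q : M) :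
  atlas M c -> cdom c q -> smooth_field_at q (coord_field c j).
Proof.
move=> Ac cq; have sM := @mspace_smooth R n M.
have [chP _ _] := m_atlas M; have [oc oi cK cc ci] := chP _ Ac.
apply: (pushforward_field sM) => [i|].
  exact: (@smooth_chart_coord _ _ _ _ _ _ _ (@mspace_charted R n M) (mchart Ac)).
apply: (nearbyS sM) (chart_dom_nearby Ac cq) => y cy.
by split; [exact: cK|exact: cinv_smooth].
Qed.

Lemma coord_fieldE (R : realType) n (M : oriented_manifold R n) c i j (q : M) :
  atlas M c -> cdom c q -> coord_field c j q (fun y => cmap c y 0 i) = (i == j)%:R.
Proof.
move=> Ac cq; have sM := @mspace_smooth R n M; have sR := rspace_smooth R n.
have [chP _ _] := m_atlas M; have [oc oi cK cc ci] := chP _ Ac.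
rewrite /coord_field differentialE; last first.
  rewrite cK//.
  exact: (@smooth_chart_coord _ _ _ _ _ _ _ (@mspace_charted R n M) (mchart Ac)).
rewrite -(pder_coord i j (cmap c q)); apply: (tangent_eq sR); first exact: pder_tangent.
have near_im : @Defs.dnbhs R (rspace R n) (cmap c q) (cmap c @` cdom c).
  by apply: open_nbhs_nbhs; split=> //; exists q.
by apply: (nearbyS sR) near_im => z [y cy <-] /=; rewrite cK.
Qed.

Lemma tangent_coord_field (R : realType) n (M : oriented_manifold R n) c (q : M) v :
  atlas M c -> cdom c q -> tangent q v ->
  v = \sum_j v (fun y => cmap c y 0 j) *: coord_field c j q.
Proof.
move=> Ac cq tv; have sM := @mspace_smooth R n M.
apply: (@tangent_ext _ _ _ _ _ _ _ _ (@mspace_charted R n M) (mchart Ac) cq) => //.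
  apply: tangent_sum_scale => j.
  have [tf _] := coord_field_smooth j Ac cq; exact: (nearby_point sM tf).
move=> i; rewrite fct_sumE (bigD1 i)//= big1 ?addr0 => [|j ji].
  by rewrite !fctE coord_fieldE// eqxx /GRing.scale /= mulr1.
by rewrite !fctE coord_fieldE// eq_sym (negbTE ji) scaler0.
Qed.

(** * Orthonormal frames *)

Section Riemannian.
Context (R : realType) (n : nat) (M : oriented_manifold R n)
  (g : M -> tvec M -> tvec M -> R) (rg : is_riemannian g).
Let sM : smooth_space M := @mspace_smooth R n M.
Implicit Types (p q : M) (v w : tvec M).

Lemma metricC p v w : tangent p v -> tangent p w -> g p v w = g p w v.
Proof. by have [+ _ _ _] := rg; exact. Qed.

Lemma metric_linl p a v v' w : tangent p v -> tangent p v' -> tangent p w ->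
  g p (a *: v + v') w = a * g p v w + g p v' w.
Proof. by have [_ + _ _] := rg; exact. Qed.

Lemma metric0l p w : tangent p w -> g p 0 w = 0.
Proof.
move=> tw; have := metric_linl 1 (tangent0 p) (tangent0 p) tw.
by rewrite scaler0 addr0 mul1r => /eqP; rewrite addrC -subr_eq subrr eq_sym => /eqP.
Qed.

Lemma metricZl p a v w : tangent p v -> tangent p w -> g p (a *: v) w = a * g p v w.
Proof.
move=> tv tw; have := metric_linl a tv (tangent0 p) tw.
by rewrite addr0 metric0l// addr0.
Qed.

Lemma tangentB_vec p v w : tangent p v -> tangent p w -> tangent p (v - w).
Proof. by move=> tv tw; have := tangent_scaleD (-1) tw tv; rewrite scaleN1r addrC. Qed.

Lemma metricBl p v v' w : tangent p v -> tangent p v' -> tangent p w ->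
  g p (v - v') w = g p v w - g p v' w.
Proof.
move=> tv tv' tw; have := metric_linl (-1) tv' tv tw.
by rewrite scaleN1r addrC => ->; rewrite mulN1r addrC.
Qed.

Lemma metric_suml p (I : Type) (r : seq I) (a : I -> R) (v : I -> tvec M) w :
  (forall i, tangent p (v i)) -> tangent p w ->
  g p (\sum_(i <- r) a i *: v i) w = \sum_(i <- r) a i * g p (v i) w.
Proof.
move=> tv tw; elim: r => [|i r IH]; first by rewrite !big_nil metric0l.
by rewrite !big_cons metric_linl// ?IH//; exact: tangent_sum_scale.
Qed.

Lemma metric_sumr p (I : Type) (r : seq I) (a : I -> R) (v : I -> tvec M) w :
  (forall i, tangent p (v i)) -> tangent p w ->
  g p w (\sum_(i <- r) a i *: v i) = \sum_(i <- r) a i * g p w (v i).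
Proof.
move=> tv tw; rewrite metricC//; last exact: tangent_sum_scale.
by rewrite metric_suml//; apply: eq_bigr => i _; rewrite metricC.
Qed.

(** That n orthonormal vectors span is read from matrices: the coefficients [A] of [b] over the
    coordinate fields [d], times the matrix of inner products of [d] with [b], give the identity, so
    [A] is invertible. *)
Lemma orthonormal_expansion p (b : 'I_n -> tvec M) v :
  (forall i, tangent p (b i)) -> (forall i j, g p (b i) (b j) = (i == j)%:R) ->
  tangent p v -> v = \sum_i g p v (b i) *: b i.
Proof.
move=> tb ob tv; have [_ coverP _] := m_atlas M; have [c Ac cp] := coverP p.
pose d j := coord_field c j p.
have td j : tangent p (d j).
  have [tf _] := coord_field_smooth j Ac cp; exact: (nearby_point sM tf).
pose A : 'M[R]_n := \matrix_(i, j) b i (fun y => cmap c y 0 j).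
have bE i : b i = \sum_j A i j *: d j.
  rewrite {1}(tangent_coord_field Ac cp (tb i)).
  by apply: eq_bigr => j _; rewrite mxE.
have uA : A \in unitmx.
  have /mulmx1_unit[] // : A *m (\matrix_(j, i) g p (d j) (b i)) = 1%:M.
  apply/matrixP => i k; rewrite !mxE -ob bE metric_suml//.
  by apply: eq_bigr => j _; congr (_ * _); rewrite mxE.
have dE j : d j = \sum_i invmx A j i *: b i.
  transitivity (\sum_k (invmx A *m A) j k *: d k).
    rewrite mulVmx// (bigD1 j)//= mxE eqxx scale1r big1 ?addr0// => k kj.
    by rewrite mxE eq_sym (negbTE kj) scale0r.
  under eq_bigr do rewrite mxE scaler_suml.
  rewrite exchange_big /=; apply: eq_bigr => i _; rewrite bE scaler_sumr.
  by apply: eq_bigr => k _; rewrite scalerA.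
have [a vE] : exists a : 'I_n -> R, v = \sum_i a i *: b i.
  exists (fun i => \sum_j v (fun y => cmap c y 0 j) * invmx A j i).
  rewrite {1}(tangent_coord_field Ac cp tv).
  under eq_bigr do rewrite -/(d _) dE scaler_sumr.
  rewrite exchange_big /=; apply: eq_bigr => i _; rewrite scaler_suml.
  by apply: eq_bigr => j _; rewrite scalerA.
rewrite {1}vE; apply: eq_bigr => i _; congr (_ *: _).
rewrite vE metric_suml// (bigD1 i)//= ob eqxx mulr1 big1 ?addr0// => k ki.
by rewrite ob (negbTE ki) mulr0.
Qed.

Lemma metric_smooth p (V W : M -> tvec M) :
  smooth_field_at p V -> smooth_field_at p W -> smooth_at p (fun q => g q (V q) (W q)).
Proof. by have [_ _ _ +] := rg; exact. Qed.

Definition local_frame (b : 'I_n -> M -> tvec M) p : Prop :=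
  nearby p (fun q => (forall i, smooth_field_at q (b i)) /\
    forall i j, g q (b i q) (b j q) = (i == j)%:R).

Lemma field_tangent p (V : M -> tvec M) : smooth_field_at p V -> tangent p (V p).
Proof. by move=> [tV _]; exact: (nearby_point sM tV). Qed.

(** Constant coefficients over the coordinate fields of a chart give a field smooth near p and not
    only at p. *)
Lemma constant_extension p v : tangent p v ->
  exists V : M -> tvec M, nearby p (fun q => smooth_field_at q V) /\ V p = v.
Proof.
move=> tv; have [_ coverP _] := m_atlas M; have [c Ac cp] := coverP p.
exists (fun q => \sum_j v (fun y => cmap c y 0 j) *: coord_field c j q).
split; last by rewrite -tangent_coord_field.
apply: (nearbyS sM) (chart_dom_nearby Ac cp) => q cq.
apply: (smooth_field_lincomb sM sM) => i; first exact: (smooth_cst sM).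
exact: coord_field_smooth.
Qed.

(** The induction makes the first k fields orthonormal near p while every field keeps its prescribed
    value at p. *)
Lemma gram_schmidt p (e : 'I_n -> tvec M) :
  (forall i, tangent p (e i)) -> (forall i j, g p (e i) (e j) = (i == j)%:R) ->
  exists b, local_frame b p /\ forall i, b i p = e i.
Proof.
move=> te oe.
suff : forall k, (k <= n)%N -> exists b : 'I_n -> M -> tvec M,
    nearby p (fun q => (forall i, smooth_field_at q (b i)) /\
      forall i j : 'I_n, (i < k)%N -> (j < k)%N -> g q (b i q) (b j q) = (i == j)%:R)
    /\ forall i, b i p = e i.
  move=> /(_ n (leqnn n))[b [fb be]]; exists b; split=> //.
  by apply: (nearbyS sM) fb => q [sb ob]; split=> // i j; exact: ob.
elim=> [|k IH] kn.
  have /choice[V VP] := fun i => constant_extension (te i).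
  exists V; split; last by move=> i; exact: (VP i).2.
  apply: (nearbyS sM (W := fun q => forall i, smooth_field_at q (V i))).
    by move=> q sV; split.
  by apply: (nearby_forall sM) => i; exact: (VP i).1.
have [b [fb be]] := IH (ltnW kn).
pose K : 'I_n := Ordinal kn.
(* A single combination of the whole family: minus the projection for each j < k, and for the other
   j the delta at [K], so that [w'] is [b K] minus its projections. *)
pose w' q : tvec M := \sum_(j < n) (if (j < k)%N then - g q (b K q) (b j q) else (j == K)%:R) *: b j q.
pose N q := g q (w' q) (w' q).
pose b' i q : tvec M := if i == K then N q `^ (- 2^-1) *: w' q else b i q.
have w'p : w' p = e K.
  rewrite /w' (bigD1 K)//= ltnn eqxx scale1r be big1 ?addr0// => j jK.
  rewrite !be oe eq_sym (negbTE jK) /= oppr0.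
  by case: ifP => _; rewrite scale0r.
(* At p the vectors are already orthonormal, so the process changes nothing there; the squared norm
   [N] is 1 at p, hence positive nearby. *)
have Np : N p = 1 by rewrite /N w'p oe eqxx.
have sw' q : (forall i, smooth_field_at q (b i)) -> smooth_field_at q w'.
  move=> sb; apply: (smooth_field_lincomb sM sM) => // j.
  case: (j < k)%N; last exact: (smooth_cst sM).
  have := smoothZ sM (-1) (metric_smooth (sb K) (sb j)).
  by congr smooth_at; apply/funext => z; rewrite mulN1r.
have sN q : (forall i, smooth_field_at q (b i)) -> smooth_at q N.
  by move=> sb; apply: metric_smooth; exact: sw'.
have [sbp _] := nearby_point sM fb.
have N0 : nearby p (fun q => 0 < N q).
  by apply: (smooth_cont sM (B := [set t | 0 < t]) (sN p sbp)); [exact: open_gt|rewrite /= Np].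
exists b'; split; last first.
  move=> i; rewrite /b'; case: eqP => [->|_]; last exact: be.
  by rewrite Np powR1 scale1r w'p.
apply: (nearbyS sM) (nearbyI sM fb N0) => q [[sb ob] Nq].
have tb i : tangent q (b i q) by exact: field_tangent.
have tw' : tangent q (w' q) by exact/field_tangent/sw'.
have ow' (i : 'I_n) : (i < k)%N -> g q (w' q) (b i q) = 0.
  move=> ik; rewrite metric_suml// (bigD1 i)//= ik (ob i i)// eqxx mulr1.
  have iK : K != i by rewrite -val_eqE /= gtn_eqF.
  rewrite (bigD1 K)//= ltnn eqxx mul1r big1 ?addr0 ?addNr// => j /andP[ji jK].
  case: ifP => jk; last by rewrite (negbTE jK) mul0r.
  by rewrite (ob j i)// (negbTE ji) mulr0.
split=> [i|i j].
  rewrite /b'; case: (i == K) => //; split; last first.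
    move=> h sh; have := smoothM sM (smooth_powR sM (- 2^-1) (sN q sb) Nq) ((sw' q sb).2 h sh).
    by congr smooth_at.
  by apply: (nearbyS sM) (sw' q sb).1 => z tz /=; exact: tangent_scale.
have ltK (m : 'I_n) : (m < k.+1)%N -> m != K -> (m < k)%N.
  by rewrite ltnS leq_eqVlt -val_eqE /= => /orP[/eqP ->|//]; rewrite eqxx.
rewrite /b'; case: (eqVneq i K) => [-> _|iK /ltK/(_ iK) ik].
  case: (eqVneq j K) => [-> _|jK /ltK/(_ jK) jk].
    have ts := tangent_scale (N q `^ (- 2^-1)) tw'.
    rewrite metricZl ?(metricC tw')//.
    rewrite metricZl// -/(N q) mulrA -powRD; last by rewrite (gt_eqF Nq) implybT.
    have -> : - 2^-1 + - 2^-1 = -1 :> R by lra.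
    by rewrite powR_inv1 ?(ltW Nq)// mulVf ?gt_eqF.
  by rewrite ?eqxx /= metricZl// ow'// mulr0.
case: (eqVneq j K) => [-> _|jK /ltK/(_ jK) jk]; last exact: ob.
rewrite metricC//; last exact: tangent_scale.
by rewrite metricZl// ow'// mulr0 (negbTE iK).
Qed.

End Riemannian.

(** * Connections along a map *)

Section Sections.
Context (R : realType) (X Y : diffSpace R) (sX : smooth_space X) (sY : smooth_space Y)
  (f : X -> Y) (fsm : forall x, smooth_map_at f x).

Lemma tangent_eq_smooth (y : Y) (v w : tvec Y) : tangent y v -> tangent y w ->
  (forall h, smooth_at y h -> v h = w h) -> v = w.
Proof.
move=> [v0 _ _] [w0 _ _] vw; apply/funext => h.
by case: (pselect (smooth_at y h)) => [/vw //|nsh]; rewrite v0 ?w0.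
Qed.

Lemma smooth_section_eq x (s t : X -> tvec Y) :
  nearby x (fun y => s y = t y) -> smooth_section_at f x s -> smooth_section_at f x t.
Proof.
move=> st [ts ss]; split.
  by apply: (nearbyS sX) (nearbyI sX st ts) => y [/= ->].
move=> h sh; apply: (smooth_eq sX) (ss h sh).
by apply: (nearbyS sX) st => y ->.
Qed.

Lemma smooth_section_pull x V :
  smooth_field_at (f x) V -> smooth_section_at f x (fun y => V (f y)).
Proof.
by move=> [tV sV]; split=> [|h /sV sh]; [exact: ((fsm x).1 _ tV)|exact: ((fsm x).2 _ sh)].
Qed.

Lemma smooth_section_push x V : smooth_field_at x V ->
  smooth_section_at f x (fun y => differential f y (V y)).
Proof.
move=> [tV sV]; split.
  by apply: (nearbyS sX) tV => y ty; exact: (differential_tangent sY (fsm y)).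
move=> h sh; apply: (smooth_eq sX) (sV _ ((fsm x).2 _ sh)).
have nh := (fsm x).1 _ (smooth_near sY sh).
apply: (nearbyS sX) nh => y shy.
by rewrite differentialE.
Qed.

Lemma section_tangent x (s : X -> tvec Y) : smooth_section_at f x s -> tangent (f x) (s x).
Proof. by move=> [ts _]; exact: (nearby_point sX ts). Qed.

Section Connection.
Context (fD : connection X Y) (fDP : is_connection_along f fD).

Lemma conn_tangent x v s : tangent x v -> smooth_section_at f x s ->
  tangent (f x) (fD x v s).
Proof. by have [+ _ _ _ _] := fDP; exact. Qed.

(** Locality by the device used for derivations: the indicator of the set where s and t agree has
    derivative 0 and value 1 at x, and its products with s and with t are equal. *)
Lemma conn_eq x v s t : tangent x v -> smooth_section_at f x s ->
  nearby x (fun y => s y = t y) -> fD x v s = fD x v t.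
Proof.
move=> tv ss st; have ts := smooth_section_eq st ss.
have [_ _ _ L _] := fDP; have sW := smooth_indic sX st.
have W1 : \1_(fun y => s y = t y) x = 1 :> R.
  by rewrite indicE mem_set//; exact: (nearby_point sX st).
have E r : smooth_section_at f x r ->
    fD x v (fun y => \1_(fun y => s y = t y) y *: r y) = fD x v r.
  by move=> sr; rewrite L// (tangent_indic sX tv st) scale0r add0r W1 scale1r.
rewrite -(E s ss) -(E t ts); congr (fD x v _); apply/funext => y.
rewrite indicE; case: (boolP (y \in _)) => [|_]; last by rewrite !scale0r.
by rewrite inE => ->.
Qed.

Lemma conn_sum x v n (a : 'I_n -> X -> R) (s : 'I_n -> X -> tvec Y) :
  tangent x v -> (forall i, smooth_at x (a i)) ->
  (forall i, smooth_section_at f x (s i)) ->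
  fD x v (fun y => \sum_i a i y *: s i y) =
  \sum_i (v (a i) *: s i x + a i x *: fD x v (s i)).
Proof.
move=> tv sa ss; have [_ _ A L _] := fDP.
elim: n a s sa ss => [|n IH] a s sa ss.
  rewrite big_ord0.
  have s0 : smooth_section_at f x (fun=> 0 : tvec Y).
    by split=> [|h sh]; [apply: (nearbyT sX) => y; exact: tangent0|exact: (smooth_cst sX)].
  have -> : (fun y => \sum_(i < 0) a i y *: s i y) = (fun y => 0 : tvec Y).
    by apply/funext => y; rewrite big_ord0.
  have := A x v _ _ tv s0 s0; rewrite (_ : (fun y => 0 + 0) = (fun=> 0 : tvec Y)).
    by move/eqP; rewrite addrC -subr_eq subrr eq_sym => /eqP.
  by apply/funext => y; rewrite addr0.
rewrite big_ord_recl -IH//.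
rewrite -L// -A//.
- by congr (fD x v _); apply/funext => y; rewrite big_ord_recl.
- split.
    by apply: (nearbyS sX) (ss ord0).1 => y ty /=; exact: tangent_scale.
  move=> h sh; have := smoothM sX (sa ord0) ((ss ord0).2 _ sh).
  by congr smooth_at.
- by apply: (smooth_field_lincomb sX sY).
Qed.

Lemma conn_vec_sum x (I : Type) (r : seq I) (a : I -> R) (v : I -> tvec X) s :
  (forall i, tangent x (v i)) -> smooth_section_at f x s ->
  fD x (\sum_(i <- r) a i *: v i) s = \sum_(i <- r) a i *: fD x (v i) s.
Proof.
move=> tv ss; have [_ A _ _ _] := fDP; elim: r => [|i r IH].
  rewrite !big_nil; have := A x 1 0 0 s (tangent0 x) (tangent0 x) ss.
  by rewrite scaler0 addr0 scale1r => /eqP; rewrite addrC -subr_eq subrr eq_sym => /eqP.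
by rewrite !big_cons A// ?IH//; exact: tangent_sum_scale.
Qed.

End Connection.
End Sections.

Section AlongMap.
Context (R : realType) (n : nat) (M : oriented_manifold R n)
  (g : M -> tvec M -> tvec M -> R) (rg : is_riemannian g)
  (D : connection M M) (DP : is_linear_connection D)
  (X : diffSpace R) (sX : smooth_space X) (f : X -> M)
  (fsm : forall x, smooth_map_at f x)
  (fD : connection X M) (fDP : is_pullback_connection f D fD).
Let sM : smooth_space M := @mspace_smooth R n M.
Let fDC : is_connection_along f fD := fDP.1.
Variable b : 'I_n -> M -> tvec M.

Definition coef (s : X -> tvec M) i (y : X) : R := g (f y) (s y) (b i (f y)).

Lemma coef_smooth x s i : smooth_section_at f x s -> smooth_field_at (f x) (b i) ->
  smooth_at x (coef s i).
Proof.
move=> ss sb; have [_ coverP _] := m_atlas M; have [c Ac cx] := coverP (f x).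
have cn := (fsm x).1 _ (chart_dom_nearby Ac cx).
have bn := (fsm x).1 _ sb.1.
apply: (smooth_eq sX (h := fun y => \sum_j s y (fun q => cmap c q 0 j) *
    g (f y) (coord_field c j (f y)) (b i (f y)))).
  apply: (nearbyS sX) (nearbyI sX (nearbyI sX cn bn) ss.1) => y [[cy tb] ts].
  rewrite /coef {2}(tangent_coord_field Ac cy ts) (metric_suml rg)// => j.
  exact: (field_tangent (coord_field_smooth j Ac cy)).
apply: (smooth_sum sX) => j; apply: (smoothM sX).
  by apply: ss.2; exact: (@smooth_chart_coord _ _ _ _ _ _ _ (@mspace_charted R n M) (mchart Ac)).
apply: ((fsm x).2 (fun q => g q (coord_field c j q) (b i q))).
by apply: (metric_smooth rg) => //; exact: coord_field_smooth.
Qed.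

Lemma frame_nearby x : local_frame g b (f x) -> nearby x (fun y => local_frame g b (f y)).
Proof. by move=> /(nearby_nearby sM) fb; exact: ((fsm x).1 _ fb). Qed.

Lemma frame_fields q : local_frame g b q -> forall i, smooth_field_at q (b i).
Proof. by move=> /(nearby_point sM)[]. Qed.

Lemma frame_ortho q : local_frame g b q -> forall i j, g q (b i q) (b j q) = (i == j)%:R.
Proof. by move=> /(nearby_point sM)[]. Qed.

Lemma frame_expansion q v : local_frame g b q -> tangent q v ->
  v = \sum_i g q v (b i q) *: b i q.
Proof.
move=> fb tv; apply: (orthonormal_expansion rg) => //; last exact: frame_ortho.
by move=> i; apply/field_tangent/frame_fields.
Qed.

Lemma section_expansion x s : local_frame g b (f x) -> smooth_section_at f x s ->
  nearby x (fun y => s y = \sum_i coef s i y *: b i (f y)).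
Proof.
move=> fb [ts _]; apply: (nearbyS sX) (nearbyI sX (frame_nearby fb) ts) => y [fby ty].
exact: frame_expansion.
Qed.

Lemma coefs_nearby x s : local_frame g b (f x) -> smooth_section_at f x s ->
  nearby x (fun y => forall i, smooth_at y (coef s i)).
Proof.
move=> fb ss; apply: (nearby_forall sX) => i; apply: (smooth_near sX).
by apply: coef_smooth => //; exact: frame_fields.
Qed.

Lemma smooth_section_near x s : local_frame g b (f x) -> smooth_section_at f x s ->
  nearby x (fun y => smooth_section_at f y s).
Proof.
move=> fb ss; have E := nearby_nearby sX (section_expansion fb ss).
apply: (nearbyS sX) (nearbyI sX (nearbyI sX E (coefs_nearby fb ss)) (frame_nearby fb)).
move=> y [[Ey sc] fby].
apply: (smooth_section_eq sX (s := fun y => \sum_i coef s i y *: b i (f y))).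
  by apply: (nearbyS sX) Ey => z ->.
apply: (smooth_field_lincomb sX sM) => // i.
by apply: (smooth_section_pull fsm); exact: frame_fields.
Qed.

(** The fields whose components are the connection coefficients of the frame. *)
Definition frame_conn l i : M -> tvec M := fun q => D q (b l q) (b i).

Lemma frame_conn_smooth q l i : local_frame g b q -> smooth_field_at q (frame_conn l i).
Proof.
move=> fb; have [_ _ _ _ A] := DP; apply: A; exact: frame_fields.
Qed.

Lemma conn_frame x v i : local_frame g b (f x) -> tangent x v ->
  fD x v (fun y => b i (f y)) =
  \sum_l g (f x) (differential f x v) (b l (f x)) *: frame_conn l i (f x).
Proof.
move=> fb tv; have [_ P] := fDP; rewrite P//; last exact: frame_fields.
have tdv := differential_tangent sM (fsm x) tv.
rewrite {1}(frame_expansion fb tdv) (conn_vec_sum DP)//.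
  by move=> l; apply/field_tangent/frame_fields.
exact: frame_fields.
Qed.

Lemma conn_section x v s : local_frame g b (f x) -> tangent x v ->
  smooth_section_at f x s ->
  fD x v s = \sum_i (v (coef s i) *: b i (f x) +
     \sum_l (coef s i x * g (f x) (differential f x v) (b l (f x))) *: frame_conn l i (f x)).
Proof.
move=> fb tv ss; rewrite (conn_eq sX fDC tv ss (section_expansion fb ss)).
have sb i : smooth_section_at f x (fun y => b i (f y)).
  by apply: (smooth_section_pull fsm); exact: frame_fields.
rewrite (conn_sum sX sM fDC)//; last first.
  by move=> i; apply: coef_smooth => //; exact: frame_fields.
apply: eq_bigr => i _; congr (_ + _); rewrite conn_frame// scaler_sumr.
by apply: eq_bigr => l _; rewrite scalerA.
Qed.

Let push (V : X -> tvec X) (y : X) : tvec M := differential f y (V y).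

Lemma push_section x V : smooth_field_at x V -> smooth_section_at f x (push V).
Proof. exact: (smooth_section_push sX sM fsm). Qed.

(** Over a frame of M, the second derivative consists of derivatives of functions on X and of
    derivatives at [f x] of fields of M; only the latter can contribute to curvature. *)
Lemma conn_conn x V W s : local_frame g b (f x) ->
  smooth_field_at x V -> smooth_field_at x W -> smooth_section_at f x s ->
  fD x (V x) (fun y => fD y (W y) s) =
  \sum_i (V x (fun y => W y (coef s i)) *: b i (f x) +
    (\sum_l (W x (coef s i) * coef (push V) l x + V x (coef s i) * coef (push W) l x
       + coef s i x * V x (coef (push W) l)) *: frame_conn l i (f x) +
     \sum_l \sum_m (coef s i x * coef (push W) l x * coef (push V) m x) *:
        D (f x) (b m (f x)) (frame_conn l i))).
Proof.
move=> fb sV sW ss; have tV := section_tangent sX sV.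
pose cW := coef (push W).
have sc i : smooth_at x (coef s i) by apply: coef_smooth => //; exact: frame_fields.
have scW l : smooth_at x (cW l).
  by apply: coef_smooth; [exact: push_section|exact: frame_fields].
have sb i : smooth_section_at f x (fun y => b i (f y)).
  by apply: (smooth_section_pull fsm); exact: frame_fields.
have sbb l i : smooth_section_at f x (fun y => frame_conn l i (f y)).
  by apply: (smooth_section_pull fsm); exact: frame_conn_smooth.
have sWc i : smooth_at x (fun y => W y (coef s i)) by exact: sW.2.
have [_ _ _ _ sfDW] := fDC.
have E : nearby x (fun y => fD y (W y) s = \sum_i (1 *: (W y (coef s i) *: b i (f y) +
    \sum_l (coef s i y * cW l y) *: frame_conn l i (f y)))).
  apply: (nearbyS sX) (nearbyI sX (nearbyI sX (frame_nearby fb) sW.1)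
    (smooth_section_near fb ss)) => y [[fby tWy] ssy].
  by rewrite (conn_section fby tWy ssy); under [RHS]eq_bigr do rewrite scale1r.
have s2 i : smooth_section_at f x
    (fun y => \sum_l (coef s i y * cW l y) *: frame_conn l i (f y)).
  by apply: (smooth_field_lincomb sX sM) => // l; exact: (smoothM sX).
have s1 i : smooth_section_at f x (fun y => W y (coef s i) *: b i (f y)).
  have := @smooth_field_lincomb _ _ _ sX sM f x 'I_1 (fun=> fun y => W y (coef s i))
    (fun=> fun y => b i (f y)) (fun=> sWc i) (fun=> sb i).
  by congr smooth_section_at; apply/funext => y; rewrite big_ord1.
have s3 i : smooth_section_at f x (fun y => W y (coef s i) *: b i (f y) +
    \sum_l (coef s i y * cW l y) *: frame_conn l i (f y)).
  split; last first.
    by move=> h sh; apply: (smoothD sX); [exact: (s1 i).2|exact: (s2 i).2].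
  apply: (nearbyS sX) (nearbyI sX (s1 i).1 (s2 i).1) => y [t1 t2] /=.
  by have := tangent_scaleD 1 t1 t2; rewrite scale1r.
rewrite (conn_eq sX fDC tV _ E)//; last exact: sfDW.
have [_ _ addD leibD _] := fDC.
rewrite (conn_sum sX sM fDC tV (a := fun=> fun=> 1))//; last by move=> i; exact: (smooth_cst sX).
apply: eq_bigr => i _; rewrite (tangent_cst sX _ tV) scale0r add0r scale1r.
rewrite addD// leibD// -addrA; congr (_ + _).
rewrite (conn_sum sX sM fDC)//; last by move=> l; exact: (smoothM sX).
rewrite conn_frame// scaler_sumr.
under [X in _ + X]eq_bigr => l _.
  rewrite (tangentM tV)// -/(cW l).
  have -> : fD x (V x) (fun y => frame_conn l i (f y)) =
     \sum_m coef (push V) m x *: D (f x) (b m (f x)) (frame_conn l i).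
    have [_ P] := fDP; rewrite P//; last exact: frame_conn_smooth.
    have tdv := differential_tangent sM (fsm x) tV.
    rewrite {1}(frame_expansion fb tdv) (conn_vec_sum DP)//.
      by move=> m; apply/field_tangent/frame_fields.
    exact: frame_conn_smooth.
  over.
rewrite big_split /= addrA -big_split /=; congr (_ + _); last first.
  apply: eq_bigr => l _; rewrite scaler_sumr; apply: eq_bigr => m _.
  by rewrite scalerA.
apply: eq_bigr => l _; rewrite scalerA -scalerDl; congr (_ *: _).
exact: addrA.
Qed.

(** V and W need not be related by f to fields of M, so their images are expanded over the frame,
    and derivatives of the coefficients appear beside the brackets of frame fields. *)
Lemma push_bracket x V W : local_frame g b (f x) ->
  smooth_field_at x V -> smooth_field_at x W ->
  differential f x (bracket V W x) =
  \sum_l (V x (coef (push W) l) - W x (coef (push V) l)) *: b l (f x) +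
  \sum_l \sum_m (coef (push W) l x * coef (push V) m x) *: bracket (b m) (b l) (f x).
Proof.
move=> fb sV sW; have sb := frame_fields fb.
have tb i := field_tangent (sb i).
have tbr : tangent x (bracket V W x) by exact: bracket_tangent.
have tV := section_tangent sX sV; have tW := section_tangent sX sW.
have scp V' l : smooth_field_at x V' -> smooth_at x (coef (push V') l).
  by move=> sV'; apply: coef_smooth => //; exact: push_section.
apply: (tangent_eq_smooth (differential_tangent sM (fsm x) tbr)).
  have := tangent_scaleD 1
    (tangent_sum_scale (index_enum 'I_n) (fun l => V x (coef (push W) l) - W x (coef (push V) l)) tb)
    (tangent_sum_scale (index_enum 'I_n) (fun l => 1) (fun l =>
      tangent_sum_scale (index_enum 'I_n) (fun m => coef (push W) l x * coef (push V) m x)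
        (fun m => bracket_tangent sM (sb m) (sb l)))).
  by rewrite scale1r; under [X in _ + X]eq_bigr do rewrite scale1r.
move=> h sh.
have key V' W' : smooth_field_at x V' -> smooth_field_at x W' -> tangent x (V' x) ->
    V' x (fun y => W' y (fun y => h (f y))) =
    \sum_l (V' x (coef (push W') l) * b l (f x) h +
       coef (push W') l x * \sum_m coef (push V') m x * b m (f x) (fun q => b l q h)).
  move=> sV' sW' tV'.
  have sbh l : smooth_at x (fun y => b l (f y) h).
    by apply: ((fsm x).2 (fun q => b l q h)); exact: (sb l).2.
  rewrite (@tangent_eq _ _ sX _ _ _ (fun y => \sum_l coef (push W') l y * b l (f y) h) tV').
    rewrite (tangent_sum sX _ tV')//; last by move=> l; apply: (smoothM sX) => //; exact: scp.
    apply: eq_bigr => l _; rewrite (tangentM tV')//; last exact: scp.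
    congr (_ + _ * _).
    rewrite -(@differentialE _ _ _ f x (V' x) (fun q => b l q h)); last exact: (sb l).2.
    have tdv := differential_tangent sM (fsm x) tV'.
    by rewrite {1}(frame_expansion fb tdv) fct_sumE.
  have shn := (fsm x).1 _ (smooth_near sM sh).
  apply: (nearbyS sX) (nearbyI sX (nearbyI sX (frame_nearby fb) sW'.1) shn) => y [[fby tWy] shy].
  rewrite -(@differentialE _ _ _ f y (W' y) h)//.
  have tdw := differential_tangent sM (fsm y) tWy.
  by rewrite {1}(frame_expansion fby tdw) fct_sumE.
rewrite differentialE// bracketE; last exact: (fsm x).2.
rewrite (key _ _ sV sW tV) (key _ _ sW sV tW) !fctE !fct_sumE !big_split /=.
rewrite opprD addrACA; congr (_ + _).
  by rewrite -sumrB; apply: eq_bigr => l _; rewrite -mulrBl.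
under [X in _ - X]eq_bigr do rewrite mulr_sumr.
rewrite [X in _ - X]exchange_big /= -sumrB; apply: eq_bigr => l _.
rewrite mulr_sumr -sumrB fct_sumE; apply: eq_bigr => m _.
rewrite !fctE bracketE// /GRing.scale /=; ring.
Qed.

(** The curvature of f^*D is the pullback of that of D, written out over the frame. Derivatives of
    components cancel between the two second derivatives and the derivative along the bracket. *)
Lemma conn_curvature x V W s : local_frame g b (f x) ->
  smooth_field_at x V -> smooth_field_at x W -> smooth_section_at f x s ->
  fD x (V x) (fun y => fD y (W y) s) - fD x (W x) (fun y => fD y (V y) s)
    - fD x (bracket V W x) s =
  \sum_i \sum_l \sum_m (coef s i x * coef (push W) l x * coef (push V) m x) *:
    curvature D (b m) (b l) (b i) (f x).
Proof.
move=> fb sV sW ss; have sb := frame_fields fb.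
have tbr : tangent x (bracket V W x) by exact: bracket_tangent.
rewrite (conn_conn fb sV sW ss) (conn_conn fb sW sV ss).
have [_ PD] := fDP.
have brE i : coef s i x *: D (f x) (differential f x (bracket V W x)) (b i) =
   \sum_l (coef s i x * (V x (coef (push W) l) - W x (coef (push V) l))) *: frame_conn l i (f x) +
   \sum_l \sum_m (coef s i x * coef (push W) l x * coef (push V) m x) *:
     D (f x) (bracket (b m) (b l) (f x)) (b i).
  have tb j := field_tangent (sb j).
  have tB m l := bracket_tangent sM (sb m) (sb l).
  have tS l : tangent (f x) (\sum_m (coef (push W) l x * coef (push V) m x) *:
      bracket (b m) (b l) (f x)).
    by apply: tangent_sum_scale => m; exact: tB.
  have E1 : \sum_l \sum_m (coef (push W) l x * coef (push V) m x) *: bracket (b m) (b l) (f x) =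
      \sum_l 1 *: \sum_m (coef (push W) l x * coef (push V) m x) *: bracket (b m) (b l) (f x).
    by apply: eq_bigr => l _; rewrite scale1r.
  have [_ A _ _ _] := DP.
  rewrite (push_bracket fb sV sW) -[X in D _ (X + _)]scale1r E1.
  rewrite (A _ _ _ _ _ (tangent_sum_scale _ _ tb) (tangent_sum_scale _ _ tS) (sb i)).
  rewrite scale1r (conn_vec_sum DP)//; last exact: sb.
  rewrite (conn_vec_sum DP)//; last exact: sb.
  rewrite scalerDr !scaler_sumr; congr (_ + _); apply: eq_bigr => l _.
    by rewrite scalerA.
  rewrite scale1r (conn_vec_sum DP)//; last exact: sb.
  rewrite scaler_sumr.
  by apply: eq_bigr => m _; rewrite scalerA mulrA.
rewrite (conn_eq sX fDC tbr ss (section_expansion fb ss)) (conn_sum sX sM fDC tbr); last 2 first.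
- by move=> i; apply: coef_smooth.
- by move=> i; apply: (smooth_section_pull fsm); exact: sb.
rewrite -!sumrB; apply: eq_bigr => i _.
rewrite PD// brE bracketE; last by apply: coef_smooth.
rewrite scalerBl.
set P := _ *: b i _; set Q := _ *: b i _.
rewrite [X in _ - (Q + (_ + X))]exchange_big /=.
rewrite opprD addrACA opprD addrACA opprD addrACA.
(* [P' - Q'] is the derivative of a component of s along the bracket, and the [A] terms are of first
   order in the frame fields; both cancel. The [B] terms make up the curvature of the frame
   fields. *)
have abs (P' Q' A1 A2 A3 B1 B2 B3 : tvec M) : A1 = A2 + A3 ->
    P' - Q' + (A1 + B1 + (- A2 - B2)) + (- (P' - Q') - (A3 + B3)) = B1 - B2 - B3.
  by move=> ->; apply/funext => h; rewrite !fctE; ring.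
rewrite abs.
  rewrite -!sumrB; apply: eq_bigr => l _; rewrite -!sumrB; apply: eq_bigr => m _.
  rewrite (_ : _ * _ * coef (push W) l x = coef s i x * coef (push W) l x * coef (push V) m x).
    by rewrite -!scalerBr.
  by ring.
rewrite -big_split /=; apply: eq_bigr => l _; rewrite -scalerDl; congr (_ *: _).
by rewrite /=; ring.
Qed.

End AlongMap.

(** * Curvature *)

Section Curvature.
Context (R : realType) (n : nat) (M : oriented_manifold R n)
  (g : M -> tvec M -> tvec M -> R) (rg : is_riemannian g)
  (D : connection M M) (DP : is_linear_connection D) (Dg : is_metric_connection g D).
Let sM : smooth_space M := @mspace_smooth R n M.
Variable b : 'I_n -> M -> tvec M.

Lemma smooth_map_id (X : diffSpace R) (x : X) : smooth_map_at (fun y : X => y) x.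
Proof. by split. Qed.

Lemma differential_id (X : diffSpace R) (x : X) (v : tvec X) :
  tangent x v -> differential (fun y : X => y) x v = v.
Proof.
move=> [v0 _ _]; apply/funext => h; rewrite /differential.
by case: asboolP => // /v0 ->.
Qed.

Lemma pullback_id : is_pullback_connection (fun p : M => p) D D.
Proof. by split=> // x v W tv sW; rewrite differential_id. Qed.

Lemma extendP (p : M) (x : tvec M) : tangent p x ->
  smooth_field_at p (extend p x) /\ extend p x p = x.
Proof.
move=> tx; have [V [Vn Vp]] := constant_extension tx.
have /(xgetPex (fun=> 0)) : exists V, [set V : M -> tvec M | smooth_field_at p V /\ V p = x] V.
  by exists V; split=> //; exact: (nearby_point sM Vn).
exact.
Qed.

Lemma curvature_at_tangent (p : M) (x y z : tvec M) :
  tangent p x -> tangent p y -> tangent p z -> tangent p (curvature_at D p x y z).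
Proof.
move=> tx ty tz; have [sx ex] := extendP tx; have [sy ey] := extendP ty.
have [sz ez] := extendP tz; have [_ _ _ _ A] := DP.
rewrite /curvature_at /curvature; apply: tangentB_vec; [apply: tangentB_vec|].
- by apply: (conn_tangent DP); [exact: (field_tangent sx)|exact: A].
- by apply: (conn_tangent DP); [exact: (field_tangent sy)|exact: A].
- by apply: (conn_tangent DP) => //; exact: bracket_tangent.
Qed.

(** Tensoriality, as the case f = id of the pullback formula: the coefficients involve only the
    values at p of the chosen extensions. *)
Lemma curvature_at_frame (p : M) (x y z : tvec M) : local_frame g b p ->
  tangent p x -> tangent p y -> tangent p z ->
  curvature_at D p x y z = \sum_i \sum_l \sum_m
    (g p z (b i p) * g p y (b l p) * g p x (b m p)) *: curvature D (b m) (b l) (b i) p.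
Proof.
move=> fb tx ty tz; have [sx ex] := extendP tx; have [sy ey] := extendP ty.
have [sz ez] := extendP tz.
have := conn_curvature rg DP sM (@smooth_map_id M) pullback_id fb sx sy sz.
rewrite /curvature_at /curvature => ->; apply: eq_bigr => i _.
apply: eq_bigr => l _; apply: eq_bigr => m _.
by rewrite /coef ez ey ex !differential_id.
Qed.

Lemma conn_const_inner (p : M) (x : tvec M) i k : local_frame g b p -> tangent p x ->
  g p (D p x (b i)) (b k p) = - g p (D p x (b k)) (b i p).
Proof.
move=> fb tx; have sb := frame_fields fb.
have tb j := field_tangent (sb j).
have := Dg tx (sb i) (sb k).
rewrite (metricC rg (tb i)); last exact: (conn_tangent DP tx (sb k)).
rewrite (@tangent_eq _ _ sM p x _ (fun=> (i == k)%:R) tx).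
  by rewrite (tangent_cst sM _ tx) => /esym/eqP; rewrite addr_eq0 => /eqP.
by apply: (nearbyS sM) fb => q [_].
Qed.

(** [conn_const_inner] holds near p, so it may be differentiated once more. The resulting products
    of first derivatives are symmetric in m and l and disappear on antisymmetrising; the bracket
    term is skew by [conn_const_inner] itself. *)
Lemma curvature_antisym (p : M) m l i k : local_frame g b p ->
  g p (curvature D (b m) (b l) (b i) p) (b k p) =
  - g p (curvature D (b m) (b l) (b k) p) (b i p).
Proof.
move=> fb; have sb := frame_fields fb; have tb j := field_tangent (sb j).
have sbb a c : smooth_field_at p (frame_conn D b a c) by exact: (frame_conn_smooth DP _ _ fb).
have tbb a c := field_tangent (sbb a c).
have tDD a c d : tangent p (D p (b a p) (frame_conn D b c d)).
  exact: (conn_tangent DP (tb a) (sbb c d)).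
have tbr a c := bracket_tangent sM (sb a) (sb c).
have tDB a c d : tangent p (D p (bracket (b a) (b c) p) (b d)).
  exact: (conn_tangent DP (tbr a c) (sb d)).
have key a c : g p (D p (b a p) (frame_conn D b c i)) (b k p)
   + g p (D p (b a p) (frame_conn D b c k)) (b i p) =
   - g p (frame_conn D b c i p) (frame_conn D b a k p)
   - g p (frame_conn D b c k p) (frame_conn D b a i p).
  have e1 := Dg (tb a) (sbb c i) (sb k); have e2 := Dg (tb a) (sbb c k) (sb i).
  have : b a p (fun q => g q (frame_conn D b c i q) (b k q)) =
      - b a p (fun q => g q (frame_conn D b c k q) (b i q)).
    rewrite -mulN1r -(tangentZ sM _ (tb a)); last first.
      by apply: (metric_smooth rg).
    apply: (tangent_eq sM (tb a)).
    apply: (nearbyS sM) (nearby_nearby sM fb) => q fbq.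
    rewrite mulN1r; apply: conn_const_inner => //.
    exact/field_tangent/(frame_fields fbq).
  rewrite e1 e2 -!/(frame_conn D b _ _ p); lra.
have kb := @conn_const_inner p _ i k fb (tbr m l).
have gE d w : tangent p w -> g p (curvature D (b m) (b l) (b d) p) w =
    g p (D p (b m p) (frame_conn D b l d)) w - g p (D p (b l p) (frame_conn D b m d)) w
    - g p (D p (bracket (b m) (b l) p) (b d)) w.
  move=> tw; rewrite /curvature -/(frame_conn D b l d) -/(frame_conn D b m d).
  by rewrite !(metricBl rg)//; exact: tangentB_vec.
have k1 := key m l; have k2 := key l m.
have C1 := metricC rg (tbb m i) (tbb l k); have C2 := metricC rg (tbb m k) (tbb l i).
rewrite !gE//; lra.
Qed.

Lemma curvature_at_antisym (p : M) m l i k : local_frame g b p ->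
  g p (curvature_at D p (b m p) (b l p) (b i p)) (b k p) =
  - g p (curvature_at D p (b m p) (b l p) (b k p)) (b i p).
Proof.
move=> fb; have sb := frame_fields fb; have tb j := field_tangent (sb j).
have ob := frame_ortho fb.
have E d : curvature_at D p (b m p) (b l p) (b d p) = curvature D (b m) (b l) (b d) p.
  rewrite (curvature_at_frame fb)// (bigD1 d)//= (bigD1 l)//= (bigD1 m)//=.
  rewrite !ob !eqxx !mulr1 scale1r big1; last first.
    by move=> j jm; rewrite ob [m == j]eq_sym (negbTE jm) mulr0 scale0r.
  rewrite big1; last first.
    move=> j jl; apply: big1 => j' _.
    by rewrite !ob [l == j]eq_sym (negbTE jl) mulr0 mul0r scale0r.
  rewrite big1 ?addr0// => j jd; apply: big1 => j' _; apply: big1 => j'' _.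
  by rewrite !ob [d == j]eq_sym (negbTE jd) !mul0r scale0r.
by rewrite !E curvature_antisym.
Qed.

Section Along.
Context (X : diffSpace R) (sX : smooth_space X) (f : X -> M)
  (fsm : forall x, smooth_map_at f x)
  (fD : connection X M) (fDP : is_pullback_connection f D fD).
Let fDC : is_connection_along f fD := fDP.1.

Lemma conn_curvature_at x V W s : local_frame g b (f x) ->
  smooth_field_at x V -> smooth_field_at x W -> smooth_section_at f x s ->
  fD x (bracket V W x) s =
  fD x (V x) (fun y => fD y (W y) s) - fD x (W x) (fun y => fD y (V y) s) -
  curvature_at D (f x) (differential f x (V x)) (differential f x (W x)) (s x).
Proof.
move=> fb sV sW ss; rewrite curvature_at_frame//.
- rewrite -(conn_curvature rg DP sX fsm fDP fb sV sW ss).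
  by rewrite opprB addrC subrK.
- exact: (differential_tangent sM (fsm x) (section_tangent sX sV)).
- exact: (differential_tangent sM (fsm x) (section_tangent sX sW)).
- exact: (section_tangent sX ss).
Qed.

(** f^*D preserves the metric pulled back to f^*TM. In an orthonormal frame of M the derivatives of
    components give the Leibniz rule, and the two sums of connection coefficients cancel by
    skew-symmetry. *)
Lemma conn_metric x v s t : local_frame g b (f x) -> tangent x v ->
  smooth_section_at f x s -> smooth_section_at f x t ->
  v (fun y => g (f y) (s y) (t y)) =
  g (f x) (fD x v s) (t x) + g (f x) (s x) (fD x v t).
Proof.
move=> fb tv ss st; have sb := frame_fields fb; have tb j := field_tangent (sb j).
have sc s' i : smooth_section_at f x s' -> smooth_at x (coef g f b s' i).
  by move=> ss'; apply: (coef_smooth rg sX fsm ss').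
have E : v (fun y => g (f y) (s y) (t y)) =
   \sum_i (v (coef g f b s i) * coef g f b t i x + coef g f b s i x * v (coef g f b t i)).
  rewrite (@tangent_eq _ _ sX x v _ (fun y => \sum_i coef g f b s i y * coef g f b t i y) tv).
    rewrite (tangent_sum sX _ tv); last by move=> i; apply: (smoothM sX); exact: sc.
    by apply: eq_bigr => i _; rewrite (tangentM tv)//; exact: sc.
  apply: (nearbyS sX) (nearbyI sX (nearbyI sX (frame_nearby fsm fb) ss.1) st.1).
  move=> y [[fby ts] tt].
  have tby i : tangent (f y) (b i (f y)) by exact/field_tangent/(frame_fields fby).
  rewrite {1}(frame_expansion rg fby ts) (metric_suml rg)//.
  by apply: eq_bigr => i _; rewrite (metricC rg (tby i)).
have H s' t' : smooth_section_at f x s' -> smooth_section_at f x t' ->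
   g (f x) (fD x v s') (t' x) = \sum_i v (coef g f b s' i) * coef g f b t' i x +
     \sum_i \sum_k \sum_l coef g f b s' i x * coef g f b t' k x *
       g (f x) (differential f x v) (b l (f x)) * g (f x) (frame_conn D b l i (f x)) (b k (f x)).
  move=> ss' st'; have tt' := section_tangent sX st'.
  have tbb l i : tangent (f x) (frame_conn D b l i (f x)).
    exact: (field_tangent (frame_conn_smooth DP l i fb)).
  have tS i : tangent (f x) (\sum_l (coef g f b s' i x *
      g (f x) (differential f x v) (b l (f x))) *: frame_conn D b l i (f x)).
    exact: tangent_sum_scale.
  have tT i : tangent (f x) (v (coef g f b s' i) *: b i (f x) +
     \sum_l (coef g f b s' i x * g (f x) (differential f x v) (b l (f x))) *: frame_conn D b l i (f x)).
    by apply: tangent_scaleD => //; exact: tangent_sum_scale.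
  rewrite (conn_section rg DP sX fsm fDP fb tv ss').
  under eq_bigr do rewrite -[_ + _]scale1r.
  rewrite (metric_suml rg)// -big_split /=; apply: eq_bigr => i _.
  rewrite mul1r (metric_linl rg)//; congr (_ + _).
    by rewrite (metricC rg (tb i)).
  rewrite exchange_big (metric_suml rg)//; apply: eq_bigr => l _ /=.
  rewrite {1}(frame_expansion rg fb tt') (metric_sumr rg)// mulr_sumr.
  by apply: eq_bigr => k _; rewrite /coef; ring.
rewrite E (metricC rg (section_tangent sX ss)); last exact: (conn_tangent fDC tv st).
rewrite (H s t)// (H t s)// big_split /= -!addrA; congr (_ + _).
have -> : \sum_i \sum_k \sum_l coef g f b s i x * coef g f b t k x *
       g (f x) (differential f x v) (b l (f x)) * g (f x) (frame_conn D b l i (f x)) (b k (f x))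
   = - \sum_i \sum_k \sum_l coef g f b t i x * coef g f b s k x *
       g (f x) (differential f x v) (b l (f x)) * g (f x) (frame_conn D b l i (f x)) (b k (f x)).
  rewrite exchange_big /= -sumrN; apply: eq_bigr => i _.
  rewrite -sumrN; apply: eq_bigr => k _; rewrite -sumrN; apply: eq_bigr => l _.
  by rewrite /frame_conn (conn_const_inner i k fb (tb l)); ring.
rewrite addrCA [X in _ + X]addrC subrr addr0.
by apply: eq_bigr => i _; rewrite mulrC.
Qed.

(** In general the torsion of D, evaluated on df V and df W, has to be subtracted on the right. It
    vanishes here because df V = 0 at x. *)
Lemma push_bracket_vertical x V W : local_frame g b (f x) ->
  smooth_field_at x V -> smooth_field_at x W -> differential f x (V x) = 0 ->
  differential f x (bracket V W x) =
  fD x (V x) (fun y => differential f y (W y)) - fD x (W x) (fun y => differential f y (V y)).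
Proof.
move=> fb sV sW dV0; have sb := frame_fields fb; have tb j := field_tangent (sb j).
have tV := section_tangent sX sV; have tW := section_tangent sX sW.
rewrite (push_bracket rg sX fsm fb sV sW).
rewrite (conn_section rg DP sX fsm fDP fb tV (smooth_section_push sX sM fsm sW)).
rewrite (conn_section rg DP sX fsm fDP fb tW (smooth_section_push sX sM fsm sV)).
have g0 i : g (f x) (differential f x (V x)) (b i (f x)) = 0.
  by rewrite dV0 (metric0l rg).
rewrite [X in _ + X]big1 ?addr0; last first.
  by move=> l _; apply: big1 => m _; rewrite [coef _ _ _ _ m x]g0 mulr0 scale0r.
rewrite -sumrB; apply: eq_bigr => i _; rewrite scalerBl; congr (_ - _).
  by rewrite big1 ?addr0// => l _; rewrite g0 mulr0 scale0r.
by rewrite big1 ?addr0// => l _; rewrite [coef _ _ _ _ i x]g0 mul0r scale0r.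
Qed.

End Along.
End Curvature.

(** * Vector fields on the sphere bundle *)

Section SphereFields.
Context (R : realType) (n : nat) (M : oriented_manifold R n)
  (g : M -> tvec M -> tvec M -> R) (rg : is_riemannian g)
  (D : connection M M) (DP : is_linear_connection D) (Dg : is_metric_connection g D)
  (fD : connection (sphere_bundle g) M)
  (fDP : is_pullback_connection (@sproj R n M g) D fD).
Let sM : smooth_space M := @mspace_smooth R n M.
Let sS : smooth_space (sphere_bundle g) := @sphere_smooth R n M g.
Let f : sphere_bundle g -> M := @sproj R n M g.
Let fsm : forall w, smooth_map_at f w := @sproj_smooth R n M g.
Let U : sphere_bundle g -> tvec M := @taut R n M g.
Implicit Types (w y : sphere_bundle g).

Lemma sphere_eq w y : sval w = sval y -> w = y.
Proof.
case: w => [x xP]; case: y => [x' x'P] /= e; move: xP; rewrite e => xP.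
by congr exist; exact: Prop_irrelevance.
Qed.

Lemma taut_tangent w : tangent (f w) (U w).
Proof. by have [] := svalP w. Qed.

Lemma taut_unit w : g (f w) (U w) (U w) = 1.
Proof. by have [] := svalP w. Qed.

Lemma taut_section w : smooth_section_at f w U.
Proof.
split; first by apply: (nearbyT sS) => y; exact: taut_tangent.
move=> h sh; have [_ coverP _] := m_atlas M; have [c Ac cw] := coverP (f w).
have cn := (fsm w).1 _ (chart_dom_nearby Ac cw).
apply: (smooth_eq sS (h := fun y => \sum_j U y (fun q => cmap c q 0 j) *
    coord_field c j (f y) h)).
  apply: (nearbyS sS) cn => y cy.
  by rewrite {2}(tangent_coord_field Ac cy (taut_tangent y)) fct_sumE.
apply: (smooth_sum sS) => j; apply: (smoothM sS); first exact: taut_coord_smooth.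
apply: ((fsm w).2 (fun q => coord_field c j q h)).
exact: (coord_field_smooth j Ac cw).2.
Qed.

Variables (b : 'I_n -> M -> tvec M) (u0 : sphere_bundle g) (c : chart R (mtop M) n).
Hypotheses (fb : local_frame g b (f u0)) (Ac : atlas M c) (cu : cdom c (f u0)).

Let z i w : R := coef g f b U i w.

Let sz i w : local_frame g b (f w) -> smooth_at w (z i).
Proof. by move=> fbw; apply: (coef_smooth rg sS fsm (taut_section w)); exact: (frame_fields fbw i). Qed.

Lemma taut_coefs w : local_frame g b (f w) ->
  U w = \sum_i z i w *: b i (f w) /\ \sum_i z i w ^+ 2 = 1.
Proof.
move=> fbw; have E := frame_expansion rg fbw (taut_tangent w); split=> //.
have tb i := field_tangent (frame_fields fbw i).
by rewrite -(taut_unit w) {2}E (metric_sumr rg)//; exact: taut_tangent.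
Qed.

(** * The retraction onto the sphere bundle and the fields it pushes forward *)

Let base (r : rspace R (n + n)) : M := cinv c (lsubmx r).
Let S (r : rspace R (n + n)) : R := \sum_i (r : 'rV[R]_(n + n)) 0 (rshift n i) ^+ 2.
Let vec (r : rspace R (n + n)) : tvec M :=
  \sum_i ((r : 'rV[R]_(n + n)) 0 (rshift n i) * S r `^ (- 2^-1)) *: b i (base r).
(** The fibre coordinates are components in the orthonormal frame, not in the chart, so that SM
    becomes the locus [S] = 1. *)
Let kappa w : rspace R (n + n) := row_mx (cmap c (f w)) (\row_i z i w).

(** A point of SM carries a proof, so a total map into SM needs a default [w] where (p, v) fails to
    be a unit tangent vector. *)
Definition sphere_point (p : M) (v : tvec M) (w : sphere_bundle g) : sphere_bundle g :=
  match pselect (tangent p v /\ g p v v = 1) with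
  | left H => exist _ (p, v) H
  | right _ => w
  end.

Lemma sphere_pointE p v w : tangent p v -> g p v v = 1 ->
  sval (sphere_point p v w) = (p, v).
Proof. by move=> tv gv; rewrite /sphere_point; case: pselect => //; case. Qed.

(* A local left inverse of the coordinates [kappa]: renormalising the fibre part
   retracts an open subset of R^(n+n) onto the sphere bundle. *)
Let rho (r : rspace R (n + n)) : sphere_bundle g := sphere_point (base r) (vec r) u0.

Let good (r : rspace R (n + n)) : Prop :=
  [/\ (cmap c @` cdom c) (lsubmx r), local_frame g b (base r) & 0 < S r].

Let sR : smooth_space (rspace R (n + n)) := @rspace_smooth R (n + n).

Let s_coord (r : rspace R (n + n)) j : smooth_at r (fun z : 'rV[R]_(n + n) => z 0 j).
Proof. by exists setT; split=> //; [exact: openT|move=> k; exact: Ck_coord]. Qed.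

Let sS_ (r : rspace R (n + n)) : smooth_at r S.
Proof. by apply: (smooth_sum sR) => i; apply: (smoothM sR); exact: s_coord. Qed.

Let near_image (r : rspace R (n + n)) : (cmap c @` cdom c) (lsubmx r) ->
  nearby r (fun z : rspace R (n + n) => (cmap c @` cdom c) (lsubmx z)).
Proof.
move=> rI; have [chP _ _] := m_atlas M; have [oc oi cK cc ci] := chP _ Ac.
have cl : {for (r : 'rV[R]_(n + n)), continuous (lsubmx : 'rV[R]_(n + n) -> 'rV[R]_n)}.
  apply: continuous_rV => i.
  have -> : (fun r' : 'rV[R]_(n + n) => lsubmx r' 0 i) = (fun r' => r' 0 (lshift n i)).
    by apply/funext => r'; rewrite mxE.
  exact: coord_continuous.
by apply: (cl (cmap c @` cdom c)); exact: open_nbhs_nbhs.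
Qed.

Let base_smooth r : (cmap c @` cdom c) (lsubmx r) -> smooth_map_at base r.
Proof.
move=> rI; have [chP _ _] := m_atlas M; have [oc oi cK cc ci] := chP _ Ac.
apply: (@smooth_map_charted _ _ _ sR _ _ _ _ _ (@mspace_charted R n M) (mchart Ac)).
- by have [y cy e] := rI; rewrite /base -e /= cK.
- by apply: (nearbyS sR) (near_image rI) => r' [y cy e]; rewrite /base -e /= cK.
- move=> j; apply: (smooth_eq sR) (s_coord r (lshift n j)).
  apply: (nearbyS sR) (near_image rI) => r' [y cy e].
  by rewrite /base /= -e cK// e mxE.
Qed.

Let good_near r : good r -> nearby r good.
Proof.
move=> [rI fbr S0].
have n1 := (base_smooth rI).1 _ (nearby_nearby sM fbr).
have n2 := smooth_cont sR (B := [set t : R | 0 < t]) (sS_ r) (@open_gt R 0) S0.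
apply: (nearbyS sR) (nearbyI sR (nearbyI sR (near_image rI) n1) n2).
by move=> r' [[h1 h2] h3]; split.
Qed.

Let N2S r : 0 < S r -> S r `^ (- 2^-1) * S r `^ (- 2^-1) * S r = 1.
Proof.
move=> S0; rewrite -powRD; last by rewrite (gt_eqF S0) implybT.
have -> : - 2^-1 + - 2^-1 = -1 :> R by lra.
by rewrite powR_inv1 ?(ltW S0)// mulVf ?gt_eqF.
Qed.

Let vecP r : good r -> tangent (base r) (vec r) /\ g (base r) (vec r) (vec r) = 1.
Proof.
move=> [_ fbr S0]; have tb i := field_tangent (frame_fields fbr i).
have ob := frame_ortho fbr.
have tv : tangent (base r) (vec r) by exact: tangent_sum_scale.
split=> //; rewrite -[RHS](N2S S0) {1}/vec (metric_suml rg)//.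
rewrite {4}/S mulr_sumr; apply: eq_bigr => i _; rewrite (metric_sumr rg)// (bigD1 i)//= ob eqxx big1.
  by rewrite addr0 mulr1; ring.
by move=> j ji; rewrite ob eq_sym (negbTE ji) mulr0.
Qed.

Let rhoE r : good r -> f (rho r) = base r /\ U (rho r) = vec r.
Proof.
move=> gr; have [tv gv] := vecP gr.
have e := sphere_pointE u0 tv gv.
by rewrite /f /U /sproj /taut -/(rho r) /rho e.
Qed.

Let good_dom r : good r -> cdom c (base r).
Proof.
move=> [[y cy e] _ _]; have [chP _ _] := m_atlas M; have [oc oi cK cc ci] := chP _ Ac.
by rewrite /base -e cK.
Qed.

Let rho_smooth r : good r -> smooth_map_at rho r.
Proof.
move=> gr; have [chP _ _] := m_atlas M; have [oc oi cK cc ci] := chP _ Ac.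
apply: (@smooth_map_charted _ _ _ sR _ _ _ _ _ (sphere_charted g) (schart g Ac)).
- by rewrite /= -[_.1]/(f (rho r)) (rhoE gr).1; exact: good_dom.
- apply: (nearbyS sR) (good_near gr) => r' gr'.
  by rewrite /= -[_.1]/(f (rho r')) (rhoE gr').1; exact: good_dom.
move=> j; case: (fintype.split_ordP j) => i ->.
  apply: (smooth_eq sR) (s_coord r (lshift n i)).
  apply: (nearbyS sR) (good_near gr) => r' gr'.
  rewrite /= /tcoord row_mxEl -[_.1]/(f (rho r')) (rhoE gr').1.
  by have [[y cy e] _ _] := gr'; rewrite /base -e cK// e mxE.
have [rI fbr S0] := gr.
apply: (smooth_eq sR (h := fun r' : rspace R (n + n) =>
  \sum_k ((r' : 'rV[R]_(n + n)) 0 (rshift n k) * S r' `^ (- 2^-1)) *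
    b k (base r') (fun q => cmap c q 0 i))).
  apply: (nearbyS sR) (good_near gr) => r' gr'.
  rewrite /= /tcoord row_mxEr mxE -[_.2]/(U (rho r')) (rhoE gr').2.
  by rewrite /vec fct_sumE.
apply: (smooth_sum sR) => k; apply: (smoothM sR).
  by apply: (smoothM sR); [exact: s_coord|exact: (smooth_powR sR)].
apply: ((base_smooth rI).2 (fun q => b k q (fun q => cmap c q 0 i))).
apply: (frame_fields fbr k).2.
exact: (@smooth_chart_coord _ _ _ _ _ _ _ (@mspace_charted R n M) (mchart Ac) (good_dom gr)).
Qed.

Let kappaP w : cdom c (f w) -> local_frame g b (f w) -> good (kappa w) /\ rho (kappa w) = w.
Proof.
move=> cw fbw; have [chP _ _] := m_atlas M; have [oc oi cK cc ci] := chP _ Ac.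
have [UE S1] := taut_coefs fbw.
have bE : base (kappa w) = f w by rewrite /base /kappa row_mxKl cK.
have SE : S (kappa w) = 1.
  by rewrite -S1; apply: eq_bigr => i _; rewrite /kappa row_mxEr mxE.
have vE : vec (kappa w) = U w.
  rewrite UE /vec bE SE powR1; apply: eq_bigr => i _.
  by rewrite /kappa row_mxEr mxE mulr1.
have gk : good (kappa w).
  by split; [rewrite /kappa row_mxKl; exists (f w)|rewrite bE|rewrite SE].
split=> //; have [tv gv] := vecP gk; have e := sphere_pointE u0 tv gv.
have : sval (rho (kappa w)) = sval w by rewrite /rho e bE vE /f /U /sproj /taut -surjective_pairing.
exact: sphere_eq.
Qed.

Let near_frame : nearby u0 (fun w => cdom c (f w) /\ local_frame g b (f w)).
Proof.
have n1 := (fsm u0).1 _ (chart_dom_nearby Ac cu).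
exact: (nearbyI sS) n1 (frame_nearby fsm fb).
Qed.

Let d J w : tvec (sphere_bundle g) := differential rho (kappa w) (pder J (kappa w)).

Let kappa_smooth J : smooth_at u0 (fun w => (kappa w : 'rV[R]_(n + n)) 0 J).
Proof.
case: (fintype.split_ordP J) => i ->.
  have := @sphere_base_smooth R n M g c u0 i Ac cu; congr smooth_at.
  by apply/funext => w; rewrite /kappa row_mxEl.
have := sz i fb; congr smooth_at.
by apply/funext => w; rewrite /kappa row_mxEr mxE.
Qed.

Let d_smooth J : smooth_field_at u0 (d J).
Proof.
apply: (@pushforward_field _ _ sS _ rho kappa u0 J kappa_smooth).
apply: (nearbyS sS) near_frame => w [cw fbw].
by have [gw e] := kappaP cw fbw; split=> //; exact: rho_smooth.
Qed.

Let combination (A : 'I_(n + n) -> R) w (h : sphere_bundle g -> R) :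
  cdom c (f w) -> local_frame g b (f w) -> smooth_at w h ->
  (\sum_J A J *: d J w) h = (\sum_J A J *: pder J (kappa w)) (fun r => h (rho r)).
Proof.
move=> cw fbw sh; have [gw e] := kappaP cw fbw; rewrite !fct_sumE.
by apply: eq_bigr => J _; rewrite !fctE /d differentialE// e.
Qed.

Let pder_sum_coord (A : 'I_(n + n) -> R) r J :
  (\sum_K A K *: pder K r) (fun r' : 'rV[R]_(n + n) => r' 0 J) = A J.
Proof.
rewrite fct_sumE (bigD1 J)//= big1 ?addr0.
  by rewrite !fctE pder_coord eqxx /GRing.scale /= mulr1.
by move=> K KJ; rewrite !fctE pder_coord eq_sym (negbTE KJ) scaler0.
Qed.

Let pder_sum_tangent (A : 'I_(n + n) -> R) r : tangent r (\sum_K A K *: pder K r).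
Proof. by apply: tangent_sum_scale => K; exact: pder_tangent. Qed.

Let combination_base (A : 'I_(n + n) -> R) w j :
  cdom c (f w) -> local_frame g b (f w) ->
  (\sum_J A J *: d J w) (fun y => cmap c (f y) 0 j) = A (lshift n j).
Proof.
move=> cw fbw; have [gw e] := kappaP cw fbw.
have [chP _ _] := m_atlas M; have [oc oi cK cc ci] := chP _ Ac.
rewrite combination//; last exact: sphere_base_smooth.
rewrite -(pder_sum_coord A (kappa w) (lshift n j)).
apply: (tangent_eq sR); first exact: pder_sum_tangent.
apply: (nearbyS sR) (good_near gw) => r gr.
by rewrite (rhoE gr).1; have [[y cy ey] _ _] := gr; rewrite /base -ey cK// ey mxE.
Qed.

(** The condition on [A] says that the fibre direction is tangent to the sphere: then [S] and its
    power -1/2 have derivative 0, and renormalising does not alter the fibre components. *)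
Let combination_fiber (A : 'I_(n + n) -> R) w j :
  cdom c (f w) -> local_frame g b (f w) ->
  \sum_k z k w * A (rshift n k) = 0 ->
  (\sum_J A J *: d J w) (z j) = A (rshift n j).
Proof.
move=> cw fbw zA; have [gw e] := kappaP cw fbw; rewrite combination//; last exact: sz.
set r := kappa w; set v := \sum_J _.
have tv : tangent r v by exact: pder_sum_tangent.
have [rI fbr S0] := gw.
have sN : smooth_at r (fun r' => S r' `^ (- 2^-1)) by exact: (smooth_powR sR).
have rz k : (r : 'rV[R]_(n + n)) 0 (rshift n k) = z k w.
  by rewrite /r /kappa row_mxEr mxE.
have S1 : S r = 1.
  by have [_ <-] := taut_coefs fbw; apply: eq_bigr => k _; rewrite rz.
have vS : v S = 0.
  rewrite /S (tangent_sum sR _ tv); last by move=> k; apply: (smoothM sR); exact: s_coord.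
  rewrite (eq_bigr (fun k => 2 * (z k w * A (rshift n k)))); last first.
    move=> k _; rewrite (tangentM tv (s_coord _ _) (s_coord _ _)) /v pder_sum_coord rz; ring.
  by rewrite -mulr_sumr zA mulr0.
(* Obtained by differentiating N^2 S = 1 with N the power -1/2 of [S], which avoids a chain rule for
   powers. *)
have vN : v (fun r' => S r' `^ (- 2^-1)) = 0.
  have := tangent_cst sR 1 tv.
  have -> : v (fun=> 1) = v (fun r' => (S r' `^ (- 2^-1) * S r' `^ (- 2^-1)) * S r').
    apply: (tangent_eq sR tv); apply: (nearbyS sR) (good_near gw) => r' [_ _ S0'].
    by rewrite N2S.
  rewrite (tangentM tv (smoothM sR sN sN) (sS_ r)) (tangentM tv sN sN) vS S1 powR1.
  by lra.
rewrite (@tangent_eq _ _ sR r v _ (fun r' : rspace R (n + n) =>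
   (r' : 'rV[R]_(n + n)) 0 (rshift n j) * S r' `^ (- 2^-1)) tv).
  rewrite (tangentM tv (s_coord _ _) sN) vN mulr0 addr0 /v pder_sum_coord S1 powR1.
  by rewrite mulr1.
apply: (nearbyS sR) (good_near gw) => r' gr'.
have [rI' fbr' S0'] := gr'.
rewrite /z /coef (rhoE gr').1 (rhoE gr').2 /vec (metric_suml rg).
- rewrite (bigD1 j)//= (frame_ortho fbr') eqxx mulr1 big1 ?addr0// => k kj.
  by rewrite (frame_ortho fbr') (negbTE kj) mulr0.
- by move=> k; exact/field_tangent/(frame_fields fbr').
- exact/field_tangent/(frame_fields fbr').
Qed.

(** Smooth fields on SM with prescribed images under df and under (f^*D)U. The condition on [k] is
    forced: the derivative of the unit section U is orthogonal to U. *)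
Lemma sphere_field (a k : 'I_n -> sphere_bundle g -> R) :
  (forall i, smooth_at u0 (a i)) -> (forall i, smooth_at u0 (k i)) ->
  nearby u0 (fun w => \sum_i z i w * k i w = 0) ->
  exists E, smooth_field_at u0 E /\ nearby u0 (fun w =>
    [/\ tangent w (E w),
        differential f w (E w) = \sum_i a i w *: b i (f w)
      & fD w (E w) U = \sum_i k i w *: b i (f w)]).
Proof.
move=> sa sk zk; pose Gam l i j q := g q (frame_conn D b l i q) (b j q).
(* (f^*D)_E U has components E(z_j) plus connection coefficients, so prescribing it as [k]
   prescribes E(z_j) as [B]. *)
pose B j w := k j w - \sum_i \sum_l z i w * a l w * Gam l i j (f w).
pose A J w := match fintype.split J with
  | inl j => \sum_i a i w * b i (f w) (fun q => cmap c q 0 j)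
  | inr j => B j w end.
have sb := frame_fields fb.
have sB j : smooth_at u0 (B j).
  apply: (smoothB sS) => //; apply: (smooth_sum sS) => i; apply: (smooth_sum sS) => l.
  apply: (smoothM sS); first by apply: (smoothM sS) => //; exact: sz.
  apply: ((fsm u0).2 (Gam l i j)); apply: (metric_smooth rg) => //.
  exact: (frame_conn_smooth DP _ _ fb).
have sA J : smooth_at u0 (A J).
  rewrite /A; case: (fintype.split J) => j //.
  apply: (smooth_sum sS) => i; apply: (smoothM sS) => //.
  apply: ((fsm u0).2 (fun q => b i q (fun q => cmap c q 0 j))); apply: (sb i).2.
  exact: (@smooth_chart_coord _ _ _ _ _ _ _ (@mspace_charted R n M) (mchart Ac)).
exists (fun w => \sum_J A J w *: d J w).
have sE : smooth_field_at u0 (fun w => \sum_J A J w *: d J w).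
  exact: (smooth_field_lincomb sS sS).
split=> //; apply: (nearbyS sS) (nearbyI sS (nearbyI sS near_frame zk) sE.1).
move=> w [[[cw fbw] zkw] tE]; have sbw := frame_fields fbw.
have tb i := field_tangent (sbw i).
have tbb l i := field_tangent (frame_conn_smooth DP l i fbw).
have GamN l i j : Gam l i j (f w) = - Gam l j i (f w).
  by apply: (conn_const_inner rg DP Dg).
(* The connection part of [B] is orthogonal to [z] because the coefficients [Gam] are skew in their
   last two indices; [B] is therefore a direction tangent to the sphere. *)
have zB : \sum_j z j w * A (rshift n j) w = 0.
  rewrite /A; under eq_bigr => j _.
    rewrite (unsplitK (inr j : 'I_n + 'I_n)) /B mulrBr mulr_sumr; over.
  rewrite sumrB zkw sub0r; apply/eqP; rewrite oppr_eq0; apply/eqP.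
  set T := \sum_j _; have : T = - T; last by lra.
  rewrite {1}/T exchange_big /= -sumrN; apply: eq_bigr => i _.
  rewrite -sumrN; apply: eq_bigr => j _; rewrite !mulr_sumr -sumrN.
  by apply: eq_bigr => l _; rewrite (GamN l j i); ring.
have dE : differential f w (\sum_J A J w *: d J w) = \sum_i a i w *: b i (f w).
  have tdE := differential_tangent sM (fsm w) tE.
  apply: (@tangent_ext _ _ _ _ _ _ _ _ (@mspace_charted R n M) (mchart Ac) cw) => //.
    exact: tangent_sum_scale.
  move=> j; rewrite differentialE /=; last first.
    exact: (@smooth_chart_coord _ _ _ _ _ _ _ (@mspace_charted R n M) (mchart Ac)).
  rewrite combination_base// /A (unsplitK (inl j : 'I_n + 'I_n)).
  by rewrite fct_sumE.
split=> //.
rewrite (conn_section rg DP sS fsm fDP fbw tE (taut_section w)) dE.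
under eq_bigr => i _ do rewrite -/(z i) combination_fiber// /A (unsplitK (inr i : 'I_n + 'I_n)).
have tS i : tangent (f w) (\sum_l (z i w * a l w) *: frame_conn D b l i (f w)).
  exact: tangent_sum_scale.
have aE l : g (f w) (\sum_i a i w *: b i (f w)) (b l (f w)) = a l w.
  rewrite (metric_suml rg)// (bigD1 l)//= (frame_ortho fbw) eqxx mulr1 big1 ?addr0//.
  by move=> i il; rewrite (frame_ortho fbw) (negbTE il) mulr0.
rewrite big_split /=.
under [X in _ + X]eq_bigr => i _.
  under eq_bigr do rewrite aE -/(z i w).
  rewrite (frame_expansion rg fbw (tS i)); over.
rewrite exchange_big /= -big_split /=; apply: eq_bigr => j _.
rewrite -scaler_suml -scalerDl; congr (_ *: _); rewrite /B.
under [X in _ + X]eq_bigr do rewrite (metric_suml rg)//.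
by rewrite subrK.
Qed.

End SphereFields.

(** * Adapted frames *)

(* The rows are the quaternion [z] multiplied on the right by 1, i, j, k. *)
Definition quat (R : nzRingType) (z : 'I_4 -> R) (k i : 'I_4) : R :=
  let z0 := z ord0 in let z1 := z (lift ord0 ord0) in
  let z2 := z (lift ord0 (lift ord0 ord0)) in
  let z3 := z (lift ord0 (lift ord0 (lift ord0 ord0))) in
  nth 0 (nth [::] [:: [:: z0; z1; z2; z3]; [:: - z1; z0; z3; - z2];
    [:: - z2; - z3; z0; z1]; [:: - z3; z2; - z1; z0]] k) i.

(** Left multiplication by a quaternion is a similarity whose ratio is its norm. *)
Lemma quat_orthogonal (R : comNzRingType) (z : 'I_4 -> R) k l :
  \sum_i quat z k i * quat z l i = (k == l)%:R * \sum_i z i ^+ 2.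
Proof.
rewrite !big_ord_recl !big_ord0.
by case: k => [[|[|[|[|//]]]] kP]; case: l => [[|[|[|[|//]]]] lP]; rewrite /quat /=; ring.
Qed.

Lemma quat_row0 (R : nzRingType) (z : 'I_4 -> R) i : quat z ord0 i = z i.
Proof.
by case: i => [[|[|[|[|//]]]] iP]; rewrite /quat /=; congr z; apply/val_inj.
Qed.

Lemma quat_unit (R : nzRingType) (z : 'I_4 -> R) k i :
  (forall j, z j = (j == ord0)%:R) -> quat z k i = (i == k)%:R.
Proof.
move=> zE; case: k => [[|[|[|[|//]]]] kP]; case: i => [[|[|[|[|//]]]] iP];
  by rewrite /quat /= !zE /= ?oppr0.
Qed.

(** Positivity of transition Jacobians lets the orientation of a basis be tested in a single
    chart. *)
Lemma jacobian_det_gt0 (R : realType) n (M : oriented_manifold R n) (c c' : chart R (mtop M) n)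
    (q : M) (v : 'I_n -> tvec M) :
  atlas M c -> atlas M c' -> cdom c q -> cdom c' q -> (forall i, tangent q (v i)) ->
  0 < \det (\matrix_(i, j) v i (fun y => cmap c y 0 j)) ->
  0 < \det (\matrix_(i, j) v i (fun y => cmap c' y 0 j)).
Proof.
move=> Ac Ac' cq cq' tv v0; have [chP _ trP] := m_atlas M.
have [oc oi cK cc ci] := chP _ Ac; have [oc' _ _ _ _] := chP _ Ac'.
have [kt J0] := trP _ _ Ac Ac'.
set B := cmap c @` (cdom c `&` cdom c') in kt J0.
have oB : open B.
  by rewrite /B chart_overlap; [exact: open_setI_preimage oi ci oc'|exact: chP].
have Bq : B (cmap c q) by exists q.
rewrite (_ : (\matrix_(i, j) v i (fun y => cmap c' y 0 j)) =
  (\matrix_(i, j) v i (fun y => cmap c y 0 j)) *m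
  (\matrix_(i, j) 'D_(delta_mx 0 i) (fun x => cmap c' (cinv c x) 0 j) (cmap c q))).
  by rewrite det_mulmx mulr_gt0//; exact: J0.
apply/matrixP => i j; rewrite !mxE.
rewrite (@tangent_coord R M n (@mcharts R n M) (cdom c, cmap c) _ B
  (fun x => cmap c' (cinv c x) 0 j) _ _ (@mspace_charted R n M) (mchart Ac) cq oB Bq (kt j) _ (tv i)).
  by apply: eq_bigr => k _; rewrite !mxE mulrC.
by move=> y /= cy _; rewrite cK.
Qed.

Section AdaptedFrame.
Context (R : realType) (M : oriented_manifold R 4)
  (g : M -> tvec M -> tvec M -> R) (rg : is_riemannian g)
  (D : connection M M) (DP : is_linear_connection D) (Dg : is_metric_connection g D)
  (fD : connection (sphere_bundle g) M)
  (fDP : is_pullback_connection (@sproj R 4 M g) D fD).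
Let sM : smooth_space M := @mspace_smooth R 4 M.
Let sS : smooth_space (sphere_bundle g) := @sphere_smooth R 4 M g.
Let f : sphere_bundle g -> M := @sproj R 4 M g.
Let fsm : forall w, smooth_map_at f w := @sproj_smooth R 4 M g.
Let U : sphere_bundle g -> tvec M := @taut R 4 M g.
Variables (b : 'I_4 -> M -> tvec M) (u : sphere_bundle g).
Hypotheses (fb : local_frame g b (f u)) (bd : direct_orthonormal g (f u) (fun i => b i (f u)))
  (b0 : b ord0 (f u) = U u).

Let z w i : R := coef g f b U i w.

Definition adapted_section (k : 'I_4) (w : sphere_bundle g) : tvec M :=
  \sum_i quat (z w) k i *: b i (f w).
Local Notation ee := adapted_section.

Let sz i : smooth_at u (fun w => z w i).
Proof. by apply: (coef_smooth rg sS fsm (taut_section u)); exact: (frame_fields fb i). Qed.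

Let squat k i : smooth_at u (fun w => quat (z w) k i).
Proof.
have sN j : smooth_at u (fun w => - z w j).
  have := smoothZ sS (-1) (sz j); congr smooth_at.
  by apply/funext => w; rewrite mulN1r.
case: k => [[|[|[|[|//]]]] kP]; case: i => [[|[|[|[|//]]]] iP]; rewrite /quat /=;
  by [exact: sz|exact: sN].
Qed.

Lemma adapted_section_smooth k : smooth_section_at f u (ee k).
Proof.
apply: (smooth_field_lincomb sS sM) => // i.
by apply: (smooth_section_pull fsm); exact: (frame_fields fb i).
Qed.

Lemma adapted_section_at k : ee k u = b k (f u).
Proof.
have zu j : z u j = (j == ord0)%:R.
  by rewrite /z /coef -/(f u) -b0 (frame_ortho fb) eq_sym.
rewrite /ee (bigD1 k)//= (quat_unit _ _ zu) eqxx scale1r big1 ?addr0// => i ik.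
by rewrite (quat_unit _ _ zu) (negbTE ik) scale0r.
Qed.

Lemma adapted_section0 w : local_frame g b (f w) -> ee ord0 w = U w.
Proof.
move=> fbw; have [UE _] := taut_coefs rg fbw; rewrite -[RHS]/(taut w) [RHS]UE.
by apply: eq_bigr => i _; rewrite quat_row0.
Qed.

Lemma adapted_section_tangent k w : local_frame g b (f w) -> tangent (f w) (ee k w).
Proof.
by move=> fbw; apply: tangent_sum_scale => i; exact/field_tangent/(frame_fields fbw).
Qed.

Lemma adapted_section_ortho k l w : local_frame g b (f w) ->
  g (f w) (ee k w) (ee l w) = (k == l)%:R.
Proof.
move=> fbw; have tb i := field_tangent (frame_fields fbw i).
have te := adapted_section_tangent l fbw.
rewrite {1}/ee (metric_suml rg)//.
have [_ z1] := taut_coefs rg fbw.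
transitivity (\sum_i quat (z w) k i * quat (z w) l i).
  apply: eq_bigr => i _; congr (_ * _).
  rewrite (metric_sumr rg)// (bigD1 i)//= (frame_ortho fbw) eqxx mulr1 big1 ?addr0//.
  by move=> j ji; rewrite (frame_ortho fbw) eq_sym (negbTE ji) mulr0.
rewrite quat_orthogonal (_ : \sum_i _ = 1) ?mulr1//.
Qed.

(** In one fixed chart the determinant is a smooth function of w, positive at u by hypothesis, hence
    positive nearby. *)
Lemma adapted_section_direct :
  nearby u (fun w => direct_orthonormal g (f w) (fun k => ee k w)).
Proof.
have [_ coverP _] := m_atlas M; have [c Ac cu] := coverP (f u).
pose dt w := \det (\matrix_(i, j) ee i w (fun q => cmap c q 0 j)).
have sdt : smooth_at u dt.
  rewrite /dt /determinant; apply: (smooth_sum sS) => s; apply: (smoothZ sS).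
  apply: (smooth_prod sS) => i.
  have := (adapted_section_smooth i).2 (fun q => cmap c q 0 (s i)).
  move=> /(_ (@smooth_chart_coord _ _ _ _ _ _ _ (@mspace_charted R 4 M) (mchart Ac) cu)).
  by congr smooth_at; apply/funext => w; rewrite mxE.
have d0 : 0 < dt u.
  have [_ _ /(_ _ Ac cu)] := bd; congr (_ < \det _).
  by apply/matrixP => i j; rewrite !mxE adapted_section_at.
have n1 := smooth_cont sS (B := [set t : R | 0 < t]) sdt (@open_gt R 0) d0.
have n2 := (fsm u).1 _ (chart_dom_nearby Ac cu).
apply: (nearbyS sS) (nearbyI sS (nearbyI sS n1 n2) (frame_nearby fsm fb)).
move=> w [[dw cw] fbw]; split.
- by move=> k; exact: (adapted_section_tangent k fbw).
- by move=> k l; exact: (adapted_section_ortho k l fbw).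
- move=> c' Ac' cw'.
  apply: (@jacobian_det_gt0 R 4 M c c' (f w) (fun k => ee k w) Ac Ac' cw cw' _ dw) => k.
  exact: (adapted_section_tangent k fbw).
Qed.

Lemma adapted_frame_field :
  exists E : 'I_7 -> sphere_bundle g -> tvec (sphere_bundle g),
    (forall J, smooth_field_at u (E J)) /\
    nearby u (fun w => adapted_frame fD w (fun k => ee k w) (fun J => E J w)).
Proof.
have [_ coverP _] := m_atlas M; have [c Ac cu] := coverP (f u).
(* [a J] and [k J] are the components over [b] of the wanted df E_J and (f^*D)U: a row of the
   quaternion matrix for the one, 0 for the other. The vertical fields use rows 1 to 3. *)
pose a (J : 'I_(4 + 3)) i w : R :=
  match fintype.split J with inl k => quat (z w) k i | inr _ => 0 end.
pose k (J : 'I_(4 + 3)) i w : R :=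
  match fintype.split J with inl _ => 0 | inr k => quat (z w) (rshift 1 k) i end.
have sa J i : smooth_at u (a J i).
  by rewrite /a; case: (fintype.split J) => j //; exact: (smooth_cst sS).
have sk J i : smooth_at u (k J i).
  by rewrite /k; case: (fintype.split J) => j //; exact: (smooth_cst sS).
have nfb := frame_nearby fsm fb.
(* Row 0 is [z] itself and the other rows are orthogonal to it. *)
have zk J : nearby u (fun w => \sum_i coef g f b U i w * k J i w = 0).
  apply: (nearbyS sS) nfb => w fbw; rewrite /k; case: (fintype.split J) => j.
    by rewrite big1// => i _; rewrite mulr0.
  under eq_bigr do rewrite -/(z w _) -(quat_row0 (z w)).
  by rewrite quat_orthogonal mul0r.
have /choice[E EP] := fun J => sphere_field rg DP Dg fDP fb Ac cu (sa J) (sk J) (zk J).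
exists E; split; first by move=> J; exact: (EP J).1.
have nE := nearby_forall sS (fun J => (EP J).2).
apply: (nearbyS sS) (nearbyI sS (nearbyI sS nE nfb) adapted_section_direct).
move=> w [[EPw fbw] dw]; split=> //; first exact: adapted_section0.
- move=> i; have [tE dE fE] := EPw (lshift 3 i); split=> //.
    by rewrite dE /a (unsplitK (inl i : 'I_4 + 'I_3)).
  by rewrite fE /k (unsplitK (inl i : 'I_4 + 'I_3)) big1// => j _; rewrite scale0r.
- move=> i; have [tE dE fE] := EPw (rshift 4 i); split=> //.
    by rewrite dE /a (unsplitK (inr i : 'I_4 + 'I_3)) big1// => j _; rewrite scale0r.
  by rewrite fE /k (unsplitK (inr i : 'I_4 + 'I_3)).
Qed.

End AdaptedFrame.

(** * The Hodge star on a basis *)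

Lemma split_lshift p q (a : 'I_p) : fintype.split (lshift q a) = inl a.
Proof. exact: (unsplitK (inl a : 'I_p + 'I_q)). Qed.

Lemma split_rshift p q (b : 'I_q) : fintype.split (rshift p b) = inr b.
Proof. exact: (unsplitK (inr b : 'I_p + 'I_q)). Qed.

(** In the Leibniz expansion a permutation s selects the single multi-index I = K o s^-1.
    Alternation of w makes the p! contributions equal, which cancels the 1/p! of the Hodge star. *)
Lemma det_delta_sum (R : comNzRingType) (T : Type) (m p : nat) (e : 'I_m -> T)
    (w : ('I_p -> T) -> R) (K : 'I_p -> 'I_m) :
  (forall s : 'S_p, w (fun a => e (K (s a))) = (-1) ^+ s * w (fun a => e (K a))) ->
  \sum_(I : {ffun 'I_p -> 'I_m}) w (fun a => e (I a)) *
    \det (\matrix_(a, b) (K a == I b)%:R) = p`!%:R * w (fun a => e (K a)).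
Proof.
move=> wP; rewrite /determinant.
under eq_bigr do rewrite mulr_sumr.
rewrite exchange_big /=.
rewrite (eq_bigr (fun=> w (fun a => e (K a)))) => [|s _].
  by rewrite sumr_const card_Sn mulr_natl.
rewrite (bigD1 [ffun a => K (s^-1 a)%g])//= [X in _ + X]big1 ?addr0 => [|I IK].
  rewrite big1 ?mulr1 => [|a _]; last by rewrite mxE ffunE permK eqxx.
  have -> : (fun a => e ([ffun a => K ((s^-1)%g a)] a)) = (fun a => e (K ((s^-1)%g a))).
    by apply/funext => a; rewrite ffunE.
  by rewrite wP odd_permV mulrAC -signr_addb addbb mul1r.
suff /existsP[a Ka] : [exists a, K a != I (s a)].
  by rewrite (bigD1 a)//= mxE (negbTE Ka) mul0r !mulr0.
apply: contraNT IK; rewrite negb_exists => /forallP H.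
apply/eqP/ffunP => a; rewrite ffunE; apply/esym.
by have := H ((s^-1)%g a); rewrite negbK permKV => /eqP.
Qed.

(** With its rows permuted by s, the volume matrix is block triangular with an identity block for
    the last q vectors; what remains is a determinant of deltas on the first p. *)
Lemma hodge_basis (R : realType) (T : Type) (p q : nat) (th : 'I_(p + q) -> T -> R)
    (e : 'I_(p + q) -> T) (w : ('I_p -> T) -> R) (s : 'S_(p + q)) :
  (forall i j, th i (e j) = (i == j)%:R) ->
  (forall t : 'S_p, w (fun a => e (s (lshift q (t a)))) =
     (-1) ^+ t * w (fun a => e (s (lshift q a)))) ->
  hodge th e w (fun b => e (s (rshift p b))) =
  (-1) ^+ s * w (fun a => e (s (lshift q a))).
Proof.
move=> thE wP; rewrite /hodge.
rewrite (eq_bigr (fun I : {ffun 'I_p -> 'I_(p + q)} => (-1) ^+ s * (w (fun a => e (I a)) *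
    \det (\matrix_(a, b) (s (lshift q a) == I b)%:R)))) => [|I _].
  rewrite -mulr_sumr (@det_delta_sum _ _ _ _ e w (fun a => s (lshift q a))) //.
  by rewrite mulrCA mulKf// pnatr_eq0 -lt0n fact_gt0.
set A := \matrix_(i, b) _; rewrite mulrCA; congr (_ * _).
have -> : \det A = (-1) ^+ s * \det (row_perm s A).
  by rewrite row_permE det_mulmx det_perm mulrA -expr2 sqrr_sign mul1r.
congr (_ * _).
have -> : row_perm s A = block_mx (\matrix_(a, b) (s (lshift q a) == I b)%:R) 0
    (\matrix_(a, b) (s (rshift p a) == I b)%:R) 1%:M.
  apply/matrixP => i b; rewrite [LHS]mxE [LHS]mxE.
  case: (fintype.split_ordP i) => i' ->; case: (fintype.split_ordP b) => b' ->.
  - by rewrite block_mxEul mxE /fcat split_lshift thE.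
  - rewrite block_mxEur mxE /fcat split_rshift thE.
    by rewrite (inj_eq perm_inj) eq_lrshift.
  - by rewrite block_mxEdl mxE /fcat split_lshift thE.
  - rewrite block_mxEdr mxE /fcat split_rshift thE.
    by rewrite (inj_eq perm_inj) (inj_eq (@rshift_inj _ _)).
by rewrite det_lblock det1 mulr1.
Qed.

Definition lblock_fun p q (s : 'S_p) (i : 'I_(p + q)) : 'I_(p + q) :=
  match fintype.split i with inl a => lshift q (s a) | inr b => rshift p b end.

Lemma lblock_fun_inj p q (s : 'S_p) : injective (@lblock_fun p q s).
Proof.
move=> i j; rewrite /lblock_fun.
case: (fintype.split_ordP i) => i' ->; case: (fintype.split_ordP j) => j' ->.
- by move=> /lshift_inj/perm_inj ->.
- by move/eqP; rewrite eq_lrshift.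
- by move/eqP; rewrite eq_rlshift.
- by [].
Qed.

Definition lblock_perm p q (s : 'S_p) : 'S_(p + q) := perm (@lblock_fun_inj p q s).

Lemma lblock_permE p q (s : 'S_p) a : @lblock_perm p q s (lshift q a) = lshift q (s a).
Proof. by rewrite permE /lblock_fun split_lshift. Qed.

(** The analogue of [det_delta_sum] for the sum over S_(p+q) in a wedge product. Permutations that
    fix the first p indices are counted by a cardinal, whose nonvanishing is what [wedge_star_phi]
    relies on. *)
Lemma det_delta_perm_sum (R : comNzRingType) (T : Type) (p q : nat) (e : 'I_(p + q) -> T)
    (w : ('I_p -> T) -> R) (k : 'S_(p + q)) :
  (forall s : 'S_p, w (fun a => e (k (lshift q (s a)))) =
     (-1) ^+ s * w (fun a => e (k (lshift q a)))) ->
  \sum_(s : 'S_(p + q)) w (fun a => e (s (lshift q a))) *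
    \det (\matrix_(a, b) (k (lshift q a) == s (lshift q b))%:R) =
  (p`! * #|[pred t : 'S_(p + q) | [forall a, t (lshift q a) == lshift q a]]|)%:R *
    w (fun a => e (k (lshift q a))).
Proof.
move=> wP; rewrite /determinant.
under eq_bigr do rewrite mulr_sumr.
rewrite exchange_big /=.
set N := #|_|.
rewrite (eq_bigr (fun=> N%:R * w (fun a => e (k (lshift q a))))) => [|s _].
  by rewrite sumr_const card_Sn natrM -mulrA [RHS]mulr_natl.
(* After this change of variable, the product of deltas attached to s is nonzero exactly when t
   fixes the first p indices. *)
have hin : injective (fun t : 'S_(p + q) => lblock_perm q (s^-1)%g * t * k)%g.
  by move=> t t' /mulIg/mulgI.
rewrite (reindex_inj hin) /=.
rewrite (bigID [pred t : 'S_(p + q) | [forall a, t (lshift q a) == lshift q a]]) /=.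
rewrite [X in _ + X]big1 ?addr0 => [|t]; last first.
  rewrite negb_forall => /existsP[a ta].
  rewrite (bigD1 a)//= mxE !permM lblock_permE permK (inj_eq perm_inj) eq_sym.
  by rewrite (negbTE ta) mul0r !mulr0.
rewrite (eq_bigr (fun=> w (fun a => e (k (lshift q a))))) => [|t /forallP tP].
  by rewrite sumr_const mulr_natl.
rewrite big1 ?mulr1 => [|a _]; last first.
  by rewrite mxE !permM lblock_permE permK (eqP (tP a)) eqxx.
have -> : (fun a => e ((lblock_perm q s^-1 * t * k)%g (lshift q a))) =
   (fun a => e (k (lshift q ((s^-1)%g a)))).
  by apply/funext => a; rewrite !permM lblock_permE (eqP (tP _)).
by rewrite wP odd_permV mulrAC -signr_addb addbb mul1r.
Qed.

(** Vanishing on equal arguments, polarised at the sum of two of them, gives the sign of a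
    transposition; a general permutation is a product of transpositions. *)
Lemma form_perm (R : realType) (X : diffSpace R) k (w : dform X k) (x : X)
    (v : 'I_k -> tvec X) (s : 'S_k) :
  is_form w -> (forall i, tangent x (v i)) ->
  w x (fun i => v (s i)) = (-1) ^+ s * w x v.
Proof.
move=> [wl wa _].
have swap i j (y : 'I_k -> tvec X) : (forall i, tangent x (y i)) -> i != j ->
    w x (fun a => y (tperm i j a)) = - w x y.
  move=> ty ij.
  pose F (p q : tvec X) : 'I_k -> tvec X := [eta [eta y with i |-> p] with j |-> q].
  have tF p q : tangent x p -> tangent x q -> forall a, tangent x (F p q a).
    by move=> tp tq a; rewrite /F /=; case: ifP => // _; case: ifP.
  have Fj p q q' : tangent x p -> tangent x q -> tangent x q' ->
      w x (F p (1 *: q + q')) = w x (F p q) + w x (F p q').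
    move=> tp tq tq'; have ty1 a : tangent x ([eta y with i |-> p] a).
      by rewrite /=; case: ifP.
    by rewrite /F wl// mul1r.
  have FC p q : F p q = [eta [eta y with j |-> q] with i |-> p].
    apply/funext => a; rewrite /F /=; case: (eqVneq a j) => [->|//].
    by rewrite eq_sym (negbTE ij).
  have Fi p p' q : tangent x p -> tangent x p' -> tangent x q ->
      w x (F (1 *: p + p') q) = w x (F p q) + w x (F p' q).
    move=> tp tp' tq; rewrite !FC; have ty1 a : tangent x ([eta y with j |-> q] a).
      by rewrite /=; case: ifP.
    by rewrite wl// mul1r.
  have F0 p : tangent x p -> w x (F p p) = 0.
    move=> tp; apply: (wa x _ i j) => //; first exact: tF.
    by rewrite /F /= eqxx (negbTE ij) eqxx.
  have ts : tangent x (1 *: y i + y j) by apply: tangent_scaleD.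
  have := F0 _ ts; rewrite Fj// !Fi// !F0// add0r addr0.
  have -> : F (y i) (y j) = y.
    apply/funext => a; rewrite /F /=; case: (eqVneq a j) => [->//|_].
    by case: (eqVneq a i) => [->|].
  have -> : F (y j) (y i) = (fun a => y (tperm i j a)).
    apply/funext => a; rewrite /F /=; case: (eqVneq a j) => [->|aj].
      by rewrite tpermR.
    by case: (eqVneq a i) => [->|ai]; rewrite ?tpermL// tpermD// eq_sym.
  by move/eqP; rewrite addrC addr_eq0 => /eqP ->; rewrite opprK.
move=> tv; have [ts -> dts] := prod_tpermP s.
elim: ts dts => [_|[i j] ts IH /= /andP[ij dts]].
  rewrite big_nil odd_perm1 expr0 mul1r; congr (w x _).
  by apply/funext => i; rewrite perm1.
rewrite big_cons odd_mul_tperm ij signr_addb -mulrA -IH//=.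
rewrite expr1 mulN1r -(swap i j)//.
by congr (w x _); apply/funext => a; rewrite permM.
Qed.

(* [l] is the Lehmer code: the permutation sends [i] to the [l i]-th of the values
   not yet taken. *)
Fixpoint code_perm (n : nat) (l : nat -> nat) : 'S_n :=
  match n with
  | 0 => 1%g
  | n'.+1 => lift_perm ord0 (inord (l 0)) (code_perm n' (fun i => l i.+1))
  end.

Fixpoint code_val (n : nat) (l : nat -> nat) (i : nat) : nat :=
  match n, i with
  | 0, _ => i
  | n'.+1, 0 => l 0
  | n'.+1, i'.+1 => bump (l 0) (code_val n' (fun i => l i.+1) i')
  end.

(** Each entry of the code counts inversions, so the sign of an explicit permutation reduces to the
    parity of a sum of numerals. *)
Lemma code_permP n l : (forall i, i < n -> i + l i < n)%N ->
  (forall i, code_perm n l i = code_val n l i :> nat) /\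
  odd_perm (code_perm n l) = odd (\sum_(i < n) l i).
Proof.
elim: n l => [|n IH] l ln.
  by split=> [[]//|]; rewrite big_ord0 odd_perm1.
have [|IHv IHs] := IH (fun i => l i.+1).
  by move=> i ni; have := ln i.+1 ni; rewrite addSn.
have l0 : (inord (l 0%N) : 'I_n.+1) = l 0%N :> nat.
  by rewrite inordK//; have := ln 0%N isT.
split=> [i|].
  rewrite /=; case: (unliftP ord0 i) => [i' ->|->].
    by rewrite lift_perm_lift /= l0 IHv.
  by rewrite lift_perm_id l0.
by rewrite /= odd_lift_perm IHs l0 big_ord_recl oddD.
Qed.

(** * Structure functions of an adapted frame *)

Lemma coframe_frame (R : realType) (M : oriented_manifold R 4)
    (g : M -> tvec M -> tvec M -> R) (rg : is_riemannian g)
    (fD : connection (sphere_bundle g) M) (u : sphere_bundle g) (e : 'I_4 -> tvec M)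
    (E : 'I_7 -> tvec (sphere_bundle g)) (I J : 'I_7) :
  adapted_frame fD u e E -> coframe fD u E I (E J) = (I == J)%:R.
Proof.
move=> [[te oe _] _ H V]; rewrite /coframe /sphere_metric.
have t0 : tangent (sproj u) (0 : tvec M) := tangent0 (sproj u).
have g0 x : tangent (sproj u) x -> g (sproj u) x 0 = 0.
  by move=> tx; rewrite (metricC rg)// (metric0l rg).
case: (fintype.split_ordP (I : 'I_(4 + 3))) => i ->;
  case: (fintype.split_ordP (J : 'I_(4 + 3))) => j ->.
- have [_ -> ->] := H i; have [_ -> ->] := H j; rewrite (metric0l rg)// addr0 oe.
  suff -> : (lshift 3 i == lshift 3 j :> 'I_7) = (i == j) by [].
  by apply/idP/idP => /eqP h; apply/eqP; [exact: (@lshift_inj 4 3 _ _ h)|rewrite h].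
- have [_ -> ->] := H i; have [_ -> ->] := V j; rewrite g0// (metric0l rg)// addr0.
  apply/esym/eqP; rewrite pnatr_eq0 eqb0.
  by apply/negP => /eqP/(congr1 val)/= /eqP; rewrite ltn_eqF// ltn_addr.
- have [_ -> ->] := V i; have [_ -> ->] := H j; rewrite g0// (metric0l rg)// addr0.
  apply/esym/eqP; rewrite pnatr_eq0 eqb0.
  by apply/negP => /eqP/(congr1 val)/= /eqP; rewrite gtn_eqF// ltn_addr.
- have [_ -> ->] := V i; have [_ -> ->] := V j; rewrite (metric0l rg)// add0r oe.
  suff -> : (rshift 4 i == rshift 4 j :> 'I_7) = (rshift 1 i == rshift 1 j) by [].
  by apply/idP/idP => /eqP h; apply/eqP;
    [rewrite (@rshift_inj 4 3 _ _ h)|rewrite (@rshift_inj 1 3 _ _ h)].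
Qed.

Section Brackets.
Context (R : realType) (M : oriented_manifold R 4)
  (g : M -> tvec M -> tvec M -> R) (rg : is_riemannian g)
  (D : connection M M) (DP : is_linear_connection D) (Dg : is_metric_connection g D)
  (fD : connection (sphere_bundle g) M)
  (fDP : is_pullback_connection (@sproj R 4 M g) D fD).
Let sM : smooth_space M := @mspace_smooth R 4 M.
Let sS : smooth_space (sphere_bundle g) := @sphere_smooth R 4 M g.
Let f : sphere_bundle g -> M := @sproj R 4 M g.
Let fsm : forall w, smooth_map_at f w := @sproj_smooth R 4 M g.
Let U : sphere_bundle g -> tvec M := @taut R 4 M g.
Let fDC : is_connection_along f fD := fDP.1.
Variables (b : 'I_4 -> M -> tvec M) (u : sphere_bundle g).
Hypothesis fb : local_frame g b (f u).
Variables (ee : 'I_4 -> sphere_bundle g -> tvec M)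
  (E : 'I_7 -> sphere_bundle g -> tvec (sphere_bundle g)).
Hypotheses (see : forall k, smooth_section_at f u (ee k))
  (sE : forall J, smooth_field_at u (E J))
  (nE : nearby u (fun w => adapted_frame fD w (fun k => ee k w) (fun J => E J w))).

Let p := f u.
Let e k := ee k u.
Let adu : adapted_frame fD u e (fun J => E J u) := nearby_point sS nE.

Let te k : tangent p (e k).
Proof. by have [[+ _ _] _ _ _] := adu; exact. Qed.

Let oe k l : g p (e k) (e l) = (k == l)%:R.
Proof. by have [[_ + _] _ _ _] := adu; exact. Qed.

Let tE J : tangent u (E J u) := section_tangent sS (sE J).

Definition conn_form J k l : R := g p (fD u (E J u) (ee k)) (e l).

Lemma conn_form_antisym J k l : conn_form J k l = - conn_form J l k.
Proof.
have := conn_metric rg DP Dg sS fsm fDP fb (tE J) (see k) (see l).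
rewrite (@tangent_eq _ _ sS u _ _ (fun=> (k == l)%:R) (tE J)).
  rewrite (tangent_cst sS _ (tE J)) (metricC rg (te k)).
    by move=> /esym/eqP; rewrite addr_eq0 => /eqP.
  exact: (conn_tangent fDC (tE J) (see l)).
by apply: (nearbyS sS) nE => w [[_ + _] _ _ _]; exact.
Qed.

Let tautE : nearby u (fun w => U w = ee ord0 w).
Proof. by apply: (nearbyS sS) nE => w [_ -> _ _]. Qed.

Lemma conn_form0_ver (i : 'I_3) l : conn_form (rshift 4 i) ord0 l = (rshift 1 i == l)%:R.
Proof.
rewrite /conn_form -(conn_eq sS fDC (tE _) (taut_section u) tautE).
by have [_ _ _ /(_ i)[_ _ ->]] := adu; rewrite oe.
Qed.

(** [hor J] and [ver J] agree with df E_J and (f^*D)U along E_J near u and not only at u, so they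
    can replace them under a derivative. *)
Definition hor (J : 'I_(4 + 3)) w : tvec M :=
  match fintype.split J with inl j => ee j w | inr _ => 0 end.

Definition ver (J : 'I_(4 + 3)) w : tvec M :=
  match fintype.split J with inl _ => 0 | inr i => ee (rshift 1 i) w end.

Let horE J : nearby u (fun w => differential f w (E J w) = hor J w).
Proof.
apply: (nearbyS sS) nE => w [_ _ H V]; rewrite /hor.
by case: (fintype.split_ordP (J : 'I_(4 + 3))) => j ->; [have [] := H j|have [] := V j].
Qed.

Let verE J : nearby u (fun w => fD w (E J w) U = ver J w).
Proof.
apply: (nearbyS sS) nE => w [_ _ H V]; rewrite /ver.
by case: (fintype.split_ordP (J : 'I_(4 + 3))) => j ->; [have [] := H j|have [] := V j].
Qed.

Let conn0 v : tangent u v -> fD u v (fun=> 0) = 0.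
Proof.
move=> tv.
have -> : (fun=> 0) = (fun y : sphere_bundle g => \sum_(i < 0) (0 : R) *: (0 : tvec M)).
  by apply/funext => y; rewrite big_ord0.
rewrite (conn_sum sS sM fDC (a := fun _ _ => 0) (s := fun _ _ => 0) tv); first by rewrite big_ord0.
- by case.
- by case.
Qed.

Let Br I J := bracket (E I) (E J) u.
Let tBr I J : tangent u (Br I J) := bracket_tangent sS (sE I) (sE J).

Let zero_section : smooth_section_at f u (fun=> 0).
Proof.
by split=> [|h sh]; [apply: (nearbyT sS) => y; exact: tangent0|exact: (smooth_cst sS)].
Qed.

Let ver_section J : smooth_section_at f u (ver J).
Proof. by rewrite /ver; case: (fintype.split _) => j. Qed.

Let hor_section J : smooth_section_at f u (hor J).
Proof. by rewrite /hor; case: (fintype.split _) => j. Qed.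

Lemma bracket_ver I J : fD u (Br I J) U =
  fD u (E I u) (ver J) - fD u (E J u) (ver I) - curvature_at D p (hor I u) (hor J u) (e ord0).
Proof.
rewrite (conn_curvature_at rg DP sS fsm fDP fb (sE I) (sE J) (taut_section u)).
have [_ _ _ _ sfD] := fDC.
rewrite (conn_eq sS fDC (tE I) (sfD _ _ _ (sE J) (taut_section u)) (verE J)).
rewrite (conn_eq sS fDC (tE J) (sfD _ _ _ (sE I) (taut_section u)) (verE I)).
rewrite (nearby_point sS (horE I)) (nearby_point sS (horE J)).
by rewrite -[taut u]/(U u) (nearby_point sS tautE).
Qed.

Lemma bracket_hor I J : hor I u = 0 -> differential f u (Br I J) =
  fD u (E I u) (hor J) - fD u (E J u) (hor I).
Proof.
move=> hI0; have dI0 : differential f u (E I u) = 0 by rewrite (nearby_point sS (horE I)).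
rewrite (push_bracket_vertical rg DP sS fsm fDP fb (sE I) (sE J) dI0).
have sp K := smooth_section_push sS sM fsm (sE K).
rewrite (conn_eq sS fDC (tE I) (sp J) (horE J)).
by rewrite (conn_eq sS fDC (tE J) (sp I) (horE I)).
Qed.

Definition struct (m I J : 'I_7) : R := coframe fD u (fun K => E K u) m (Br I J).

Lemma coframe_hor (j : 'I_4) v : tangent u v ->
  coframe fD u (fun K => E K u) (lshift 3 j) v = g p (e j) (differential f u v).
Proof.
move=> tv; rewrite /coframe /sphere_metric.
have [_ _ /(_ j)[_ -> ->] _] := adu.
by rewrite (metric0l rg) ?addr0//; exact: (conn_tangent fDC tv (taut_section u)).
Qed.

Lemma coframe_ver (i : 'I_3) v : tangent u v ->
  coframe fD u (fun K => E K u) (rshift 4 i) v = g p (e (rshift 1 i)) (fD u v U).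
Proof.
move=> tv; rewrite /coframe /sphere_metric.
have [_ _ _ /(_ i)[_ -> ->]] := adu.
by rewrite (metric0l rg) ?add0r//; exact: (differential_tangent sM (fsm u) tv).
Qed.

Lemma struct_antisym m I J : struct m I J = - struct m J I.
Proof.
have brN : Br I J = (-1) *: Br J I.
  apply/funext => h; rewrite !fctE /Br /bracket; case: asboolP => _.
    by rewrite /GRing.scale /= mulN1r opprB.
  by rewrite scaler0.
rewrite /struct brN; case: (fintype.split_ordP (m : 'I_(4 + 3))) => i ->.
  rewrite !coframe_hor//; last exact: tangent_scale.
  have := @differential_scaleD _ _ _ f u (-1) (Br J I) 0; rewrite !addr0.
  have -> : differential f u 0 = 0.
    by apply/funext => h; rewrite /differential; case: asboolP.
  rewrite addr0 => ->; have td := differential_tangent sM (fsm u) (tBr J I).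
  rewrite (metricC rg)//; last exact: tangent_scale.
  by rewrite (metricZl rg)// mulN1r (metricC rg).
rewrite !coframe_ver//; last exact: tangent_scale.
have := @conn_vec_sum _ _ _ _ _ fDC u 'I_1 (index_enum _) (fun=> -1) (fun=> Br J I) U.
rewrite !big_ord1 => ->//; last exact: taut_section.
have td := conn_tangent fDC (tBr J I) (taut_section u).
rewrite (metricC rg)//; last exact: tangent_scale.
by rewrite (metricZl rg)// mulN1r (metricC rg).
Qed.

Let curvature0 z : tangent p z -> curvature_at D p 0 0 z = 0.
Proof.
move=> tz; rewrite (curvature_at_frame rg DP fb (tangent0 p) (tangent0 p) tz).
apply: big1 => i _; apply: big1 => l _; apply: big1 => m _.
by rewrite (metric0l rg) ?mulr0 ?mul0r ?scale0r//; exact: (field_tangent (frame_fields fb l)).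
Qed.

Lemma struct_vhh (i : 'I_3) (j k : 'I_4) : struct (rshift 4 i) (lshift 3 j) (lshift 3 k) =
  - g p (curvature_at D p (e j) (e k) (e ord0)) (e (rshift 1 i)).
Proof.
rewrite /struct coframe_ver// bracket_ver.
have -> : ver (lshift 3 j) = fun=> 0 by rewrite /ver split_lshift.
have -> : ver (lshift 3 k) = fun=> 0 by rewrite /ver split_lshift.
rewrite !conn0// subr0 sub0r /hor !split_lshift.
have tc := curvature_at_tangent DP (te j) (te k) (te ord0).
rewrite -scaleN1r (metricC rg)//; last exact: tangent_scale.
by rewrite (metricZl rg)// mulN1r.
Qed.

Lemma struct_vvv (i j k : 'I_3) : struct (rshift 4 i) (rshift 4 j) (rshift 4 k) =
  conn_form (rshift 4 j) (rshift 1 k) (rshift 1 i) -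
  conn_form (rshift 4 k) (rshift 1 j) (rshift 1 i).
Proof.
rewrite /struct coframe_ver// bracket_ver.
have vE (l : 'I_3) : ver (rshift 4 l) = ee (rshift 1 l) by rewrite /ver split_rshift.
have hE (l : 'I_3) : hor (rshift 4 l) = fun=> 0 by rewrite /hor split_rshift.
rewrite !vE !hE curvature0// subr0.
have t1 := conn_tangent fDC (tE (rshift 4 j)) (see (rshift 1 k)).
have t2 := conn_tangent fDC (tE (rshift 4 k)) (see (rshift 1 j)).
rewrite (metricC rg)//; last exact: tangentB_vec.
by rewrite (metricBl rg).
Qed.

Lemma struct_hvh (i : 'I_3) (j k : 'I_4) : struct (lshift 3 j) (rshift 4 i) (lshift 3 k) =
  conn_form (rshift 4 i) k j.
Proof.
have hE : hor (rshift 4 i) = fun=> 0 by rewrite /hor split_rshift.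
rewrite /struct coframe_hor// bracket_hor; last by rewrite hE.
rewrite hE conn0// subr0 /hor split_lshift.
have t1 := conn_tangent fDC (tE (rshift 4 i)) (see k).
by rewrite (metricC rg).
Qed.

End Brackets.

(** * Combinatorics of the G2 form *)

(** [emono] with the multi-index as a function, so that the degree is literally 3 and not the size
    of a list. *)
Definition emono3 (R : realType) (V : Type) (th : 'I_7 -> V -> R) (K : nat -> nat)
    (v : 'I_3 -> V) : R :=
  \det (\matrix_(a < 3, b < 3) th (inord (K a)) (v b)).

Definition o1 : 'I_3 := lift ord0 ord0.
Definition o2 : 'I_3 := lift ord0 (lift ord0 ord0).

Definition triple_det (R : nzRingType) (i j k : nat) (x y z : nat -> R) : R :=
  x i * (y j * z k - z j * y k) - y i * (x j * z k - z j * x k)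
  + z i * (x j * y k - y j * x k).

(** The value of phi on vectors with coordinates x, y, z. The last sign is + because e^315 = -
    e^135. Any ring is allowed, so that the coefficients can be computed over the integers. *)
Definition g2_poly (R : nzRingType) (x y z : nat -> R) : R :=
  triple_det 4 5 6 x y z + triple_det 0 1 4 x y z + triple_det 0 2 5 x y z
  + triple_det 0 3 6 x y z - triple_det 1 2 6 x y z - triple_det 2 3 4 x y z
  + triple_det 1 3 5 x y z.

Lemma emono3E (R : realType) (V : Type) (th : 'I_7 -> V -> R) (K : nat -> nat) (v : 'I_3 -> V) :
  emono3 th K v = triple_det (K 0%N) (K 1%N) (K 2%N) (fun k => th (inord k) (v ord0))
    (fun k => th (inord k) (v o1)) (fun k => th (inord k) (v o2)).
Proof.
rewrite /emono3 /triple_det (expand_det_row _ ord0) !big_ord_recl big_ord0 /cofactor.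
rewrite !(expand_det_row _ ord0) !big_ord_recl !big_ord0 /cofactor !det_mx11 !mxE /=.
pose vn m := v (inord m).
have vE i : v i = vn (val i) by rewrite /vn inord_val.
by rewrite !vE /bump /=; ring.
Qed.

Lemma emono3_perm (R : realType) (V : Type) (th : 'I_7 -> V -> R) (K : nat -> nat)
    (v : 'I_3 -> V) (s : 'S_3) :
  emono3 th K (fun a => v (s a)) = (-1) ^+ s * emono3 th K v.
Proof.
rewrite /emono3; have -> : (\matrix_(a < 3, b < 3) th (inord (K a)) (v (s b))) =
    col_perm s (\matrix_(a < 3, b < 3) th (inord (K a)) (v b)).
  by apply/matrixP => i j; rewrite !mxE.
by rewrite col_permE det_mulmx det_perm odd_permV mulrC.
Qed.

Lemma wedge_mu_beta (R : realType) (V : Type) (th : 'I_7 -> V -> R) (v : 'I_3 -> V) :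
  wedge (mu_ th) (beta_ th) v = emono3 th (nth 0%N [:: 0; 1; 4]%N) v
    + emono3 th (nth 0%N [:: 0; 2; 5]%N) v + emono3 th (nth 0%N [:: 0; 3; 6]%N) v.
Proof.
have det2 (s : seq nat) (w : 'I_2 -> V) :
    \det (\matrix_(a < 2, b < 2) th (inord (nth 0%N s a)) (w b)) =
    th (inord (nth 0%N s 0)) (w 0) * th (inord (nth 0%N s 1)) (w 1) -
    th (inord (nth 0%N s 0)) (w 1) * th (inord (nth 0%N s 1)) (w 0).
  rewrite (expand_det_row _ ord0) !big_ord_recl big_ord0 /cofactor !det_mx11 !mxE /=.
  pose wn m := w (inord m).
  have wE i : w i = wn (val i) by rewrite /wn inord_val.
  by rewrite !wE /bump /=; ring.
have leibniz (i j k : nat) : emono3 th (nth 0%N [:: i; j; k]) v =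
    \sum_(s : 'S_3) (-1) ^+ s * (th (inord i) (v (s ord0)) *
      (th (inord j) (v (s (lift ord0 ord0))) * th (inord k) (v (s (lift ord0 (lift ord0 ord0)))))).
  by apply: eq_bigr => s _; rewrite !big_ord_recl big_ord0 mulr1 !mxE.
have swap (i j k : nat) : emono3 th (nth 0%N [:: i; k; j]) v = - emono3 th (nth 0%N [:: i; j; k]) v.
  by rewrite !emono3E /triple_det /=; ring.
(* The sum over S_3 of the wedge meets the 2 x 2 determinants of [beta_], which are already
   antisymmetrised; the 2 compensates for the factor 1! 2! of the normalisation. *)
have half (i j k : nat) : emono3 th (nth 0%N [:: i; j; k]) v = 2^-1 *
    (emono3 th (nth 0%N [:: i; j; k]) v - emono3 th (nth 0%N [:: i; k; j]) v).
  by rewrite (swap i j k) opprK; lra.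
rewrite (half 0 1 4)%N (half 0 2 5)%N (half 0 3 6)%N -!mulrDr /wedge; congr (_ * _).
rewrite !leibniz -!sumrB -!big_split /=; apply: eq_bigr => s _.
rewrite /beta_ /mu_ /emono det_mx11 mxE !det2 /=.
have -> : lshift 2 (0 : 'I_1) = (ord0 : 'I_3) by apply/val_inj.
have -> : rshift 1 (0 : 'I_2) = (lift ord0 ord0 : 'I_3) by apply/val_inj.
have -> : rshift 1 (1 : 'I_2) = (lift ord0 (lift ord0 ord0) : 'I_3) by apply/val_inj.
rewrite -!mulrBr -!mulrDr; congr (_ * (_ * (_ + _ + _)));
  by congr (_ - _); rewrite mulrC.
Qed.

(* [phi] is the sum of the [e^{g2_triple n}] with sign [g2_sign n]; the triple
   followed by its [g2_complement] is an even permutation, of code [g2_code n]. *)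
Definition g2_triple (n : nat) : seq nat :=
  nth [::] [:: [:: 4; 5; 6]; [:: 0; 1; 4]; [:: 0; 2; 5]; [:: 0; 3; 6]; [:: 1; 2; 6];
    [:: 2; 3; 4]; [:: 1; 3; 5]]%N n.

Definition g2_complement (n : nat) : seq nat :=
  nth [::] [:: [:: 0; 1; 2; 3]; [:: 2; 3; 5; 6]; [:: 1; 3; 4; 6]; [:: 1; 2; 4; 5];
    [:: 0; 3; 4; 5]; [:: 0; 1; 5; 6]; [:: 0; 2; 4; 6]]%N n.

Definition g2_code (n : nat) : seq nat :=
  nth [::] [:: [:: 4; 4; 4]; [:: 0; 0; 2]; [:: 0; 1; 3]; [:: 0; 2; 4]; [:: 1; 1; 4];
    [:: 2; 2; 2]; [:: 1; 2; 3]]%N n.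

Definition g2_sign (n : nat) : bool := (n == 4) || (n == 5).

(** The codes have three entries. The default 0 of [nth] supplies the other four, which lists the
    complementary indices in increasing order. *)
Definition g2_perm (n : 'I_7) : 'S_(3 + 4) := code_perm 7 (nth 0%N (g2_code n)).

Lemma g2_permP (n : 'I_7) :
  [/\ forall a : 'I_3, g2_perm n (lshift 4 a) = nth 0%N (g2_triple n) a :> nat,
      forall a : 'I_4, g2_perm n (rshift 3 a) = nth 0%N (g2_complement n) a :> nat
    & odd_perm (g2_perm n) = false].
Proof.
have code_lt i : (i < 7 -> i + nth 0 (g2_code n) i < 7)%N.
  by case: n => [[|[|[|[|[|[|[|//]]]]]]] nP]; case: i => [|[|[|i]]] //=;
    rewrite nth_nil addn0.
have [pv ps] := code_permP code_lt.
split=> [a|a|].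
- rewrite [LHS]pv; case: n {pv ps code_lt} => [[|[|[|[|[|[|[|//]]]]]]] nP];
    by case: a => [[|[|[|//]]] aP].
- rewrite [LHS]pv; case: n {pv ps code_lt} => [[|[|[|[|[|[|[|//]]]]]]] nP];
    by case: a => [[|[|[|[|//]]]] aP].
- rewrite ps !big_ord_recl big_ord0.
  by case: n {pv ps code_lt} => [[|[|[|[|[|[|[|//]]]]]]] nP].
Qed.

Lemma g2_formE (R : realType) (V : Type) (th : 'I_7 -> V -> R) (v : 'I_3 -> V) :
  alpha_ th v + wedge (mu_ th) (beta_ th) v - alpha2_ th v =
  \sum_(n < 7) (-1) ^+ g2_sign n * emono3 th (nth 0%N (g2_triple n)) v.
Proof.
rewrite wedge_mu_beta /alpha_ /alpha2_.
rewrite -[emono th [:: 4; 5; 6]%N v]/(emono3 th (nth 0%N [:: 4; 5; 6]%N) v).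
rewrite -[emono th [:: 1; 2; 6]%N v]/(emono3 th (nth 0%N [:: 1; 2; 6]%N) v).
rewrite -[emono th [:: 2; 3; 4]%N v]/(emono3 th (nth 0%N [:: 2; 3; 4]%N) v).
rewrite -[emono th [:: 3; 1; 5]%N v]/(emono3 th (nth 0%N [:: 3; 1; 5]%N) v).
have -> : emono3 th (nth 0%N [:: 3; 1; 5]%N) v = - emono3 th (nth 0%N [:: 1; 3; 5]%N) v.
  by rewrite !emono3E /triple_det /=; ring.
by rewrite !big_ord_recl big_ord0 /=; ring.
Qed.

Lemma g2_formE_poly (R : realType) (V : Type) (th : 'I_7 -> V -> R) (v : 'I_3 -> V) :
  alpha_ th v + wedge (mu_ th) (beta_ th) v - alpha2_ th v =
  g2_poly (fun k => th (inord k) (v ord0)) (fun k => th (inord k) (v o1))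
    (fun k => th (inord k) (v o2)).
Proof.
rewrite g2_formE !big_ord_recl big_ord0 !emono3E /=.
by rewrite /g2_poly; ring.
Qed.

Definition delta_nat (R : nzRingType) (c k : nat) : R := (k == c)%:R.

(** Brings the values of phi on basis vectors to the integers, where they are computed; the ring R
    is abstract. *)
Lemma g2_poly_int (R : comNzRingType) (a b c : nat) :
  g2_poly (delta_nat R a) (delta_nat R b) (delta_nat R c) =
  (g2_poly (delta_nat int a) (delta_nat int b) (delta_nat int c))%:~R.
Proof.
by rewrite /g2_poly /triple_det /delta_nat !(rmorphD, rmorphN, rmorphM) /= !rmorph_nat.
Qed.

(** The complements span coassociative 4-planes, on which phi vanishes. Every term of tau_1 /\ phi
    on such a plane evaluates phi on three of its vectors, so that form has no component there. *)
Lemma g2_poly_complement (R : comNzRingType) (n : 'I_7) (a b c : 'I_4) :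
  g2_poly (delta_nat R (nth 0%N (g2_complement n) a)) (delta_nat R (nth 0%N (g2_complement n) b))
    (delta_nat R (nth 0%N (g2_complement n) c)) = 0.
Proof.
rewrite g2_poly_int; suff -> : g2_poly (delta_nat int (nth 0%N (g2_complement n) a))
  (delta_nat int (nth 0%N (g2_complement n) b)) (delta_nat int (nth 0%N (g2_complement n) c)) = 0 by [].
case: n => [[|[|[|[|[|[|[|//]]]]]]] nP]; case: a => [[|[|[|[|//]]]] aP];
  case: b => [[|[|[|[|//]]]] bP]; by case: c => [[|[|[|[|//]]]] cP]; vm_compute.
Qed.

Lemma g2_poly_triple (R : comNzRingType) (n : 'I_7) :
  g2_poly (delta_nat R (nth 0%N (g2_triple n) 0)) (delta_nat R (nth 0%N (g2_triple n) 1))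
    (delta_nat R (nth 0%N (g2_triple n) 2)) = (-1) ^+ g2_sign n.
Proof.
rewrite g2_poly_int; suff -> : g2_poly (delta_nat int (nth 0%N (g2_triple n) 0))
  (delta_nat int (nth 0%N (g2_triple n) 1)) (delta_nat int (nth 0%N (g2_triple n) 2)) =
  (-1) ^+ g2_sign n by rewrite rmorph_sign.
by case: n => [[|[|[|[|[|[|[|//]]]]]]] nP]; vm_compute.
Qed.

(** * The exterior derivative of a form with constant coefficients, in terms of structure functions:
    [T a b m] stands for e^m([e_a, e_b]) *)

Definition koszul_sum (R : comNzRingType) (T : nat -> nat -> nat -> R) (c : nat -> nat) : R :=
  \sum_(i < 4) \sum_(j < 3 | (i <= j)%N) (-1) ^+ (i + j.+1) *
    g2_poly (T (c i) (c (lift i j)))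
      (delta_nat R (c (lift i (lift j (ord0 : 'I_2)))))
      (delta_nat R (c (lift i (lift j (lift ord0 ord0 : 'I_2))))).

Lemma koszul_sumE (R : comNzRingType) (T : nat -> nat -> nat -> R) (c : nat -> nat) :
  let G a b x y := g2_poly (T (c a) (c b)) (delta_nat R (c x)) (delta_nat R (c y)) in
  koszul_sum T c = - G 0%N 1%N 2%N 3%N + G 0%N 2%N 1%N 3%N - G 0%N 3%N 1%N 2%N - G 1%N 2%N 0%N 3%N + G 1%N 3%N 0%N 2%N - G 2%N 3%N 0%N 1%N.
Proof.
move=> G; rewrite /koszul_sum; under eq_bigr do rewrite big_mkcond /=.
rewrite !big_ord_recl !big_ord0 /= /bump /= -!/(G _ _ _ _).
by move: G => G; ring.
Qed.

Lemma g2_poly_delta (R : comNzRingType) (x : nat -> R) (b c : nat) :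
  g2_poly x (delta_nat R b) (delta_nat R c) =
  \sum_(m < 7) x m * (g2_poly (delta_nat int m) (delta_nat int b) (delta_nat int c))%:~R.
Proof.
under eq_bigr do rewrite -g2_poly_int.
rewrite !big_ord_recl big_ord0 /bump /=.
rewrite /g2_poly /triple_det.
move: (delta_nat R b) (delta_nat R c) => y z.
rewrite /delta_nat /=; ring.
Qed.

(** The sum over a < b and m of phi_(abm) [T a b m], three terms for each monomial of phi. A
    monomial has one or three vertical indices, so neither the horizontal part of a bracket of
    horizontal fields nor the vertical part of a mixed bracket occurs. *)
Definition g2_trace (R : comNzRingType) (T : nat -> nat -> nat -> R) : R :=
  T 0%N 1%N 4%N + T 1%N 4%N 0%N - T 0%N 4%N 1%N + T 0%N 2%N 5%N + T 2%N 5%N 0%N - T 0%N 5%N 2%N + T 0%N 3%N 6%N + T 3%N 6%N 0%N - T 0%N 6%N 3%N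
  - T 1%N 2%N 6%N - T 2%N 6%N 1%N + T 1%N 6%N 2%N + T 1%N 3%N 5%N + T 3%N 5%N 1%N - T 1%N 5%N 3%N - T 2%N 3%N 4%N - T 3%N 4%N 2%N + T 2%N 4%N 3%N
  + T 5%N 6%N 4%N - T 4%N 6%N 5%N + T 4%N 5%N 6%N.

Definition g2_coef (m b c : nat) : int :=
  g2_poly (delta_nat int m) (delta_nat int b) (delta_nat int c).

(** The index of the basis vector which, up to sign, is the cross product of e_b and e_c defined by
    phi. For b = c no index qualifies and [find] returns 7. *)
Definition g2_cross (b c : nat) : nat := find (fun m => g2_coef m b c != 0) (iota 0 7).

Lemma g2_poly_cross (R : comNzRingType) (x : nat -> R) (b c : 'I_7) : b != c ->
  g2_poly x (delta_nat R b) (delta_nat R c) = x (g2_cross b c) * (g2_coef (g2_cross b c) b c)%:~R.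
Proof.
move=> bc; rewrite g2_poly_delta -/(g2_coef _ _ _).
have [m7 H] : (g2_cross b c < 7)%N /\ all (fun m => (m != g2_cross b c) ==> (g2_coef m b c == 0)) (iota 0 7).
  by case: b bc => [[|[|[|[|[|[|[|//]]]]]]] bP]; case: c => [[|[|[|[|[|[|[|//]]]]]]] cP] //= _; vm_compute.
rewrite (bigD1 (Ordinal m7))//= big1 ?addr0// => m mb.
have := allP H m; rewrite mem_iota ltn_ord => /(_ isT)/implyP/(_ mb)/eqP.
by rewrite /g2_coef => ->; rewrite mulr0.
Qed.

(** Replaces each phi(x, e_b, e_c) by plus or minus one coordinate of x, leaving [ring] a linear
    identity in the entries of [T]. *)
Ltac g2_cross_compute :=
  repeat match goal with |- context [g2_poly ?x (delta_nat ?R ?b) (delta_nat ?R ?c)] =>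
    let m := eval vm_compute in (g2_cross b c) in
    let a := eval vm_compute in (g2_coef m b c) in
    rewrite (_ : g2_poly x (delta_nat R b) (delta_nat R c) = x m * a%:~R);
    [|exact: (@g2_poly_cross R x (@Ordinal 7 b isT) (@Ordinal 7 c isT) isT)] end.

(** The contraction identity for phi and star phi: over ordered pairs (c, d), the sum of phi_(mcd)
    times the component abcd of star phi is 4 phi_(mab) up to the sign convention. The Koszul
    formula uses unordered pairs, whence 2. *)
Lemma koszul_sum_g2 (R : comNzRingType) (T : nat -> nat -> nat -> R) :
  \sum_(n < 7) (-1) ^+ g2_sign n * koszul_sum T (nth 0%N (g2_complement n)) = 2 * g2_trace T.
Proof.
rewrite !big_ord_recl big_ord0; do !rewrite koszul_sumE /=.
g2_cross_compute.
rewrite /g2_trace.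
ring.
Qed.

(** * The scalar torsion form *)

Lemma g2_poly_eq (R : nzRingType) (x y z x' y' z' : nat -> R) :
  (forall k, (k < 7)%N -> x k = x' k) -> (forall k, (k < 7)%N -> y k = y' k) ->
  (forall k, (k < 7)%N -> z k = z' k) -> g2_poly x y z = g2_poly x' y' z'.
Proof. by move=> hx hy hz; rewrite /g2_poly /triple_det !hx// !hy// !hz. Qed.

Section G2Torsion.
Context (R : realType) (M : oriented_manifold R 4)
  (g : M -> tvec M -> tvec M -> R) (rg : is_riemannian g)
  (fD : connection (sphere_bundle g) M)
  (phi : dform (sphere_bundle g) 3) (phiP : is_G2_form fD phi).
Let sS : smooth_space (sphere_bundle g) := @sphere_smooth R 4 M g.

Section Pointwise.
Variables (u : sphere_bundle g) (e : 'I_4 -> tvec M) (E : 'I_7 -> tvec (sphere_bundle g)).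
Hypothesis ad : adapted_frame fD u e E.

Lemma adapted_frame_tangent J : tangent u (E J).
Proof.
have [_ _ H V] := ad.
by case: (fintype.split_ordP (J : 'I_(4 + 3))) => j ->; [have [] := H j|have [] := V j].
Qed.

Lemma coframe_delta k J : (k < 7)%N -> coframe fD u E (inord k) (E J) = delta_nat R J k.
Proof. by move=> k7; rewrite (coframe_frame rg _ _ ad) /delta_nat -val_eqE /= inordK. Qed.

Lemma phi_poly v : (forall i, tangent u (v i)) ->
  phi u v = g2_poly (fun k => coframe fD u E (inord k) (v ord0))
    (fun k => coframe fD u E (inord k) (v o1)) (fun k => coframe fD u E (inord k) (v o2)).
Proof. by move=> tv; rewrite (phiP ad tv) g2_formE_poly. Qed.

Lemma phi_basis (K : 'I_3 -> 'I_7) : phi u (fun a => E (K a)) =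
  g2_poly (delta_nat R (K ord0)) (delta_nat R (K o1)) (delta_nat R (K o2)).
Proof.
rewrite phi_poly; last by move=> a; exact: adapted_frame_tangent.
by apply: g2_poly_eq => k k7; rewrite coframe_delta.
Qed.

Lemma phi_perm v (s : 'S_3) : (forall i, tangent u (v i)) ->
  phi u (fun a => v (s a)) = (-1) ^+ s * phi u v.
Proof.
move=> tv; rewrite (phiP ad tv) (phiP (v := fun a => v (s a)) ad)// !g2_formE mulr_sumr.
by apply: eq_bigr => n _; rewrite emono3_perm mulrCA.
Qed.

Lemma hodge_phi_basis (s : 'S_(3 + 4)) :
  hodge (p := 3) (q := 4) (coframe fD u E) E (phi u) (fun b => E (s (rshift 3 b))) =
  (-1) ^+ s * phi u (fun a => E (s (lshift 4 a))).
Proof.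
apply: (@hodge_basis _ _ 3 4 (coframe fD u E) E) => [i j|t]; first exact: (coframe_frame rg _ _ ad).
by apply: (phi_perm (v := fun a => E (s (lshift 4 a)))) => i; exact: adapted_frame_tangent.
Qed.

Lemma phi_triple (n : 'I_7) : phi u (fun a => E (g2_perm n (lshift 4 a))) = (-1) ^+ g2_sign n.
Proof.
have [pv _ _] := g2_permP n.
by rewrite (phi_basis (fun a => g2_perm n (lshift 4 a))) !pv -(g2_poly_triple R n).
Qed.

Lemma wedge1_phi_complement (t : ('I_1 -> tvec (sphere_bundle g)) -> R) (n : 'I_7) :
  wedge t (phi u) (fun b : 'I_(1 + 3) => E (g2_perm n (rshift 3 b))) = 0.
Proof.
have [_ pv _] := g2_permP n.
rewrite /wedge big1 ?mulr0// => s _.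
rewrite (phi_basis (fun j => g2_perm n (rshift 3 (s (rshift 1 j))))) !pv.
by rewrite g2_poly_complement !mulr0.
Qed.

Lemma phi_sum v : (forall i, tangent u (v i)) -> phi u v =
  \sum_(n < 7) (-1) ^+ g2_sign n *
    \det (\matrix_(a < 3, b < 3) coframe fD u E (g2_perm n (lshift 4 a)) (v b)).
Proof.
move=> tv; rewrite (phiP ad tv) g2_formE; apply: eq_bigr => n _; congr (_ * \det _).
apply/matrixP => a b; rewrite !mxE.
have [pv _ _] := g2_permP n.
by rewrite -pv inord_val.
Qed.

Lemma form_perm_basis (t : dform (sphere_bundle g) 3) (k : 'S_(3 + 4)) (s : 'S_3) : is_form t ->
  t u (fun a => E (k (lshift 4 (s a)))) = (-1) ^+ s * t u (fun a => E (k (lshift 4 a))).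
Proof.
move=> ft; apply: (form_perm (v := fun a => E (k (lshift 4 a))) s ft) => i.
exact: adapted_frame_tangent.
Qed.

(* [t /\ star phi = <t, phi> vol] *)
Lemma wedge_star_phi (t : dform (sphere_bundle g) 3) : is_form t ->
  wedge (t u) (hodge (p := 3) (q := 4) (coframe fD u E) E (phi u)) E = 0 ->
  \sum_(n < 7) (-1) ^+ g2_sign n * t u (fun a => E (g2_perm n (lshift 4 a))) = 0.
Proof.
move=> ft; rewrite /wedge => /eqP; rewrite mulf_eq0 invr_eq0 pnatr_eq0.
have -> : (3`! * 4`! == 0)%N = false by [].
move=> /eqP.
set N := #|[pred s : 'S_(3 + 4) | [forall a : 'I_3, s (lshift 4 a) == lshift 4 a]]|.
have N0 : (3`! * N)%:R != 0 :> R.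
  rewrite pnatr_eq0 muln_eq0 negb_or /= -lt0n; apply/card_gt0P.
  by exists 1%g; apply/forallP => a; rewrite perm1.
under eq_bigr => s _.
  rewrite hodge_phi_basis mulrCA [X in _ * X]mulrA -signr_addb addbb mul1r.
  rewrite phi_sum; last by move=> i; exact: adapted_frame_tangent.
  rewrite mulr_sumr; under eq_bigr do rewrite mulrCA.
  over.
rewrite exchange_big /= => H; apply: (mulfI N0); rewrite mulr0 -[RHS]H mulr_sumr.
apply: eq_bigr => n _; rewrite -mulr_sumr mulrCA; congr (_ * _).
rewrite -(@det_delta_perm_sum _ _ 3 4 E) => [|s]; last exact: form_perm_basis.
apply: eq_bigr => s _; congr (_ * \det _); apply/matrixP => a b.
by rewrite !mxE (coframe_frame rg _ _ ad).
Qed.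

End Pointwise.

Section Local.
Variables (u : sphere_bundle g) (ee : 'I_4 -> sphere_bundle g -> tvec M)
  (E : 'I_7 -> sphere_bundle g -> tvec (sphere_bundle g)).
Hypotheses (sE : forall J, smooth_field_at u (E J))
  (nE : nearby u (fun w => adapted_frame fD w (fun k => ee k w) (fun J => E J w))).

Let tE J : tangent u (E J u) := section_tangent sS (sE J).

(* On a frame in which [phi] has constant coefficients, only the bracket terms of
   the Koszul formula remain. *)
Lemma ext_d_phi (J : 'I_4 -> 'I_7) (c : nat -> nat) : (forall i, J i = c i :> nat) ->
  ext_d phi (fun i => E (J i)) u =
  koszul_sum (fun a b m => struct fD u E (inord m) (inord a) (inord b)) c.
Proof.
move=> Jc; have ad := nearby_point sS nE.
rewrite /ext_d big1 ?add0r => [|i _]; last first.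
  rewrite (@tangent_eq _ _ sS u _ _ (fun=> g2_poly (delta_nat R (c (lift i ord0)))
    (delta_nat R (c (lift i o1))) (delta_nat R (c (lift i o2)))) (tE _)).
    by rewrite (tangent_cst sS _ (tE _)) mulr0.
  apply: (nearbyS sS) nE => w adw.
  by rewrite (phi_basis adw (fun a => J (lift i a))) !Jc.
rewrite /koszul_sum; apply: eq_bigr => i _; apply: eq_bigr => j _; congr (_ * _).
have tB : tangent u (bracket (E (J i)) (E (J (lift i j))) u) by exact: bracket_tangent.
rewrite (phi_poly ad); last first.
  by move=> a; rewrite /fcons; case: (unliftP ord0 a) => [a' _|_] /=; [exact: tE|exact: tB].
rewrite /fcons unlift_none /o1 /o2 !liftK /=.
apply: g2_poly_eq => k k7; rewrite ?(coframe_delta ad)// ?Jc//.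
by rewrite /struct -(Jc i) -(Jc (lift i j)) !inord_val.
Qed.

Lemma torsion_trace (tau0 : sphere_bundle g -> R) (tau1 : dform (sphere_bundle g) 1)
    (tau3 : dform (sphere_bundle g) 3) : torsion_decomposition fD phi tau0 tau1 tau3 ->
  7 * tau0 u = 2 * g2_trace (fun a b m => struct fD u E (inord m) (inord a) (inord b)).
Proof.
move=> [_ _ ft3 tau3P dphiP]; have ad := nearby_point sS nE.
have [_ /(_ (fun i => E i u) (adapted_frame_tangent ad)) t3] := tau3P _ _ _ ad.
have := wedge_star_phi ad ft3 t3; rewrite -koszul_sum_g2 => t30.
(* On the n-th complement star(phi) and star(tau_3) take the values of phi and tau_3 on the n-th
   triple, the permutation being even. Weighted by signs and summed, the former gives 7 and the
   latter <tau_3, phi> = 0. *)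
have dn (n : 'I_7) : koszul_sum (fun a b m => struct fD u E (inord m) (inord a) (inord b))
    (nth 0%N (g2_complement n)) =
    tau0 u * (-1) ^+ g2_sign n + tau3 u (fun a => E (g2_perm n (lshift 4 a)) u).
  have [_ pv sg] := g2_permP n.
  rewrite -(ext_d_phi (J := fun b => g2_perm n (rshift 3 b)) pv).
  have := dphiP _ _ _ ad (fun b => E (g2_perm n (rshift 3 b))) (fun b => sE _).
  move=> /= ->; rewrite (wedge1_phi_complement ad) mulr0 addr0.
  rewrite (hodge_phi_basis ad) sg mul1r (phi_triple ad); congr (_ + _).
  rewrite (@hodge_basis _ _ 3 4 (coframe fD u (fun J => E J u)) (fun J => E J u)) ?sg ?mul1r//.
    by move=> i j; exact: (coframe_frame rg _ _ ad).
  by move=> s; exact: (form_perm_basis ad).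
under eq_bigr do rewrite dn mulrDr mulrCA -signr_addb addbb mulr1.
by rewrite big_split /= t30 addr0 sumr_const card_ord mulr_natl.
Qed.

End Local.

End G2Torsion.

Lemma g2_trace_curvature (R : realType) (M : oriented_manifold R 4)
    (g : M -> tvec M -> tvec M -> R) (rg : is_riemannian g)
    (D : connection M M) (DP : is_linear_connection D) (Dg : is_metric_connection g D)
    (fD : connection (sphere_bundle g) M)
    (fDP : is_pullback_connection (@sproj R 4 M g) D fD)
    (b : 'I_4 -> M -> tvec M) (u : sphere_bundle g) (fb : local_frame g b (sproj u))
    (ee : 'I_4 -> sphere_bundle g -> tvec M)
    (E : 'I_7 -> sphere_bundle g -> tvec (sphere_bundle g))
    (see : forall k, smooth_section_at (@sproj R 4 M g) u (ee k))
    (sE : forall J, smooth_field_at u (E J))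
    (nE : nearby u (fun w => adapted_frame fD w (fun k => ee k w) (fun J => E J w)))
    (eb : forall k, ee k u = b k (sproj u)) :
  let e k := ee k u in
  g2_trace (fun a b m => struct fD u E (inord m) (inord a) (inord b)) =
  ricci g D (sproj u) e (e ord0) (e ord0) - l_coef g D (sproj u) e + 6.
Proof.
move=> e; set S := fun a b m => _.
pose W i k l := conn_form fD u ee E (rshift 4 (inord i : 'I_3)) (inord k) (inord l).
pose K i j k l := Rcoef g D (sproj u) e i j k l.
have hE k : (k < 4)%N -> (inord k : 'I_7) = lshift 3 (inord k : 'I_4).
  by move=> k4; apply/val_inj; rewrite /= !inordK// (leq_trans k4).
(* The vertical index 4 + i corresponds to e_(i+1), hence the shift from ['I_3] to ['I_4]. *)
have vE i : (i < 3)%N -> (inord (4 + i) : 'I_7) = rshift 4 (inord i : 'I_3).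
  by move=> i3; apply/val_inj; rewrite /= !inordK// ltn_add2l.
have rE i : (i < 3)%N -> rshift 1 (inord i : 'I_3) = (inord i.+1 : 'I_4).
  by move=> i3; apply/val_inj; rewrite /= !inordK.
have zE : (inord 0 : 'I_4) = ord0 by apply/val_inj; rewrite /= inordK.
have Sa x y m : S x y m = - S y x m by exact: (struct_antisym rg fDP sE nE).
have Svhh i j k : (i < 3)%N -> (j < 4)%N -> (k < 4)%N -> S j k (4 + i)%N = - K j k 0%N i.+1.
  move=> i3 j4 k4; rewrite /S vE// !hE// (struct_vhh rg DP fDP fb sE nE).
  by rewrite /K /Rcoef rE// zE.
have Shvh i j k : (i < 3)%N -> (j < 4)%N -> (k < 4)%N -> S (4 + i)%N k j = W i k j.
  by move=> i3 j4 k4; rewrite /S vE// !hE// (struct_hvh rg DP fDP fb see sE nE).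
have Svvv i j k : (i < 3)%N -> (j < 3)%N -> (k < 3)%N ->
    S (4 + j)%N (4 + k)%N (4 + i)%N = W j k.+1 i.+1 - W k j.+1 i.+1.
  by move=> i3 j3 k3; rewrite /S !vE// (struct_vvv rg DP fDP fb see sE nE) !rE.
have W0 i l : (i < 3)%N -> W i 0%N l = (inord i.+1 == inord l :> 'I_4)%:R.
  by move=> i3; rewrite /W zE (conn_form0_ver fDP sE nE) rE.
have Wa i k l : W i k l = - W i l k by exact: (conn_form_antisym rg DP Dg fDP fb see sE nE).
have Ka i j k l : K i j k l = - K i j l k.
  by rewrite /K /Rcoef /e !eb; exact: (curvature_at_antisym rg DP Dg _ _ _ _ fb).
(* With third index 0, skew-symmetry of the curvature in its first two indices is read from that of
   the bracket. *)
have Kb i j k : (i < 4)%N -> (j < 4)%N -> (k < 3)%N -> K i j 0%N k.+1 = - K j i 0%N k.+1.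
  by move=> i4 j4 k3; have := Sa i j (4 + k)%N; rewrite !Svhh// opprK => <-; rewrite opprK.
(* The term j = 0 of the Ricci trace. *)
have K0 : K 0%N 0%N 0%N 0%N = 0.
  by have /eqP := Ka 0%N 0%N 0%N 0%N; rewrite -addr_eq0 -mulr2n mulrn_eq0 => /eqP.
have -> : ricci g D (sproj u) e (e ord0) (e ord0) = K 1%N 0%N 0%N 1%N + K 2%N 0%N 0%N 2%N + K 3%N 0%N 0%N 3%N.
  pose en k : tvec M := e (inord k).
  have eE i : e i = en (val i) by rewrite /en inord_val.
  rewrite /ricci !big_ord_recl big_ord0 !eE /= -!/(K _ _ _ _).
  by rewrite -[X in X + _]/(K 0%N 0%N 0%N 0%N) K0 add0r addr0 addrA.
rewrite /l_coef -!/(K _ _ _ _) /g2_trace.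
(* Vertical parts of brackets of horizontal fields: the terms of mu /\ beta give - R_(0i0i) =
   R_(i00i), hence r; those of alpha_2 give - l. *)
rewrite (Svhh 0 0 1)%N// (Svhh 1 0 2)%N// (Svhh 2 0 3)%N// (Svhh 2 1 2)%N// (Svhh 1 1 3)%N// (Svhh 0 2 3)%N//.
rewrite (Sa 1 4)%N (Sa 2 5)%N (Sa 3 6)%N (Sa 2 6)%N (Sa 3 5)%N (Sa 3 4)%N.
rewrite (Sa 0 4 1)%N (Sa 0 5 2)%N (Sa 0 6 3)%N (Sa 1 6)%N (Sa 1 5)%N (Sa 2 4)%N.
rewrite (Svvv 0 1 2)%N// (Svvv 1 0 2)%N// (Svvv 2 0 1)%N//.
rewrite !(Shvh 0)%N// !(Shvh 1)%N// !(Shvh 2)%N//.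
(* Each i contributes 1 twice, through e^0([e_i, e_(i+3)]) and through - e^i([e_0, e_(i+3)]): this
   is the 6. *)
rewrite (Wa 0 1 0)%N (Wa 1 2 0)%N (Wa 2 3 0)%N !W0// !eqxx !mulr1n.
(* The other mixed brackets and the brackets of vertical fields involve the same three connection
   coefficients, with factors -2 and 2. *)
rewrite (Wa 1 3 1)%N (Wa 2 2 1)%N (Wa 0 3 2)%N.
rewrite (Kb 0 1 0)%N// (Kb 0 2 1)%N// (Kb 0 3 2)%N//.
rewrite (Ka 1 2 3 0)%N (Ka 2 3 1 0)%N (Ka 3 1 2 0)%N (Kb 3 1 1)%N//.
clearbody S K W.
ring.
Qed.

Theorem proposition3p4 (R : realType) (M : oriented_manifold R 4)
    (g : M -> tvec M -> tvec M -> R) (g_riemannian : is_riemannian g)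
    (D : connection M M) (D_linear : is_linear_connection D)
    (D_metric : is_metric_connection g D)
    (fD : connection (sphere_bundle g) M)
    (fD_pullback : is_pullback_connection (@sproj R 4 M g) D fD)
    (phi : dform (sphere_bundle g) 3) (phi_G2 : is_G2_form fD phi)
    (tau0 : sphere_bundle g -> R) (tau1 : dform (sphere_bundle g) 1)
    (tau3 : dform (sphere_bundle g) 3)
    (dphi : torsion_decomposition fD phi tau0 tau1 tau3)
    (u : sphere_bundle g) (e : 'I_4 -> tvec M)
    (E : 'I_7 -> tvec (sphere_bundle g)) (e_adapted : adapted_frame fD u e E) :
  tau0 u = 2 / 7 * (ricci g D (sproj u) e (taut u) (taut u)
                    - l_coef g D (sproj u) e + 6).
Proof.
have [ed e0 _ _] := e_adapted; have [te oe _] := ed.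
have [b [fb be]] := gram_schmidt g_riemannian te oe.
have bE : b^~ (sproj u) = e by apply/funext.
have bd : direct_orthonormal g (sproj u) (b^~ (sproj u)) by rewrite bE.
have b0 : b ord0 (sproj u) = taut u by rewrite be.
have [F [sF nF]] := adapted_frame_field g_riemannian D_linear D_metric fD_pullback fb bd b0.
have eb := adapted_section_at fb b0.
have := torsion_trace g_riemannian phi_G2 sF nF dphi.
rewrite (g2_trace_curvature g_riemannian D_linear D_metric fD_pullback fb
  (adapted_section_smooth g_riemannian fb) sF nF eb).
(* At u the field of frames is the given frame, in which r and l are to be read. *)
have -> : (adapted_section b)^~ u = e by apply/funext => k; rewrite eb be.
rewrite eb be e0 => H.
have : 7 * tau0 u = 7 * (2 / 7 * (ricci g D (sproj u) e (taut u) (taut u)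
  - l_coef g D (sproj u) e + 6)) by rewrite H; field.
by apply: mulfI; rewrite pnatr_eq0.
Qed.
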